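(* Let $H$ be a finite dimensional hereditary algebra over a field $K$ of rank $n\ge2$, and let $\frac{A}{B}$ be an indecomposable balanced pair over $H$. If $A\ne0$, the covering wall of $g\left(\frac{A}{B}\right)$ is $\mathcal{D}_H(A)$. If $B\neq0$, the flooring wall of $g\left(\frac{A}{B}\right)$ is $\mathcal{D}_H(B)$.
   Context: Write $\Lambda=H$. Modules are finitely generated right $\Lambda$-modules; $S_1,\dots,S_n$ are the simple modules up to isomorphism and $n$ is the rank of $\Lambda$. $\underline{\dim}\,M\in\mathbb{Z}^n$ is the vector of multiplicities of the $S_i$ in a composition series of $M$. $\tau$ is the Auslander-Reiten translate. For $v,w\in\mathbb{R}^n$ put $v\ast w=\sum_i v_iw_i\dim_K S_i$, and $\eta=(1,\dots,1)$. Balanced pairs: a pair of modules, written $\frac{A}{B}$, is a balanced pair if (1) $\mathrm{Hom}_\Lambda(A,B)=0$; (2) $B\cong\tau A\sqcup I$ with $I$ injective; (3) $A\cong\tau^{-1}B\sqcup P$ with $P$ projective ($\sqcup$ is direct sum). Direct sums are componentwise (components may be zero); pairs are considered up to isomorphism and without repeated indecomposable summands. The indecomposable balanced pairs are $\frac{A}{\tau A}$ ($A$ indecomposable nonprojective $\tau$-rigid, where $\tau$-rigid means $\mathrm{Hom}_\Lambda(A,\tau A)=0$), $\frac{P}{0}$ ($P$ indecomposable projective), $\frac{0}{I}$ ($I$ indecomposable injective). A balanced pair is complete if it has $n$ nonisomorphic indecomposable summands. $g\left(\frac{A}{B}\right)=\underline{\dim}\,\mathrm{top}\,A-\underline{\dim}\,\mathrm{soc}\,B$.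 The Jasso category is $J\left(\frac{A}{B}\right)=\{X:\mathrm{Hom}(A,X)=0=\mathrm{Hom}(X,B)\}$; if $\frac{A}{B}$ has $n-1$ indecomposable summands, $J\left(\frac{A}{B}\right)$ has, up to isomorphism, a unique simple object. Chambers: for a nonzero module $M$, $\mathcal{D}_\Lambda(M)=\{v\in\mathbb{R}^n: v\ast\underline{\dim}M=0,\ v\ast\underline{\dim}M'\le 0\ \forall M'\subseteq M\}$. A chamber is a path component of $\mathbb{R}^n\setminus\bigcup_{M\neq0}\mathcal{D}_\Lambda(M)$. For a complete balanced pair with indecomposable summands $\frac{A_i}{B_i}$, its standard open chamber is the set of all $\sum r_i\,g\left(\frac{A_i}{B_i}\right)$, $r_i>0$ (it is a chamber); the wall of this chamber opposite $g\left(\frac{A_i}{B_i}\right)$ is $\mathcal{D}_\Lambda(N)$ where $N$ is the unique simple object of $J\left(\bigsqcup_{j\ne i}\frac{A_j}{B_j}\right)$ ($\mathcal{D}_\Lambda(N)$ contains the facet of the cone opposite $g\left(\frac{A_i}{B_i}\right)$). The upper chamber $\mathcal{B}_-$ (resp. lower chamber $\mathcal{B}_+$) of $v_0=g\left(\frac{A}{B}\right)$, for a non-complete pair, is the unique chamber with $v_0$ on its boundary which contains $v_0-\varepsilon\eta$ (resp. $v_0+\varepsilon\eta$) for all sufficiently small $\varepsilon>0$; these exist and are standard open chambers of complete balanced pairs having $\frac{A}{B}$ as a summand. Covering and flooring walls: for an indecomposable balanced pair $\frac{A}{B}$ with $A\neq0$, the covering wall is the wall $\mathcal{D}_\Lambda(M_-)$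 of $\mathcal{B}_-$ opposite $v_0$ (then $\mathcal{B}_-$ lies on its positive side, i.e. $x\ast\underline{\dim}M_->0$ for $x\in\mathcal{B}_-$). If $B\ne0$, the flooring wall is the wall $\mathcal{D}_\Lambda(M_+)$ of $\mathcal{B}_+$ opposite $v_0$ (then $\mathcal{B}_+$ lies on its negative side). *)

(* Defs.v *)
From HB Require Import structures.
From mathcomp Require Import all_boot all_order all_algebra all_field.
From mathcomp Require Import all_classical all_reals all_analysis.

Set Implicit Arguments.
Unset Strict Implicit.
Unset Printing Implicit Defensive.

Import Order.TTheory GRing.Theory Num.Theory.
Import numFieldNormedType.Exports.

Local Open Scope classical_set_scope.
Local Open Scope ring_scope.

Variant side : Set := Left | Right.
Definition opp (s : side) : side := if s is Left then Right else Left.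

(** Finite dimensional modules on either side; over a finite dimensional algebra
    these are the finitely generated ones. The left modules only serve to define
    the transpose and the Auslander-Reiten translate. *)
Record fmodule (K : fieldType) (H : falgType K) (s : side) := FModule {
  msort :> vectType K;
  act : 'Hom(H, 'End(msort));
  act1 : forall x, act 1 x = x;
  actM : forall a b x,
    act (a * b) x = if s is Right then act b (act a x) else act a (act b x)
}.
Arguments act {K H s} _.

Section Modules.
Variables (K : fieldType) (H : falgType K).
Implicit Types s : side.

Definition zero_module s (M : fmodule H s) : Prop := \dim {: M} = 0%N.

Definition is_hom s (M N : fmodule H s) (f : 'Hom(M, N)) : Prop :=
  forall a x, f (act M a x) = act N a (f x).

Definition hom_zero s (M N : fmodule H s) : Prop :=
  forall f : 'Hom(M, N), is_hom f -> f = 0.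

Definition mono s (M N : fmodule H s) (f : 'Hom(M, N)) : Prop :=
  is_hom f /\ lker f = 0%VS.

Definition epi s (M N : fmodule H s) (f : 'Hom(M, N)) : Prop :=
  is_hom f /\ limg f = fullv.

Definition iso s (M N : fmodule H s) : Prop :=
  exists f : 'Hom(M, N), mono f /\ epi f.

Definition submodule s (M : fmodule H s) (U : {vspace M}) : Prop :=
  forall a x, x \in U -> act M a x \in U.

Definition simple s (M : fmodule H s) : Prop :=
  ~ zero_module M /\
  forall U : {vspace M}, submodule U -> U = 0%VS \/ U = fullv.

(** [M] is the direct sum (biproduct) of the family [F]. *)
Definition dsum s (I : finType) (F : I -> fmodule H s) (M : fmodule H s) : Prop :=
  exists (inj : forall i, 'Hom(F i, M)) (prj : forall i, 'Hom(M, F i)),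
    [/\ forall i, is_hom (inj i),
        forall i, is_hom (prj i),
        forall i x, prj i (inj i x) = x,
        forall i j x, i != j -> prj j (inj i x) = 0 &
        forall x, x = \sum_i inj i (prj i x)].

Definition dsum2 s (M1 M2 M : fmodule H s) : Prop :=
  dsum (fun b : bool => if b then M1 else M2) M.

Definition projective s (P : fmodule H s) : Prop :=
  forall (M N : fmodule H s) (p : 'Hom(M, N)) (f : 'Hom(P, N)),
    epi p -> is_hom f -> exists2 h : 'Hom(P, M), is_hom h & f = (p \o h)%VF.

Definition injective_module s (E : fmodule H s) : Prop :=
  forall (M N : fmodule H s) (j : 'Hom(M, N)) (f : 'Hom(M, E)),
    mono j -> is_hom f -> exists2 h : 'Hom(N, E), is_hom h & f = (h \o j)%VF.

(** Right hereditary, which for finite dimensional algebras is the same as left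
    hereditary. *)
Definition hereditary : Prop :=
  forall (P M : fmodule H Right) (j : 'Hom(M, P)),
    projective P -> mono j -> projective M.

Definition regular_act s : 'Hom(H, 'End(H)) :=
  if s is Right then linfun (@amulr K H) else linfun (@amull K H).

Lemma regular_act1 s (x : H) : regular_act s 1 x = x.
Proof. by case: s; rewrite lfunE lfunE /= ?mulr1 ?mul1r. Qed.

Lemma regular_actM s (a b x : H) : regular_act s (a * b) x =
  if s is Right then regular_act s b (regular_act s a x)
  else regular_act s a (regular_act s b x).
Proof. by case: s; do !rewrite lfunE /=; rewrite mulrA. Qed.

Definition regular s : fmodule H s :=
  FModule (@regular_act1 s) (@regular_actM s).

Section Dual.
Variables (s : side) (M : fmodule H s).

Definition dual_endo (a : H) (phi : 'Hom(M, K^o)) : 'Hom(M, K^o) :=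
  (phi \o act M a)%VF.

Fact dual_endo_linear a : linear (dual_endo a).
Proof. by move=> k f g; rewrite /dual_endo comp_lfunDl comp_lfunZl. Qed.

HB.instance Definition _ (a : H) := GRing.isSemilinear.Build K _ _ _
  (dual_endo a) (GRing.semilinear_linear (dual_endo_linear a)).

Definition dual_act0 (a : H) : 'End('Hom(M, K^o)) := linfun (dual_endo a).

Fact dual_act0_linear : linear dual_act0.
Proof.
move=> k a b; apply/lfunP => phi; apply/lfunP => x.
rewrite lfunE /= lfunE /= !lfunE /= !lfunE /= !lfunE /= linearP.
by rewrite !lfunE /= !lfunE /= linearP.
Qed.

HB.instance Definition _ := GRing.isSemilinear.Build K _ _ _
  dual_act0 (GRing.semilinear_linear dual_act0_linear).

Definition dual_act : 'Hom(H, 'End('Hom(M, K^o))) := linfun dual_act0.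

Lemma dual_actE a (phi : 'Hom(M, K^o)) x : dual_act a phi x = phi (act M a x).
Proof. by rewrite lfunE /= lfunE /= lfunE. Qed.

Lemma dual_act1 phi : dual_act 1 phi = phi.
Proof. by apply/lfunP => x; rewrite dual_actE act1. Qed.

Lemma dual_actM a b phi : dual_act (a * b) phi =
  if opp s is Right then dual_act b (dual_act a phi)
  else dual_act a (dual_act b phi).
Proof.
apply/lfunP => x.
have side_if t (f g : 'Hom(M, K^o)) : (if opp t is Right then f else g) x =
    if t is Right then g x else f x by case: t.
have if_arg t (u v : M) : phi (if t is Right then u else v) =
    if t is Right then phi u else phi v by case: t.
by rewrite side_if !dual_actE actM if_arg.
Qed.

(** [D M = Hom_K(M, K)]. *)
Definition dual : fmodule H (opp s) := FModule dual_act1 dual_actM.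
End Dual.

Definition superfluous_kernel s (M N : fmodule H s) (f : 'Hom(M, N)) : Prop :=
  forall U : {vspace M}, submodule U -> (U + lker f)%VS = fullv -> U = fullv.

Definition min_proj_presentation s (P1 P0 M : fmodule H s)
    (p1 : 'Hom(P1, P0)) (p0 : 'Hom(P0, M)) : Prop :=
  [/\ projective P1 /\ projective P0, epi p0 /\ is_hom p1,
      limg p1 = lker p0, superfluous_kernel p0 & superfluous_kernel p1].

(** [T] is the transpose of [M]: the cokernel of
    [Hom_H(p1, H) : Hom_H(P0, H) -> Hom_H(P1, H)]. The quotient map [q] is given
    on all of [Hom_K(P1, H)], but only its restriction to [Hom_H(P1, H)], with
    action [(a . h) x = a . (h x)], matters. *)
Definition is_transpose s (M : fmodule H s) (T : fmodule H (opp s)) : Prop :=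
  exists (P1 P0 : fmodule H s) (p1 : 'Hom(P1, P0)) (p0 : 'Hom(P0, M))
         (q : 'Hom('Hom(P1, regular s), T)),
    [/\ min_proj_presentation p1 p0,
        forall a (h : 'Hom(P1, regular s)), is_hom h ->
          q (act (regular (opp s)) a \o h)%VF = act T a (q h),
        forall t, exists2 h : 'Hom(P1, regular s), is_hom h & q h = t &
        forall h : 'Hom(P1, regular s), is_hom h ->
          (q h = 0 <->
           exists2 h0 : 'Hom(P0, regular s), is_hom h0 & h = (h0 \o p1)%VF)].

(** [N] is isomorphic to [tau M = D Tr M]. *)
Definition is_tau (M N : fmodule H Right) : Prop :=
  exists2 T : fmodule H Left, is_transpose M T & iso N (dual T).

(** [N] is isomorphic to [tau^-1 M = Tr D M]. *)
Definition is_tauV (M N : fmodule H Right) : Prop :=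
  @is_transpose Left (dual M) N.

Definition mpair : Type := (fmodule H Right * fmodule H Right)%type.
Implicit Types p q : mpair.

Definition pair_iso p q : Prop := iso p.1 q.1 /\ iso p.2 q.2.

Definition zero_pair p : Prop := zero_module p.1 /\ zero_module p.2.

Definition pair_dsum (I : finType) (F : I -> mpair) p : Prop :=
  dsum (fun i => (F i).1) p.1 /\ dsum (fun i => (F i).2) p.2.

Definition balanced p : Prop :=
  [/\ hom_zero p.1 p.2,
      exists T I, [/\ is_tau p.1 T, injective_module I & dsum2 T I p.2] &
      exists T P, [/\ is_tauV p.2 T, projective P & dsum2 T P p.1]].

Definition indec_balanced p : Prop :=
  [/\ balanced p, ~ zero_pair p &
      forall p1 p2, balanced p1 -> balanced p2 ->
        pair_dsum (fun b : bool => if b then p1 else p2) p ->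
        zero_pair p1 \/ zero_pair p2].

(** [T] lists the indecomposable summands of a complete balanced pair. *)
Definition complete_balanced n (T : 'I_n -> mpair) : Prop :=
  [/\ forall i, indec_balanced (T i),
      forall i j, pair_iso (T i) (T j) -> i = j &
      exists2 p, pair_dsum T p & balanced p].

Definition jasso p (X : fmodule H Right) : Prop :=
  hom_zero p.1 X /\ hom_zero X p.2.

(** Simple objects of a full subcategory [C] of the category of modules. *)
Definition simple_object (C : fmodule H Right -> Prop) (N : fmodule H Right) :
    Prop :=
  [/\ C N, ~ zero_module N &
      forall (X : fmodule H Right) (j : 'Hom(X, N)), C X -> mono j ->
        zero_module X \/ epi j].

Definition unique_simple_object (C : fmodule H Right -> Prop)
    (N : fmodule H Right) : Prop :=
  simple_object C N /\ forall N', simple_object C N' -> iso N' N.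

Definition is_simples n (S : 'I_n -> fmodule H Right) : Prop :=
  [/\ forall i, simple (S i),
      forall i j, iso (S i) (S j) -> i = j &
      forall M, simple M -> exists i, iso M (S i)].

Section DimensionVectors.
Variables (n : nat) (S : 'I_n -> fmodule H Right).

(** [comp_factors M s]: some composition series of [M] has factors [S i], for [i]
    running through [s] from the top down. *)
Inductive comp_factors : fmodule H Right -> seq 'I_n -> Prop :=
| comp_factors0 M : zero_module M -> comp_factors M [::]
| comp_factorsS (M' M : fmodule H Right) i (s : seq 'I_n) (j : 'Hom(M', M)) (p : 'Hom(M, S i)) :
    mono j -> epi p -> limg j = lker p ->
    comp_factors M' s -> comp_factors M (i :: s).

(** Well defined by the Jordan-Hoelder theorem. *)
Definition dimv (M : fmodule H Right) : 'rV[int]_n :=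
  xget 0 [set d | exists2 s : seq 'I_n,
    comp_factors M s & d = \row_i (count_mem i s : int)].

(** [T] is the quotient of [M] by its radical, the intersection of the maximal
    submodules. *)
Definition is_top (M T : fmodule H Right) : Prop :=
  exists2 p : 'Hom(M, T), epi p &
    forall x, x \in lker p <->
      forall U : {vspace M}, submodule U -> U <> fullv ->
        (forall V : {vspace M}, submodule V -> (U <= V)%VS ->
           V = U \/ V = fullv) ->
        x \in U.

(** [T] is the socle of [M], the sum of the simple submodules. *)
Definition is_soc (M T : fmodule H Right) : Prop :=
  exists2 j : 'Hom(T, M), mono j &
    forall U : {vspace M}, submodule U ->
      ((limg j <= U)%VS <->
       forall (N : fmodule H Right) (k : 'Hom(N, M)), simple N -> mono k ->
         (limg k <= U)%VS).

Definition gvecZ p : 'rV[int]_n :=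
  xget 0 [set v | exists T T', [/\ is_top p.1 T, is_soc p.2 T' &
                                v = dimv T - dimv T']].

Section Chambers.
Variable R : realType.

Definition gvec p : 'rV[R]_n := map_mx intr (gvecZ p).

Definition ast (v w : 'rV[R]_n) : R :=
  \sum_i v 0 i * w 0 i * (\dim {: S i})%:R.

Definition dimvR (M : fmodule H Right) : 'rV[R]_n := map_mx intr (dimv M).

(** [D_H(M)]; submodules are given by monomorphisms. *)
Definition stab (M : fmodule H Right) : set 'rV[R]_n :=
  [set v | ast v (dimvR M) = 0 /\
     forall (M' : fmodule H Right) (j : 'Hom(M', M)), mono j ->
       ast v (dimvR M') <= 0].

Definition walls : set 'rV[R]_n :=
  [set v | exists2 M : fmodule H Right, ~ zero_module M & stab M v].

Definition path_component (U : set 'rV[R]_n) (x : 'rV[R]_n) : set 'rV[R]_n :=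
  [set y | exists f : R -> 'rV[R]_n,
     [/\ {within `[0, 1], continuous f}, f 0 = x, f 1 = y &
         f @` `[0, 1] `<=` U]].

Definition chamber (C : set 'rV[R]_n) : Prop :=
  exists2 x, (~` walls) x & C = path_component (~` walls) x.

Definition boundary (C : set 'rV[R]_n) : set 'rV[R]_n :=
  closure C `\` interior C.

Definition std_open_chamber (T : 'I_n -> mpair) : set 'rV[R]_n :=
  [set v | exists2 r : 'I_n -> R,
     forall i, 0 < r i & v = \sum_i r i *: gvec (T i)].

Definition eta : 'rV[R]_n := const_mx 1.

Definition upper_chamber (v0 : 'rV[R]_n) (C : set 'rV[R]_n) : Prop :=
  [/\ chamber C, boundary C v0 & \forall e \near 0^'+, C (v0 - e *: eta)].

Definition lower_chamber (v0 : 'rV[R]_n) (C : set 'rV[R]_n) : Prop :=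
  [/\ chamber C, boundary C v0 & \forall e \near 0^'+, C (v0 + e *: eta)].

(** [W] is the wall opposite [gvec (T i)] of [std_open_chamber T]. *)
Definition opposite_wall (T : 'I_n -> mpair) (i : 'I_n) (W : set 'rV[R]_n) :
    Prop :=
  exists q N, [/\ pair_dsum (fun j : {j : 'I_n | j != i} => T (val j)) q,
                  unique_simple_object (jasso q) N & W = stab N].

End Chambers.
End DimensionVectors.
End Modules.

Arguments fmodule {K} H s.
Arguments mpair {K} H.
Arguments gvec {K H n} S R p.
Arguments stab {K H n} S R M.
Arguments std_open_chamber {K H n} S R T.

(* Main.v *)
From HB Require Import structures.
From mathcomp Require Import all_boot all_order all_algebra all_field.
From mathcomp Require Import all_classical all_reals all_analysis.
From mathcomp Require Import zify ring.
Require Import Defs.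

Set Implicit Arguments.
Unset Strict Implicit.
Unset Printing Implicit Defensive.

Import Order.TTheory GRing.Theory Num.Theory.

Local Open Scope ring_scope.

(** Write [hom(X, Y)] for the dimension of [Hom_H(X, Y)] and [A_j / B_j] for the
    members of the complete pair [T]. The chamber hypothesis enters through one
    equation: for some [e > 0] the vector [g(A/B) - e eta] (upper case) or
    [g(A/B) + e eta] (lower case) is a combination [\sum_j r_j g(A_j/B_j)] with all
    [r_j > 0]. Pair it with the class of a module [X], counting a composition
    factor [S_k] with weight [dim End(S_k)]. The g-vector of a balanced pair
    then gives [hom(A, X) - hom(X, B)] (lemma [gform_balanced]), so that, with [W X]
    the weighted length of [X],

      [hom(A, X) - hom(X, B) -/+ e W(X) = \sum_j r_j (hom(A_j, X) - hom(X, B_j))].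

    Upper case. If [X] is a quotient of some [A_j] with [Hom(A, X) = 0], the left
    side is negative unless [X = 0], whereas the right side is nonnegative; hence
    [X = 0] ([quotient_generated]). Counting dimensions, this applies to the
    quotient of [A_j] by the trace of [A], so [A_j] is generated by [A]
    ([trace_full]). By the lemma of Happel and Ringel ([indec_endo_mono]) every
    nonzero endomorphism of [A] is invertible. A nonzero map [A_j -> A] with
    [j <> i] would therefore make [A] a summand of [A_j], hence isomorphic to it,
    and the two pairs would coincide. So [A] lies in the Jasso category [J] of the
    other members. On [J] only the term of index [i] survives on the right, and
    the equation yields [Hom(A, X) <> 0] for every nonzero [X] in [J]
    ([top_source]). As [J] is closed under images, kernels and cokernels, [A] is its
    unique simple object. The lower case is dual: [B_j] is cogenerated by [B], and
    every nonzero [X] in [J] has a nonzero map to [B].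

    The statements about balanced pairs used here ([A] is indecomposable and
    determines [B], and dually) are reduced to numbers. The dimensions of the spaces
    [Hom(M, X)] for all [X] determine [M] ([hdim_iso]); those of [Hom(X, tau M)] and
    [Hom(tau^-1 M, X)] are given by the Auslander-Reiten formula ([is_tau_hdim],
    [is_tauV_hdim]) in terms of the Euler form, which is biadditive because [H] is
    hereditary. *)

(** * Subspaces and linear maps *)

Section LinearAlgebra.
Variable K : fieldType.

Section LinearMap.
Variables (V W : vectType K) (f : V -> W) (lin_f : linear f).

HB.instance Definition _ := GRing.isLinear.Build K V W _ f lin_f.

(** [linfun] accepts every function but computes the expected map only for linear
    ones; keeping the proof of linearity apart allows [f] to be a local function. *)
Lemma linE x : linfun f x = f x. Proof. by rewrite lfunE. Qed.
End LinearMap.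

Lemma min_nat_ex (X : Type) (m : X -> nat) (P : X -> Prop) x0 :
  P x0 -> exists2 x, P x & forall y, P y -> (m x <= m y)%N.
Proof.
move=> Px0; have [k] := ubnP (m x0); elim: k x0 Px0 => // k IH x Px lex.
have [[y Py lty]|no] := pselect (exists2 y, P y & (m y < m x)%N).
  by apply: (IH y Py); apply: leq_trans lty _.
by exists x => // y Py; rewrite leqNgt; apply/negP => lt; apply: no; exists y.
Qed.

Lemma max_nat_ex (X : Type) (m : X -> nat) (P : X -> Prop) (b : nat) x0 :
  P x0 -> (forall x, P x -> (m x <= b)%N) ->
  exists2 x, P x & forall y, P y -> (m y <= m x)%N.
Proof.
move=> Px0 bnd; have [x Px xmin] := min_nat_ex (fun x => b - m x)%N Px0.
by exists x => // y Py; have := xmin y Py; have := bnd x Px; have := bnd y Py; lia.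
Qed.

Variable V : vectType K.

Lemma min_vspace (P : {vspace V} -> Prop) U0 :
  P U0 -> exists2 U, P U & forall W, P W -> (\dim U <= \dim W)%N.
Proof. exact: min_nat_ex. Qed.

Lemma max_vspace (P : {vspace V} -> Prop) U0 :
  P U0 -> exists2 U, P U & forall W, P W -> (\dim W <= \dim U)%N.
Proof.
by move=> PU0; apply: (max_nat_ex (b := \dim {: V}) PU0) => U _; exact/dimvS/subvf.
Qed.

Definition lin_closed (P : V -> Prop) :=
  P 0 /\ forall k u v, P u -> P v -> P (k *: u + v).

(** Junk unless [P] is closed under linear combinations. *)
Definition vsp (P : V -> Prop) : {vspace V} :=
  xget 0%VS [set U : {vspace V} | forall x, x \in U <-> P x]%classic.

(** A subspace of largest dimension among those inside [P] absorbs every vector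
    satisfying [P]. *)
Lemma mem_vsp (P : V -> Prop) : lin_closed P -> forall x, x \in vsp P <-> P x.
Proof.
move=> [P0 PD]; suff [U HU] : exists U : {vspace V}, forall x, x \in U <-> P x.
  by rewrite /vsp; case: xgetP => [W _ //|/(_ U)[]].
have [U PU Umax] : exists2 U : {vspace V}, forall x, x \in U -> P x &
    forall W : {vspace V}, (forall x, x \in W -> P x) -> (\dim W <= \dim U)%N.
  apply: (max_vspace (U0 := 0%VS)) => x; by rewrite memv0 => /eqP->.
exists U => x; split; first exact: PU.
move=> Px; have PW y : y \in (U + <[x]>)%VS -> P y.
  case/memv_addP => u Uu [_ /vlineP[k ->] ->]; rewrite addrC.
  by apply: PD => //; exact: PU.
have sUW : (U <= U + <[x]>)%VS by exact: addvSl.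
have /eqP-> : U == (U + <[x]>)%VS.
  by rewrite eqEdim sUW /= Umax.
by rewrite memvE addvSr.
Qed.

Lemma eq_dim_full (U : {vspace V}) : (\dim {: V} <= \dim U)%N -> U = fullv.
Proof. by move=> le; apply/eqP; rewrite eqEdim subvf. Qed.

End LinearAlgebra.

(** * Homomorphisms, submodules and quotients *)

Section Homs.
Variables (K : fieldType) (H : falgType K).
Implicit Types s : side.

Lemma is_hom_id s (M : fmodule H s) : is_hom (\1%VF : 'Hom(M, M)).
Proof. by move=> a x; rewrite !lfunE. Qed.

Lemma is_hom0 s (M N : fmodule H s) : is_hom (0 : 'Hom(M, N)).
Proof. by move=> a x; rewrite !lfunE /= linear0. Qed.

Lemma is_hom_comp s (M N P : fmodule H s) (g : 'Hom(N, P)) (f : 'Hom(M, N)) :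
  is_hom f -> is_hom g -> is_hom (g \o f)%VF.
Proof. by move=> hf hg a x; rewrite !comp_lfunE hf hg. Qed.

Lemma is_homZD s (M N : fmodule H s) k (f g : 'Hom(M, N)) :
  is_hom f -> is_hom g -> is_hom (k *: f + g).
Proof. by move=> hf hg a x; rewrite !lfunE /= !lfunE /= hf hg linearP. Qed.

Lemma is_homD s (M N : fmodule H s) (f g : 'Hom(M, N)) :
  is_hom f -> is_hom g -> is_hom (f + g).
Proof. by move=> hf hg; rewrite -[f]scale1r; exact: is_homZD. Qed.

Lemma is_homN s (M N : fmodule H s) (f : 'Hom(M, N)) :
  is_hom f -> is_hom (- f).
Proof. by move=> hf; rewrite -[- f]addr0 -scaleN1r; apply: is_homZD => //; exact: is_hom0. Qed.

Definition homsp s (M N : fmodule H s) : {vspace 'Hom(M, N)} :=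
  vsp (@is_hom K H s M N).

Definition hdim s (M N : fmodule H s) : nat := \dim (homsp M N).

Lemma mem_homsp s (M N : fmodule H s) (f : 'Hom(M, N)) :
  f \in homsp M N <-> is_hom f.
Proof. by apply: mem_vsp; split; [exact: is_hom0|move=> *; exact: is_homZD]. Qed.

Lemma hom_zeroP s (M N : fmodule H s) : hom_zero M N <-> hdim M N = 0%N.
Proof.
split=> [h0|/eqP].
  apply/eqP; rewrite dimv_eq0 -subv0; apply/subvP => f /mem_homsp hf.
  by rewrite (h0 f hf) mem0v.
rewrite dimv_eq0 => /eqP h0 f /mem_homsp.
by rewrite h0 memv0 => /eqP.
Qed.

Lemma hom_gt0 s (M N : fmodule H s) (f : 'Hom(M, N)) :
  is_hom f -> f <> 0 -> (0 < hdim M N)%N.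
Proof.
move=> hf f0; rewrite lt0n; apply/eqP => /hom_zeroP h0; exact/f0/h0.
Qed.

Lemma hom_neq0 s (M N : fmodule H s) : hdim M N <> 0%N ->
  exists2 f : 'Hom(M, N), is_hom f & f <> 0.
Proof.
move=> h0; apply: contrapT => no; apply/h0/hom_zeroP => f hf.
by apply: contrapT => f0; apply: no; exists f.
Qed.

Lemma zero_moduleP s (M : fmodule H s) : zero_module M <-> forall x : M, x = 0.
Proof.
split=> [/eqP|h].
  by rewrite dimv_eq0 => /eqP M0 x; apply/eqP; rewrite -memv0 -M0 memvf.
apply/eqP; rewrite dimv_eq0 -subv0; apply/subvP => x _.
by rewrite (h x) mem0v.
Qed.

Lemma hom_from0 s (M N : fmodule H s) : zero_module M -> hdim M N = 0%N.
Proof.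
move/zero_moduleP => M0; apply/hom_zeroP => f _; apply/lfunP => x.
by rewrite (M0 x) linear0 lfunE.
Qed.

Lemma hom_to0 s (M N : fmodule H s) : zero_module N -> hdim M N = 0%N.
Proof.
by move/zero_moduleP => N0; apply/hom_zeroP => f _; apply/lfunP => x; exact: etrans (N0 _) (esym (N0 _)).
Qed.

Lemma id_neq0 s (M : fmodule H s) : ~ zero_module M -> (\1%VF : 'Hom(M, M)) <> 0.
Proof.
move=> M0 e; apply/M0/zero_moduleP => x.
by have /lfunP/(_ x) := e; rewrite !lfunE.
Qed.

Lemma hom_self s (M : fmodule H s) : ~ zero_module M -> (0 < hdim M M)%N.
Proof. by move=> M0; apply: hom_gt0 (id_neq0 M0); exact: is_hom_id. Qed.

Lemma lker_eq0P (V W : vectType K) (f : 'Hom(V, W)) :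
  lker f = 0%VS <-> injective f.
Proof. by split=> [/eqP/lker0P|/lker0P/eqP]. Qed.

Lemma limg_fullP (V W : vectType K) (f : 'Hom(V, W)) :
  limg f = fullv <-> forall y, exists x, f x = y.
Proof.
split=> [e y|h].
  have : y \in limg f by rewrite e memvf.
  by case/memv_imgP => x _ ->; exists x.
apply/eqP; rewrite eqEsubv subvf; apply/subvP => y _.
by have [x <-] := h y; rewrite memv_img ?memvf.
Qed.

Lemma mem_limgP (V W : vectType K) (f : 'Hom(V, W)) y :
  y \in limg f <-> exists x, y = f x.
Proof.
split=> [/memv_imgP[x _ ->]|[x ->]]; first by exists x.
by rewrite memv_img ?memvf.
Qed.

Lemma submodule_ker s (M N : fmodule H s) (f : 'Hom(M, N)) :
  is_hom f -> submodule (lker f).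
Proof. by move=> hf a x; rewrite !memv_ker hf => /eqP->; rewrite linear0. Qed.

Lemma submodule_img s (M N : fmodule H s) (f : 'Hom(M, N)) (U : {vspace M}) :
  is_hom f -> submodule U -> submodule (f @: U).
Proof.
move=> hf hU a _ /memv_imgP[x Ux ->]; rewrite -hf memv_img //; exact: hU.
Qed.

Lemma submodulef s (M : fmodule H s) : submodule (fullv : {vspace M}).
Proof. by move=> a x _; rewrite memvf. Qed.

Lemma submodule0 s (M : fmodule H s) : submodule (0%VS : {vspace M}).
Proof. by move=> a x; rewrite !memv0 => /eqP->; rewrite linear0. Qed.

Lemma submodule_limg s (M N : fmodule H s) (f : 'Hom(M, N)) :
  is_hom f -> submodule (limg f).
Proof. by move=> hf; apply: submodule_img => //; exact: submodulef. Qed.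

Lemma submodule_pre s (M N : fmodule H s) (f : 'Hom(M, N)) (U : {vspace N}) :
  is_hom f -> submodule U -> submodule (f @^-1: U).
Proof. by move=> hf hU a x; rewrite -!memv_preim hf; exact: hU. Qed.

Lemma submoduleD s (M : fmodule H s) (U V : {vspace M}) :
  submodule U -> submodule V -> submodule (U + V).
Proof.
move=> hU hV a _ /memv_addP[u Uu [v Vv ->]]; rewrite linearD.
by apply: memv_add; [exact: hU|exact: hV].
Qed.

Lemma submoduleI s (M : fmodule H s) (U V : {vspace M}) :
  submodule U -> submodule V -> submodule (U :&: V).
Proof.
move=> hU hV a x; rewrite !memv_cap => /andP[/hU-> /hV->] //.
Qed.

(** The common construction behind submodules and quotients: the second hypothesis
    holds as soon as the image of [j] or the kernel of [p] is a submodule. *)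
Lemma transport_module s (M : fmodule H s) (W : vectType K)
    (j : 'Hom(W, M)) (p : 'Hom(M, W)) :
  (forall x, p (j x) = x) ->
  (forall a b x, p (act M b (j (p (act M a (j x))))) = p (act M b (act M a (j x)))) ->
  exists X : fmodule H s, exists2 f : 'Hom(X, W), bijective f &
    forall a x, f (act X a x) = p (act M a (j (f x))).
Proof.
move=> pj coh.
pose T0 a : 'End(W) := (p \o act M a \o j)%VF.
have linT0 : linear T0.
  move=> k a b; apply/lfunP => x; rewrite /T0 linearP comp_lfunE comp_lfunE.
  by rewrite add_lfunE scale_lfunE linearP add_lfunE scale_lfunE !comp_lfunE.
pose T := linfun T0.
have TE a x : T a x = p (act M a (j x)) by rewrite (linE linT0) !comp_lfunE.
have T1 x : T 1 x = x by rewrite TE act1 pj.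
have TM a b x : T (a * b) x =
    if s is Right then T b (T a x) else T a (T b x).
  by rewrite !TE actM; case: (s) M j p pj coh {T0 linT0 T TE T1} => M j p pj coh; rewrite coh.
exists (FModule T1 TM), \1%VF; first by exists id => x; rewrite lfunE.
by move=> a x; rewrite !id_lfunE; exact: TE.
Qed.

Lemma sub_ex s (M : fmodule H s) (U : {vspace M}) : submodule U ->
  exists (X : fmodule H s) (j : 'Hom(X, M)), mono j /\ limg j = U.
Proof.
move=> hU; pose j : 'Hom(subvs_of U, M) := linfun vsval.
pose p : 'Hom(M, subvs_of U) := linfun (vsproj U).
have jE x : j x = vsval x by rewrite lfunE.
have pK y : y \in U -> j (p y) = y by move=> Uy; rewrite !lfunE /= vsprojK.
have jU x : j x \in U by rewrite jE subvsP.
have pj x : p (j x) = x by rewrite !lfunE /= vsvalK.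
have [a b x|X [f [g fg gf] fE]] := @transport_module s M _ j p pj.
  by rewrite pK // hU.
exists X, (j \o f)%VF; split.
  split=> [a x|]; first by rewrite !comp_lfunE fE pK // hU.
  apply/lker_eq0P => x y; rewrite !comp_lfunE !jE => /val_inj e.
  by rewrite -[x]fg -[y]fg e.
apply/vspaceP => y; apply/idP/idP.
  by move/mem_limgP => [x ->]; rewrite comp_lfunE.
move=> Uy; apply/mem_limgP; exists (g (p y)).
by rewrite comp_lfunE gf pK.
Qed.

Lemma quo_ex s (M : fmodule H s) (U : {vspace M}) : submodule U ->
  exists (X : fmodule H s) (p : 'Hom(M, X)), epi p /\ lker p = U.
Proof.
move=> hU; pose V := (U^C)%VS.
have UV : (V :&: U)%VS = 0%VS by rewrite capvC capv_compl.
pose j : 'Hom(subvs_of V, M) := linfun vsval.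
(* the quotient is carried by a linear complement [V] of [U] *)
pose p : 'Hom(M, subvs_of V) := (linfun (vsproj V) \o daddv_pi V U)%VF.
have jp y : j (p y) = daddv_pi V U y.
  by rewrite !comp_lfunE !lfunE /= vsprojK // memv_pi.
have jpU y : j (p y) - y \in U.
  have fy : y \in (V + U)%VS by rewrite addvC addv_complf memvf.
  rewrite jp -[X in _ - X](daddv_pi_add UV fy) opprD addNKr.
  by rewrite memvN memv_pi.
have jinj x y : j x = j y -> x = y by rewrite !lfunE /=; exact: val_inj.
have jV x : j x \in V by rewrite lfunE /= subvsP.
have pj x : p (j x) = x.
  by apply: jinj; rewrite jp daddv_pi_id.
have pker y : (p y == 0) = (y \in U).
  apply/eqP/idP => [py|Uy].
    by have := jpU y; rewrite py linear0 sub0r memvN.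
  apply: jinj; rewrite linear0; apply/eqP; rewrite -memv0 -UV memv_cap jV /=.
  by have := memvD (jpU y) Uy; rewrite subrK.
have [a b x|X [f [g fg gf] fE]] := @transport_module s M _ j p pj.
  by apply/eqP; rewrite -subr_eq0 -linearB pker -linearB hU.
have linf : linear (g \o p).
  by move=> k x y; apply: (can_inj fg); rewrite /= gf !linearP /= !gf.
exists X, (linfun (g \o p)); split.
  split=> [a x|].
    rewrite !(linE linf) /=; apply: (can_inj fg); rewrite gf fE gf.
    by apply/eqP; rewrite -subr_eq0 -!linearB pker hU // -opprB memvN.
  apply/limg_fullP => y; exists (j (f y)); rewrite (linE linf) /= pj fg //.
apply/vspaceP => y; rewrite memv_ker (linE linf) /= -pker.
by apply/eqP/eqP => [e|->]; [rewrite -[p y]gf e linear0|apply: (can_inj fg); rewrite gf linear0].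
Qed.

Lemma factor_mono s (X M Y : fmodule H s) (j : 'Hom(X, M)) (f : 'Hom(Y, M)) :
  mono j -> is_hom f -> (limg f <= limg j)%VS ->
  exists2 g : 'Hom(Y, X), is_hom g & f = (j \o g)%VF.
Proof.
move=> [hj /lker_eq0P ij] hf sub.
have jV y : j ((j^-1)%VF (f y)) = f y.
  by rewrite limg_lfunVK //; apply: (subvP sub); rewrite memv_img ?memvf.
exists (j^-1 \o f)%VF; last by apply/lfunP => y; rewrite !comp_lfunE jV.
by move=> a y; apply: ij; rewrite hj !comp_lfunE !jV hf.
Qed.

Lemma factor_epi s (M Q Y : fmodule H s) (p : 'Hom(M, Q)) (f : 'Hom(M, Y)) :
  epi p -> is_hom f -> (lker p <= lker f)%VS ->
  exists2 g : 'Hom(Q, Y), is_hom g & f = (g \o p)%VF.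
Proof.
move=> [hp ep] hf sub.
have pV y : p ((p^-1)%VF y) = y by rewrite limg_lfunVK // ep memvf.
have fV x : f ((p^-1)%VF (p x)) = f x.
  apply/eqP; rewrite -subr_eq0 -linearB -memv_ker; apply: (subvP sub).
  by rewrite memv_ker linearB /= pV subrr.
have gE x : (f \o p^-1)%VF (p x) = f x by rewrite comp_lfunE fV.
exists (f \o p^-1)%VF; last by apply/lfunP => y; rewrite [RHS]comp_lfunE gE.
by move=> a y; rewrite -(pV y) -hp !gE hf.
Qed.

Lemma image_ex s (M N : fmodule H s) (f : 'Hom(M, N)) : is_hom f ->
  exists (Y : fmodule H s) (p : 'Hom(M, Y)) (j : 'Hom(Y, N)),
    [/\ epi p, mono j, f = (j \o p)%VF & limg j = limg f].
Proof.
move=> hf; have [Y [j [mj ej]]] := sub_ex (submodule_limg hf).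
have [|g hg fE] := factor_mono mj hf; first by rewrite ej.
exists Y, g, j; split=> //; split=> //; apply/limg_fullP => y.
have : j y \in limg f by rewrite -ej memv_img ?memvf.
move/mem_limgP => [x jx]; exists x.
have [_ /lker_eq0P ij] := mj.
by apply: ij; rewrite jx fE comp_lfunE.
Qed.

Lemma epi_eq s (M N P : fmodule H s) (p : 'Hom(M, N)) (f g : 'Hom(N, P)) :
  epi p -> (f \o p)%VF = (g \o p)%VF -> f = g.
Proof.
move=> [_ /limg_fullP sp] e; apply/lfunP => y; have [x <-] := sp y.
by have /lfunP/(_ x) := e; rewrite !comp_lfunE.
Qed.

Lemma mono_eq s (M N P : fmodule H s) (j : 'Hom(N, P)) (f g : 'Hom(M, N)) :
  mono j -> (j \o f)%VF = (j \o g)%VF -> f = g.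
Proof.
move=> [_ /lker_eq0P ij] e; apply/lfunP => y; apply: ij.
by have /lfunP/(_ y) := e; rewrite !comp_lfunE.
Qed.

Lemma mono_comp s (M N P : fmodule H s) (f : 'Hom(M, N)) (g : 'Hom(N, P)) :
  mono f -> mono g -> mono (g \o f)%VF.
Proof.
move=> [hf /lker_eq0P jf] [hg /lker_eq0P jg]; split; first exact: is_hom_comp.
by apply/lker_eq0P => x y; rewrite !comp_lfunE => /jg/jf.
Qed.

Lemma epi_comp s (M N P : fmodule H s) (f : 'Hom(M, N)) (g : 'Hom(N, P)) :
  epi f -> epi g -> epi (g \o f)%VF.
Proof.
move=> [hf /limg_fullP jf] [hg /limg_fullP jg]; split; first exact: is_hom_comp.
apply/limg_fullP => z; have [y <-] := jg z; have [x <-] := jf y.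
by exists x; rewrite comp_lfunE.
Qed.

Lemma iso_refl s (M : fmodule H s) : iso M M.
Proof.
exists \1%VF; split; split; try exact: is_hom_id.
  by apply/lker_eq0P => x y; rewrite !lfunE.
by apply/limg_fullP => y; exists y; rewrite lfunE.
Qed.

Lemma iso_inv s (M N : fmodule H s) (f : 'Hom(M, N)) : mono f -> epi f ->
  exists g : 'Hom(N, M), [/\ mono g, epi g, (g \o f = \1)%VF & (f \o g = \1)%VF].
Proof.
move=> [hf /lker_eq0P jf] [_ ef].
have fK x : (f^-1)%VF (f x) = x by apply: jf; rewrite limg_lfunVK // ef memvf.
have Kf x : f ((f^-1)%VF x) = x by rewrite limg_lfunVK // ef memvf.
have hg : is_hom (f^-1)%VF.
  by move=> a x; apply: jf; rewrite hf !Kf.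
exists (f^-1)%VF; split.
- by split=> //; apply/lker_eq0P => x y e; rewrite -[x]Kf -[y]Kf e.
- by split=> //; apply/limg_fullP => y; exists (f y).
- by apply/lfunP => x; rewrite comp_lfunE fK lfunE.
- by apply/lfunP => x; rewrite comp_lfunE Kf lfunE.
Qed.

Lemma iso_sym s (M N : fmodule H s) : iso M N -> iso N M.
Proof. by move=> [f [mf ef]]; have [g [mg eg _ _]] := iso_inv mf ef; exists g. Qed.

Lemma iso_trans s (M N P : fmodule H s) : iso M N -> iso N P -> iso M P.
Proof.
move=> [f [mf ef]] [g [mg eg]]; exists (g \o f)%VF.
by split; [exact: mono_comp|exact: epi_comp].
Qed.

Lemma mono_dim (s : side) (M N : fmodule H s) (f : 'Hom(M, N)) :
  mono f -> \dim {: M} = \dim (limg f).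
Proof. by move=> [_ k]; rewrite limg_dim_eq // k capv0. Qed.

Lemma mono_epi s (M N : fmodule H s) (f : 'Hom(M, N)) :
  mono f -> (\dim {: N} <= \dim {: M})%N -> epi f.
Proof.
move=> mf le; split; first by case: mf.
by apply: eq_dim_full; rewrite -(mono_dim mf).
Qed.

Lemma epi_mono s (M N : fmodule H s) (f : 'Hom(M, N)) :
  epi f -> (\dim {: M} <= \dim {: N})%N -> mono f.
Proof.
move=> [hf ef] le; split=> //; apply/eqP; rewrite -dimv_eq0.
by have := limg_ker_dim f fullv; rewrite capfv ef; lia.
Qed.

(** * Short exact sequences and dimensions of homomorphism spaces *)

Definition ses s (X' X X'' : fmodule H s) (j : 'Hom(X', X)) (p : 'Hom(X, X'')) :=
  [/\ mono j, epi p & limg j = lker p].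

Lemma ses_sub s (X' X : fmodule H s) (j : 'Hom(X', X)) : mono j ->
  exists (X'' : fmodule H s) (p : 'Hom(X, X'')), ses j p.
Proof.
move=> mj; have [hj _] := mj.
by have [Q [p [ep kp]]] := quo_ex (submodule_limg hj); exists Q, p.
Qed.

Lemma ses_quo s (X X'' : fmodule H s) (p : 'Hom(X, X'')) : epi p ->
  exists (X' : fmodule H s) (j : 'Hom(X', X)), ses j p.
Proof.
move=> ep; have [hp _] := ep.
by have [Y [j [mj ej]]] := sub_ex (submodule_ker hp); exists Y, j.
Qed.

Lemma ses_comp0 s (X' X X'' : fmodule H s) (j : 'Hom(X', X)) (p : 'Hom(X, X'')) x :
  limg j = lker p -> p (j x) = 0.
Proof. by move=> e; apply/eqP; rewrite -memv_ker -e memv_img ?memvf. Qed.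

Lemma ses_dim s (X' X X'' : fmodule H s) (j : 'Hom(X', X)) (p : 'Hom(X, X'')) :
  ses j p -> \dim {: X} = (\dim {: X'} + \dim {: X''})%N.
Proof.
move=> [mj [_ ep] e]; rewrite (mono_dim mj) e -ep.
by have := limg_ker_dim p fullv; rewrite capfv.
Qed.

Fact postc_linear (Y X Z : vectType K) (p : 'Hom(X, Z)) :
  linear (fun f : 'Hom(Y, X) => (p \o f)%VF).
Proof.
by move=> k f g; apply/lfunP => x; rewrite !(comp_lfunE, add_lfunE, scale_lfunE) linearP.
Qed.
Definition postc (Y X Z : vectType K) (p : 'Hom(X, Z)) :
  'Hom('Hom(Y, X), 'Hom(Y, Z)) := linfun (fun f => (p \o f)%VF).

Fact prec_linear (Y X Z : vectType K) (j : 'Hom(X, Z)) :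
  linear (fun f : 'Hom(Z, Y) => (f \o j)%VF).
Proof.
by move=> k f g; apply/lfunP => x; rewrite !(comp_lfunE, add_lfunE, scale_lfunE).
Qed.
Definition prec (Y X Z : vectType K) (j : 'Hom(X, Z)) :
  'Hom('Hom(Z, Y), 'Hom(X, Y)) := linfun (fun f => (f \o j)%VF).

Lemma postcE (Y X Z : vectType K) (p : 'Hom(X, Z)) (f : 'Hom(Y, X)) :
  postc Y p f = (p \o f)%VF.
Proof. exact: (linE (postc_linear p)). Qed.

Lemma precE (Y X Z : vectType K) (p : 'Hom(X, Z)) (f : 'Hom(Z, Y)) :
  prec Y p f = (f \o p)%VF.
Proof. exact: (linE (prec_linear p)). Qed.

Lemma hom_postc s (Y X Z : fmodule H s) (p : 'Hom(X, Z)) : is_hom p ->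
  (postc Y p @: homsp Y X <= homsp Y Z)%VS.
Proof.
move=> hp; apply/subvP => _ /memv_imgP[f /mem_homsp hf ->].
by rewrite postcE; apply/mem_homsp/is_hom_comp.
Qed.

Lemma hom_prec s (Y X Z : fmodule H s) (p : 'Hom(X, Z)) : is_hom p ->
  (prec Y p @: homsp Z Y <= homsp X Y)%VS.
Proof.
move=> hp; apply/subvP => _ /memv_imgP[f /mem_homsp hf ->].
by rewrite precE; apply/mem_homsp/is_hom_comp.
Qed.

(** Left exactness of [Hom(Y, -)]; the rank of composition with [p] measures how many
    maps [Y -> X''] lift. *)
Lemma hom_cov s (Y X' X X'' : fmodule H s) (j : 'Hom(X', X)) (p : 'Hom(X, X'')) :
  mono j -> is_hom p -> limg j = lker p ->
  hdim Y X = (hdim Y X' + \dim (postc Y p @: homsp Y X))%N.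
Proof.
move=> mj hp e; have [hj _] := mj.
rewrite /hdim -(limg_ker_dim (postc Y p) (homsp Y X)); congr (_ + _)%N.
rewrite -(limg_dim_eq (f := postc Y j) (U := homsp Y X')); last first.
  apply/eqP; rewrite -subv0; apply/subvP => f; rewrite memv_cap memv_ker => /andP[_].
  rewrite postcE => /eqP jf0; rewrite memv0; apply/eqP/(mono_eq mj).
  by rewrite jf0 comp_lfun0r.
congr (\dim _); apply/vspaceP => f; apply/idP/memv_imgP.
  rewrite memv_cap memv_ker postcE => /andP[/mem_homsp hf /eqP pf].
  have [|g hg fE] := factor_mono mj hf.
    apply/subvP => _ /mem_limgP[y ->]; rewrite e memv_ker -comp_lfunE pf lfunE /=.
    exact: eqxx.
  by exists g; [exact/mem_homsp|rewrite postcE].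
move=> [g /mem_homsp hg ->]; rewrite memv_cap memv_ker !postcE.
apply/andP; split; first exact/mem_homsp/is_hom_comp.
by apply/eqP/lfunP => y; rewrite !comp_lfunE lfunE (ses_comp0 _ e).
Qed.

Lemma hom_con s (Y X' X X'' : fmodule H s) (j : 'Hom(X', X)) (p : 'Hom(X, X'')) :
  is_hom j -> epi p -> limg j = lker p ->
  hdim X Y = (hdim X'' Y + \dim (prec Y j @: homsp X Y))%N.
Proof.
move=> hj ep e; have [hp _] := ep.
rewrite /hdim -(limg_ker_dim (prec Y j) (homsp X Y)); congr (_ + _)%N.
rewrite -(limg_dim_eq (f := prec Y p) (U := homsp X'' Y)); last first.
  apply/eqP; rewrite -subv0; apply/subvP => f; rewrite memv_cap memv_ker => /andP[_].
  rewrite precE => /eqP jf0; rewrite memv0; apply/eqP/(epi_eq ep).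
  by rewrite jf0 comp_lfun0l.
congr (\dim _); apply/vspaceP => f; apply/idP/memv_imgP.
  rewrite memv_cap memv_ker precE => /andP[/mem_homsp hf /eqP pf].
  have [|g hg fE] := factor_epi ep hf.
    rewrite -e; apply/subvP => _ /mem_limgP[y ->]; rewrite memv_ker -comp_lfunE pf lfunE /=.
    exact: eqxx.
  by exists g; [exact/mem_homsp|rewrite precE].
move=> [g /mem_homsp hg ->]; rewrite memv_cap memv_ker !precE.
apply/andP; split; first exact/mem_homsp/is_hom_comp.
by apply/eqP/lfunP => y; rewrite !comp_lfunE lfunE (ses_comp0 _ e) linear0.
Qed.

Definition lifts s (Y X X'' : fmodule H s) (p : 'Hom(X, X'')) :=
  forall h : 'Hom(Y, X''), is_hom h -> exists2 h' : 'Hom(Y, X), is_hom h' & h = (p \o h')%VF.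

Definition extends s (Y X' X : fmodule H s) (j : 'Hom(X', X)) :=
  forall h : 'Hom(X', Y), is_hom h -> exists2 h' : 'Hom(X, Y), is_hom h' & h = (h' \o j)%VF.

(** This and the next lemma turn lifting and extension problems into counts of
    dimensions. *)
Lemma hom_lifts s (Y X' X X'' : fmodule H s) (j : 'Hom(X', X)) (p : 'Hom(X, X'')) :
  ses j p -> (@lifts s Y X X'' p <-> hdim Y X = (hdim Y X' + hdim Y X'')%N).
Proof.
move=> [mj [hp _] e]; rewrite (hom_cov Y mj hp e); split.
  move=> L; congr (_ + \dim _)%N; apply/eqP; rewrite eqEsubv hom_postc //=.
  apply/subvP => f /mem_homsp/L[g hg ->]; rewrite -postcE memv_img //.
  exact/mem_homsp.
move/addnI => e2 h hh.
have /eqP E : (postc Y p @: homsp Y X == homsp Y X'')%VS by rewrite eqEdim hom_postc // e2 /=.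
have : h \in homsp Y X'' by apply/mem_homsp.
by rewrite -E => /memv_imgP[g /mem_homsp hg ->]; exists g; rewrite ?postcE.
Qed.

Lemma hom_extends s (Y X' X X'' : fmodule H s) (j : 'Hom(X', X)) (p : 'Hom(X, X'')) :
  ses j p -> (@extends s Y X' X j <-> hdim X Y = (hdim X' Y + hdim X'' Y)%N).
Proof.
move=> [[hj _] ep e]; rewrite (hom_con Y hj ep e) addnC; split.
  move=> L; congr (\dim _ + _)%N; apply/eqP; rewrite eqEsubv hom_prec //=.
  apply/subvP => f /mem_homsp/L[g hg ->]; rewrite -precE memv_img //.
  exact/mem_homsp.
move/addIn => e2 h hh.
have /eqP E : (prec Y j @: homsp X Y == homsp X' Y)%VS by rewrite eqEdim hom_prec // e2 /=.
have : h \in homsp X' Y by apply/mem_homsp.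
by rewrite -E => /memv_imgP[g /mem_homsp hg ->]; exists g; rewrite ?precE.
Qed.

Lemma hom_ses_le s (Y X' X X'' : fmodule H s) (j : 'Hom(X', X)) (p : 'Hom(X, X'')) :
  ses j p -> [/\ (hdim Y X' <= hdim Y X)%N, (hdim Y X <= hdim Y X' + hdim Y X'')%N,
    (hdim X'' Y <= hdim X Y)%N & (hdim X Y <= hdim X' Y + hdim X'' Y)%N].
Proof.
move=> [mj ep e]; have [hj _] := mj; have [hp _] := ep.
rewrite (hom_cov Y mj hp e) (hom_con Y hj ep e).
have := dimvS (hom_postc Y hp); have := dimvS (hom_prec Y hj).
by rewrite -!/(hdim _ _) => ? ?; split; lia.
Qed.

Lemma hom_iso s (M M' : fmodule H s) : iso M M' ->
  (forall N, hdim M N = hdim M' N) /\ (forall N, hdim N M = hdim N M').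
Proof.
have half (A B : fmodule H s) : iso A B ->
   (forall N, hdim A N <= hdim B N)%N /\ (forall N, hdim N A <= hdim N B)%N.
  move=> [f [mf ef]]; split=> N.
    have [Z [q sq]] := ses_quo ef; have [_ _ _ le] := hom_ses_le N sq.
    have Z0 : zero_module Z.
      have [mq _ eq] := sq; rewrite /zero_module (mono_dim mq) eq.
      by case: mf => _ ->; rewrite dimv0.
    by move: le; rewrite (hom_from0 N Z0).
  have [Z [q sq]] := ses_sub mf; by have [] := hom_ses_le N sq.
by move=> i; have [h1 h2] := half _ _ i; have [h3 h4] := half _ _ (iso_sym i);
  split=> N; apply/eqP; rewrite eqn_leq ?h1 ?h2 ?h3 ?h4.
Qed.

Lemma zero_iso s (M N : fmodule H s) : iso M N -> zero_module M -> zero_module N.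
Proof.
move=> /iso_sym[f [mf _]] /zero_moduleP M0; apply/zero_moduleP => x.
by case: mf => _ /lker_eq0P; apply; rewrite !(M0 (f _)).
Qed.

Lemma iso_zero s (M N : fmodule H s) : zero_module M -> zero_module N -> iso M N.
Proof.
move=> /zero_moduleP M0 /zero_moduleP N0; exists 0; split; split.
- exact: is_hom0.
- by apply/lker_eq0P => x y _; rewrite (M0 x) (M0 y).
- exact: is_hom0.
- by apply/limg_fullP => y; exists 0; rewrite (N0 y) linear0.
Qed.

End Homs.

(** * Direct sums and split sequences *)

Definition lfE := (comp_lfunE, id_lfunE, opp_lfunE, add_lfunE, scale_lfunE, zero_lfunE).

Section Sums.
Variables (K : fieldType) (H : falgType K).
Implicit Types s : side.

Lemma lcompP (U V W : vectType K) (g : 'Hom(V, W)) (f : 'Hom(U, V)) (h : 'Hom(U, W)) :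
  (g \o f)%VF = h <-> forall x, g (f x) = h x.
Proof.
split=> [<- x|e]; first by rewrite comp_lfunE.
by apply/lfunP => x; rewrite comp_lfunE e.
Qed.

Lemma zero_ex s : exists Z : fmodule H s, zero_module Z.
Proof.
have [Z [j [mj ej]]] := sub_ex (@submodule0 K H s (regular H s)).
by exists Z; rewrite /zero_module (mono_dim mj) ej dimv0.
Qed.

(** The mixed composites [p2 \o j1] and [p1 \o j2] vanish as a consequence
    ([biprod_cross]). *)
Definition biprod s (M1 M2 M : fmodule H s) (j1 : 'Hom(M1, M)) (p1 : 'Hom(M, M1))
    (j2 : 'Hom(M2, M)) (p2 : 'Hom(M, M2)) : Prop :=
  [/\ is_hom j1 /\ is_hom p1, is_hom j2 /\ is_hom p2,
      (forall x, p1 (j1 x) = x) /\ (forall x, p2 (j2 x) = x) &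
      forall x, x = j1 (p1 x) + j2 (p2 x)].

Definition sum_of s (M1 M2 M : fmodule H s) : Prop :=
  exists j1 p1 j2 p2, @biprod s M1 M2 M j1 p1 j2 p2.

Lemma biprod_cross s (M1 M2 M : fmodule H s) (j1 : 'Hom(M1, M)) (p1 : 'Hom(M, M1))
    (j2 : 'Hom(M2, M)) (p2 : 'Hom(M, M2)) :
  biprod j1 p1 j2 p2 -> (forall x, p2 (j1 x) = 0) /\ (forall x, p1 (j2 x) = 0).
Proof.
move=> [_ _ [e1 e2] e]; split=> x.
  have := e (j1 x); rewrite e1 -[X in X = _]addr0 => /addrI h.
  by rewrite -(e2 (p2 _)) -h linear0.
have := e (j2 x); rewrite e2 -[X in X = _]add0r => /addIr h.
by rewrite -(e1 (p1 _)) -h linear0.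
Qed.

Lemma biprod_sym s (M1 M2 M : fmodule H s) (j1 : 'Hom(M1, M)) (p1 : 'Hom(M, M1))
    (j2 : 'Hom(M2, M)) (p2 : 'Hom(M, M2)) :
  biprod j1 p1 j2 p2 -> biprod j2 p2 j1 p1.
Proof. by move=> [h1 h2 [e1 e2] e]; split=> // x; rewrite addrC. Qed.

Lemma sum_of_sym s (M1 M2 M : fmodule H s) : sum_of M1 M2 M -> sum_of M2 M1 M.
Proof. by move=> [j1 [p1 [j2 [p2 /biprod_sym b]]]]; exists j2, p2, j1, p1. Qed.

Lemma biprod_ses s (M1 M2 M : fmodule H s) (j1 : 'Hom(M1, M)) (p1 : 'Hom(M, M1))
    (j2 : 'Hom(M2, M)) (p2 : 'Hom(M, M2)) :
  biprod j1 p1 j2 p2 -> ses j1 p2.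
Proof.
move=> b; have [c1 c2] := biprod_cross b; case: b => [[hj1 hp1] [hj2 hp2] [e1 e2] e].
split.
- by split=> //; apply/lker_eq0P => x y; move/(congr1 p1); rewrite !e1.
- by split=> //; apply/limg_fullP => y; exists (j2 y).
apply/vspaceP => x; rewrite memv_ker; apply/idP/eqP.
  by move/mem_limgP => [y ->]; rewrite c1.
by move=> p0; apply/mem_limgP; exists (p1 x); rewrite {1}(e x) p0 linear0 addr0.
Qed.

Lemma sum_of_hom s (M1 M2 M : fmodule H s) : sum_of M1 M2 M ->
  (forall N, hdim M N = (hdim M1 N + hdim M2 N)%N) /\
  (forall N, hdim N M = (hdim N M1 + hdim N M2)%N).
Proof.
move=> [j1 [p1 [j2 [p2 b]]]]; have S := biprod_ses b.
have [[hj1 hp1] [hj2 hp2] [e1 e2] _] := b.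
split=> N.
  apply/(hom_extends N S) => h hh; exists (h \o p1)%VF; first exact: is_hom_comp.
  by apply/lfunP => x; rewrite !comp_lfunE e1.
apply/(hom_lifts N S) => h hh; exists (j2 \o h)%VF; first exact: is_hom_comp.
by apply/lfunP => x; rewrite !comp_lfunE e2.
Qed.

Lemma sum_of_iso s (M1 M2 M M' : fmodule H s) : sum_of M1 M2 M -> iso M M' ->
  sum_of M1 M2 M'.
Proof.
move=> [j1 [p1 [j2 [p2 [[hj1 hp1] [hj2 hp2] [e1 e2] e]]]]] [f [mf ef]].
have [g [[hg _] _ /lcompP gf /lcompP fg]] := iso_inv mf ef.
have [hf _] := mf.
exists (f \o j1)%VF, (p1 \o g)%VF, (f \o j2)%VF, (p2 \o g)%VF.
split; try by split; exact: is_hom_comp.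
  by split=> x; rewrite !comp_lfunE gf lfunE /= ?e1 ?e2.
by move=> x; have := fg x; rewrite id_lfunE {1}(e (g x)) linearD !comp_lfunE.
Qed.

Lemma sum_of_iso1 s (M1 M2 M M1' : fmodule H s) : sum_of M1 M2 M -> iso M1 M1' ->
  sum_of M1' M2 M.
Proof.
move=> [j1 [p1 [j2 [p2 [[hj1 hp1] [hj2 hp2] [e1 e2] e]]]]] [f [mf ef]].
have [g [[hg _] _ /lcompP gf /lcompP fg]] := iso_inv mf ef.
have [hf _] := mf.
exists (j1 \o g)%VF, (f \o p1)%VF, j2, p2.
split=> //; try by split; exact: is_hom_comp.
  by split=> x; rewrite ?comp_lfunE ?e1 ?e2 ?fg ?lfunE.
by move=> x; rewrite !comp_lfunE gf lfunE /= -e.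
Qed.

Lemma dsum_boolP s (F : bool -> fmodule H s) (M : fmodule H s) :
  dsum F M <-> sum_of (F true) (F false) M.
Proof.
split.
  move=> [j [p [hj hp e1 e2 e]]]; exists (j true), (p true), (j false), (p false).
  by split=> // x; rewrite {1}(e x) big_bool.
move=> [j1 [p1 [j2 [p2 b]]]]; have [c1 c2] := biprod_cross b.
case: b => [[hj1 hp1] [hj2 hp2] [e1 e2] e].
exists (fun b => if b return 'Hom(F b, M) then j1 else j2).
exists (fun b => if b return 'Hom(M, F b) then p1 else p2).
split; try by case.
  by case; case.
by move=> x; rewrite big_bool.
Qed.

Definition split_by s (M N : fmodule H s) (i : 'Hom(N, M)) (r : 'Hom(M, N)) :=
  [/\ is_hom i, is_hom r & (r \o i = \1)%VF].

Definition summand s (N M : fmodule H s) := exists i r, @split_by s M N i r.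

Lemma split_section s (X' X X'' : fmodule H s) (j : 'Hom(X', X)) (p : 'Hom(X, X''))
    (i : 'Hom(X'', X)) :
  ses j p -> split_by i p -> exists r, biprod j r i p.
Proof.
move=> [mj [hp _] e] [hi _ /lcompP pi].
have hd : is_hom (\1 - (i \o p))%VF.
  by apply: is_homD; [exact: is_hom_id|apply: is_homN; exact: is_hom_comp].
have [|r hr rE] := factor_mono mj hd.
  apply/subvP => _ /mem_limgP[x ->]; rewrite e memv_ker !lfE linearB /=.
  by rewrite pi !lfE subrr.
have [hj /lker_eq0P ij] := mj.
have rj x : j (r x) = x - i (p x).
  by move/lfunP/(_ x): rE; rewrite !lfE.
exists r; split=> //.
  split=> x; last by rewrite pi lfunE.
  by apply: ij; rewrite rj (ses_comp0 _ e) linear0 subr0.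
by move=> x; rewrite rj subrK.
Qed.

Lemma split_retraction s (X' X X'' : fmodule H s) (j : 'Hom(X', X)) (p : 'Hom(X, X''))
    (r : 'Hom(X, X')) :
  ses j p -> split_by j r -> exists i, biprod j r i p.
Proof.
move=> [[hj _] ep e] [_ hr /lcompP rj].
have hd : is_hom (\1 - (j \o r))%VF.
  by apply: is_homD; [exact: is_hom_id|apply: is_homN; exact: is_hom_comp].
have [|i hi iE] := factor_epi ep hd.
  rewrite -e; apply/subvP => _ /mem_limgP[x ->]; rewrite memv_ker !lfE.
  by rewrite rj !lfE subrr.
have [hp /limg_fullP sp] := ep.
have ip x : i (p x) = x - j (r x).
  by move/lfunP/(_ x): iE; rewrite !lfE.
exists i; split=> //.
  split=> x; first by rewrite rj lfunE.
  by have [y <-] := sp x; rewrite ip linearB /= (ses_comp0 _ e) subr0.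
by move=> x; rewrite ip addrC subrK.
Qed.

Lemma split_mono s (M N : fmodule H s) (i : 'Hom(N, M)) (r : 'Hom(M, N)) :
  split_by i r -> mono i /\ epi r.
Proof.
move=> [hi hr /lcompP e]; split; split=> //.
  by apply/lker_eq0P => x y /(congr1 r); rewrite !e !lfunE.
by apply/limg_fullP => y; exists (i y); rewrite e lfunE.
Qed.

Lemma summandP s (N M : fmodule H s) : summand N M <-> exists X, sum_of N X M.
Proof.
split=> [[i [r S]]|[X [j1 [p1 [j2 [p2 [[? ?] _ [e _] _]]]]]]].
  have [mi _] := split_mono S; have [X [p sp]] := ses_sub mi.
  by have [k b] := split_retraction sp S; exists X, i, r, k, p.
by exists j1, p1; split=> //; apply/lcompP => x; rewrite e lfunE.
Qed.

Lemma summand_refl s (M : fmodule H s) : summand M M.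
Proof.
exists \1%VF, \1%VF; split; try exact: is_hom_id.
by apply/lcompP => x; rewrite !lfunE.
Qed.

Lemma summand_trans s (A B C : fmodule H s) : summand A B -> summand B C -> summand A C.
Proof.
move=> [i [r [hi hr /lcompP e]]] [i' [r' [hi' hr' /lcompP e']]].
exists (i' \o i)%VF, (r \o r')%VF; split; try exact: is_hom_comp.
by apply/lcompP => x; rewrite !comp_lfunE e' lfunE /= e.
Qed.

Lemma sum_of_summand s (M1 M2 M : fmodule H s) : sum_of M1 M2 M ->
  summand M1 M /\ summand M2 M.
Proof.
by move=> S; split; apply/summandP; [exists M2|exists M1; exact: sum_of_sym].
Qed.

Lemma sum_of_0 s (M Z : fmodule H s) : zero_module Z -> sum_of M Z M.
Proof.
move=> /zero_moduleP Z0; exists \1%VF, \1%VF, 0, 0; split.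
- by split; exact: is_hom_id.
- by split; exact: is_hom0.
- by split=> x; rewrite !lfunE //= (Z0 x).
- by move=> x; rewrite !lfunE /= addr0.
Qed.

Lemma sum_of_zero s (M1 M2 M : fmodule H s) : sum_of M1 M2 M -> zero_module M2 -> iso M1 M.
Proof.
move=> [j1 [p1 [j2 [p2 b]]]] M20; have S := biprod_ses b; exists j1.
have [mj _ _] := S; split=> //.
by apply: mono_epi => //; rewrite (ses_dim S) M20 addn0.
Qed.

(** The complement of [A] in [M] is the kernel of the projection to [A]; the given
    projections to [B] and [C] restrict to it. *)
Lemma sum_of_assoc s (A B C AB M : fmodule H s) :
  sum_of A B AB -> sum_of AB C M -> exists2 BC, sum_of B C BC & sum_of A BC M.
Proof.
move=> S1 S2; have [[i1 [r1 s1]] _] := sum_of_summand S1.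
have [[i2 [r2 s2]] _] := sum_of_summand S2.
case: S1 => [j1 [p1 [j2 [p2 b1]]]]; case: S2 => [k1 [q1 [k2 [q2 b2]]]].
have [c1 c2] := biprod_cross b1; have [d1 d2] := biprod_cross b2.
case: b1 => [[hj1 hp1] [hj2 hp2] [e1 e2] e].
case: b2 => [[hk1 hq1] [hk2 hq2] [f1 f2] f].
have ep : epi (p1 \o q1)%VF.
  apply: epi_comp; split=> //; apply/limg_fullP => y; first by exists (k1 y).
  by exists (j1 y).
have [X [j sj]] := ses_quo ep.
have S : split_by (k1 \o j1)%VF (p1 \o q1)%VF.
  by split; try exact: is_hom_comp; apply/lcompP => x; rewrite !comp_lfunE f1 e1 lfunE.
have [r bX] := split_section sj S; exists X; last first.
  by apply: sum_of_sym; exists j, r, (k1 \o j1)%VF, (p1 \o q1)%VF.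
have [[hj hr] _ [g1 g2] g] := bX.
have [[_ /lker_eq0P ij] _ ej] := sj.
exists (r \o (k1 \o j2))%VF, (p2 \o (q1 \o j))%VF, (r \o k2)%VF, (q2 \o j)%VF.
have jr x : p1 (q1 x) = 0 -> j (r x) = x.
  by move=> h; rewrite [RHS]g !comp_lfunE h !linear0 addr0.
split; try by split; do ?exact: is_hom_comp.
- by split; (apply: is_hom_comp => //; exact: is_hom_comp).
- split=> x; rewrite !comp_lfunE jr ?f1 ?f2 ?e2 ?c2 ?d2 ?linear0 //.
move=> x; apply: ij; rewrite linearD /= !comp_lfunE !jr ?f1 ?c2 ?d2 ?linear0 //.
have h : p1 (q1 (j x)) = 0 by have := ses_comp0 x ej; rewrite comp_lfunE.
by rewrite {1}(f (j x)) {1}(e (q1 (j x))) h linear0 add0r.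
Qed.

End Sums.

(** * Fitting decompositions and local endomorphism rings *)

Section Fitting.
Variables (K : fieldType) (H : falgType K).
Implicit Types s : side.

Definition indecomposable s (M : fmodule H s) : Prop :=
  ~ zero_module M /\
  forall M1 M2, sum_of M1 M2 M -> zero_module M1 \/ zero_module M2.

Definition endo_pow s (M : fmodule H s) (f : 'Hom(M, M)) n : 'Hom(M, M) :=
  iter n (fun g => (f \o g)%VF) \1%VF.

Lemma endo_powD s (M : fmodule H s) (f : 'Hom(M, M)) m n :
  endo_pow f (m + n) = (endo_pow f m \o endo_pow f n)%VF.
Proof.
elim: m => [|m IH]; first by rewrite /= comp_lfun1l.
by rewrite addSn /= -/(endo_pow f _) IH comp_lfunA.
Qed.

Lemma endo_powSr s (M : fmodule H s) (f : 'Hom(M, M)) n :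
  endo_pow f n.+1 = (endo_pow f n \o f)%VF.
Proof. by rewrite -addn1 endo_powD /= comp_lfun1r. Qed.

Lemma endo_pow_hom s (M : fmodule H s) (f : 'Hom(M, M)) n :
  is_hom f -> is_hom (endo_pow f n).
Proof.
move=> hf; elim: n => [|n IH] /=; first exact: is_hom_id.
by apply: is_hom_comp => //.
Qed.

(** The images of the powers of [f] stabilise, and a stable image is a direct
    summand with complement the corresponding kernel. *)
Lemma fitting s (M : fmodule H s) (f : 'Hom(M, M)) : is_hom f ->
  exists (X Y : fmodule H s) n (j : 'Hom(X, M)) (q : 'Hom(M, Y)) (i : 'Hom(Y, M)),
    [/\ sum_of X Y M, ses j q, mono i & endo_pow f n.+1 = (i \o q)%VF].
Proof.
move=> hf.
have [n _ nmin] := @min_nat_ex nat (fun n => \dim (limg (endo_pow f n.+1)))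
  (fun=> True) 0%N Logic.I.
have hn := endo_pow_hom n.+1 hf.
have [Y [q [i [eq_ mi fE iE]]]] := image_ex hn.
have [X [j sj]] := ses_quo eq_.
have [hq _] := eq_; have [hi _] := mi.
have eqi : epi (q \o i)%VF.
  split; first exact: is_hom_comp.
  apply: eq_dim_full; rewrite (mono_dim mi) iE.
  have := nmin (n + n.+1)%N Logic.I; rewrite -addSn endo_powD {2 3}fE.
  have -> : ((i \o q) \o (i \o q) = i \o (q \o i) \o q)%VF.
    by apply/lfunP => x; rewrite !lfE.
  rewrite limg_comp => /leq_trans; apply.
  rewrite limg_comp; apply: leq_trans (_ : \dim ((q \o i) @: (q @: fullv)) <= _)%N.
    by rewrite -[X in (_ <= X)%N](limg_ker_dim i) leq_addl.
  by apply/dimvS/limgS/subvf.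
have mqi : mono (q \o i)%VF by exact: epi_mono.
have [g [[hg _] _ _ /lcompP qig]] := iso_inv mqi eqi.
have S : split_by (i \o g)%VF q.
  split=> //; first exact: is_hom_comp.
  by apply/lcompP => x; have := qig x; rewrite !lfE.
have [r b] := split_section sj S.
exists X, Y, n, j, q, i; split=> //.
by exists j, r, (i \o g)%VF, q.
Qed.

Lemma ses_mono s (X M Y : fmodule H s) (j : 'Hom(X, M)) (q : 'Hom(M, Y)) :
  ses j q -> zero_module X -> mono q.
Proof. by move=> S X0; have [_ eq_ _] := S; apply: epi_mono; rewrite // (ses_dim S) X0. Qed.

Lemma indec_endo s (M : fmodule H s) (f : 'Hom(M, M)) : indecomposable M ->
  is_hom f -> mono f \/ exists n, endo_pow f n = 0.
Proof.
move=> [M0 ind] hf; have [X [Y [n [j [q [i [S sj mi fE]]]]]]] := fitting hf.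
have [X0|Y0] := ind _ _ S; last first.
  right; exists n.+1; rewrite fE; apply/lfunP => x; rewrite !lfE.
  by have /zero_moduleP Y0' := Y0; rewrite (Y0' (q x)) linear0.
have [_ /lker_eq0P inj] := mono_comp (ses_mono sj X0) mi.
left; split=> //; apply/lker_eq0P => x y e.
by apply: inj; rewrite -fE endo_powSr !lfE e.
Qed.

Lemma endo_iso s (M : fmodule H s) (f : 'Hom(M, M)) : mono f -> epi f.
Proof. by move=> mf; exact: mono_epi. Qed.

(** The endomorphism ring of an indecomposable module is local: after normalizing
    the sum to the identity, a vector killed by [g] is fixed by [f], so [f] is not
    nilpotent if [g] is not injective. *)
Lemma indec_local s (M : fmodule H s) (f g : 'Hom(M, M)) : indecomposable M ->
  is_hom f -> is_hom g -> mono (f + g) -> mono f \/ mono g.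
Proof.
move=> iM hf hg mfg.
have [u [[hu _] _ /lcompP uE _]] := iso_inv mfg (endo_iso mfg).
have hf' := is_hom_comp hf hu; have hg' := is_hom_comp hg hu.
have cancel_l (h : 'Hom(M, M)) : is_hom h -> mono (u \o h)%VF -> mono h.
  move=> hh [_ /lker_eq0P i]; split=> //; apply/lker_eq0P => x y e.
  by apply: i; rewrite !lfE e.
have [mf|[n fn0]] := indec_endo iM hf'; first by left; apply: cancel_l.
right; split=> //; apply/lker_eq0P => x y e.
apply/eqP; rewrite -subr_eq0; apply/eqP; move: (x - y) (linearB g x y) => z /=.
rewrite e subrr => gz.
have fz : (u \o f)%VF z = z by have := uE z; rewrite !lfE gz addr0.
have fnz k : endo_pow (u \o f)%VF k z = z.
  by elim: k => [|k IH]; rewrite /= ?lfE // -/(endo_pow _ _) IH -comp_lfunE fz.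
by rewrite -(fnz n) fn0 !lfE.
Qed.

Lemma is_hom_sum s (M N : fmodule H s) (I : Type) (r : seq I) (P : pred I)
    (f : I -> 'Hom(M, N)) :
  (forall i, is_hom (f i)) -> is_hom (\sum_(i <- r | P i) f i).
Proof.
move=> hf; elim/big_ind: _ => //; [exact: is_hom0|move=> *; exact: is_homD].
Qed.

Lemma indec_local_sum s (M : fmodule H s) m (f : 'I_m -> 'Hom(M, M)) :
  indecomposable M -> (forall k, is_hom (f k)) -> mono (\sum_k f k) ->
  exists k, mono (f k).
Proof.
move=> iM; elim: m f => [|m IH] f hf.
  rewrite big_ord0 => -[_ /lker_eq0P h0]; case: iM => M0; case: M0.
  by apply/zero_moduleP => x; apply: h0; rewrite !lfE.
rewrite big_ord_recl => h.
have [||m0|m1] := indec_local iM _ _ h; first exact: hf.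
- by apply: is_hom_sum => k; exact: hf.
- by exists ord0.
by have [|k mk] := IH (fun k => f (lift ord0 k)) _ m1; [move=> *; exact: hf|exists (lift ord0 k)].
Qed.

(** The hypothesis presents [N] as a summand of the [m]-th power of [M]; locality
    selects one factor. *)
Lemma indec_summand_sum s (N M : fmodule H s) m (i : 'I_m -> 'Hom(N, M))
    (r : 'I_m -> 'Hom(M, N)) :
  indecomposable N -> (forall k, is_hom (i k)) -> (forall k, is_hom (r k)) ->
  (\sum_k (r k \o i k))%VF = \1%VF -> exists k, mono (r k \o i k)%VF.
Proof.
move=> iN hi hr e; apply: indec_local_sum => //.
  by move=> k; exact: is_hom_comp.
by rewrite e; split; [exact: is_hom_id|apply/lker_eq0P => x y; rewrite !lfE].
Qed.

Lemma mono_summand s (N M : fmodule H s) (i : 'Hom(N, M)) (r : 'Hom(M, N)) :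
  is_hom i -> is_hom r -> mono (r \o i)%VF -> summand N M.
Proof.
move=> hi hr m; have [u [[hu _] _ e _]] := iso_inv m (endo_iso m).
exists i, (u \o r)%VF; split=> //; first exact: is_hom_comp.
by rewrite -comp_lfunA.
Qed.

Lemma summand_indec s (N M : fmodule H s) : indecomposable M -> ~ zero_module N ->
  summand N M -> iso N M.
Proof.
move=> [_ iM] N0 /summandP[X S]; have [//|X0] := iM _ _ S.
exact: sum_of_zero S X0.
Qed.

(** A nonzero summand of least dimension is indecomposable. *)
Lemma indec_summand_ex s (M : fmodule H s) : ~ zero_module M ->
  exists2 N : fmodule H s, indecomposable N & summand N M.
Proof.
move=> M0.
have [N [N0 sN] Nmin] := @min_nat_ex _ (fun N : fmodule H s => \dim {: N})
  (fun N => ~ zero_module N /\ summand N M) M (conj M0 (summand_refl M)).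
exists N => //; split=> // N1 N2 S; have [s1 s2] := sum_of_summand S.
have [|n1] := pselect (zero_module N1); first by left.
right; have := Nmin N1 (conj n1 (summand_trans s1 sN)).
have [j1 [p1 [j2 [p2 /biprod_ses/ses_dim ->]]]] := S.
rewrite /zero_module; lia.
Qed.

(** * Powers, and modules determined by dimensions of homomorphism spaces *)

Section Power.
Variables (s : side) (M : fmodule H s) (m : nat).
Let V := {ffun 'I_m -> M}.

Definition pow_act0 (a : H) (f : V) : V := [ffun i => act M a (f i)].
Fact pow_act0_linear a : linear (pow_act0 a).
Proof. by move=> k f g; apply/ffunP => i; rewrite !ffunE linearP. Qed.
Fact pow_act_linear : linear (fun a => linfun (pow_act0 a)).
Proof.
move=> k a b; apply/lfunP => f; rewrite !lfE !(linE (pow_act0_linear _)).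
by apply/ffunP => i; rewrite !ffunE linearP !lfE.
Qed.
Definition pow_act : 'Hom(H, 'End(V)) := linfun (fun a => linfun (pow_act0 a)).
Lemma pow_actE a f i : pow_act a f i = act M a (f i).
Proof. by rewrite (linE pow_act_linear) (linE (pow_act0_linear _)) ffunE. Qed.
Fact pow_act1 f : pow_act 1 f = f.
Proof. by apply/ffunP => i; rewrite pow_actE act1. Qed.
Fact pow_actM a b f : pow_act (a * b) f =
  if s is Right then pow_act b (pow_act a f) else pow_act a (pow_act b f).
Proof.
apply/ffunP => i; rewrite pow_actE actM.
have side_if (t : side) (u v : V) : (if t is Right then u else v) i =
  if t is Right then u i else v i by case: t.
by rewrite side_if !pow_actE.
Qed.
Definition power : fmodule H s := FModule pow_act1 pow_actM.

Definition pow_prj (k : 'I_m) : 'Hom(power, M) := linfun (fun f : V => f k).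
Fact pow_prj_linear k : linear (fun f : V => f k).
Proof. by move=> c f g; rewrite !ffunE. Qed.
Lemma pow_prjE k (f : power) : pow_prj k f = f k.
Proof. exact: (linE (pow_prj_linear k)). Qed.
Lemma pow_prj_hom k : is_hom (pow_prj k).
Proof. by move=> a f; rewrite !pow_prjE pow_actE. Qed.

Fact pow_inj_linear (k : 'I_m) : linear (fun x : M => [ffun i => if i == k then x else 0] : V).
Proof.
move=> c f g; apply/ffunP => i; rewrite !ffunE.
by case: eqP; rewrite ?scaler0 ?addr0.
Qed.
Definition pow_inj (k : 'I_m) : 'Hom(M, power) :=
  linfun (fun x : M => [ffun i => if i == k then x else 0] : V).
Lemma pow_injE k x i : (pow_inj k x : V) i = if i == k then x else 0.
Proof. by rewrite (linE (pow_inj_linear k)) ffunE. Qed.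
Lemma pow_inj_hom k : is_hom (pow_inj k).
Proof.
move=> a x; apply/ffunP => i; rewrite pow_injE pow_actE pow_injE.
by case: eqP; rewrite ?linear0.
Qed.
Lemma pow_sum (f : power) : f = \sum_k pow_inj k (f k).
Proof.
apply/ffunP => i; rewrite sum_ffunE (bigD1 i) //= pow_injE eqxx big1 ?addr0 //.
by move=> k ki; rewrite pow_injE eq_sym (negbTE ki).
Qed.
End Power.

Lemma sum_of_unique s (A B M N : fmodule H s) : sum_of A B M -> sum_of A B N -> iso M N.
Proof.
move=> [j1 [p1 [j2 [p2 b]]]] [k1 [q1 [k2 [q2 c]]]].
have [b1 b2] := biprod_cross b; have [c1 c2] := biprod_cross c.
case: b => [[hj1 hp1] [hj2 hp2] [e1 e2] e]; case: c => [[hk1 hq1] [hk2 hq2] [f1 f2] f].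
pose u : 'Hom(M, N) := (k1 \o p1)%VF + (k2 \o p2)%VF; pose v : 'Hom(N, M) := (j1 \o q1)%VF + (j2 \o q2)%VF.
have vu x : v (u x) = x.
  by rewrite /v /u !lfE !linearD /= f1 f2 c1 c2 !linear0 addr0 add0r -e.
have uv x : u (v x) = x.
  by rewrite /v /u !lfE !linearD /= e1 e2 b1 b2 !linear0 addr0 add0r -f.
have hu : is_hom u by apply: is_homD; exact: is_hom_comp.
exists u; split; split=> //.
  by apply/lker_eq0P => x y h; rewrite -(vu x) h vu.
by apply/limg_fullP => y; exists (v y).
Qed.

Lemma sum_of_iso2 s (A B B' M : fmodule H s) : sum_of A B M -> iso B B' -> sum_of A B' M.
Proof. by move=> /sum_of_sym S i; apply/sum_of_sym/(sum_of_iso1 S). Qed.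

Lemma lin_comb_hom s (M N : fmodule H s) : exists m (f : 'I_m -> 'Hom(M, N)),
  (forall k, is_hom (f k)) /\
  forall h, is_hom h -> exists c : 'I_m -> K, h = \sum_k c k *: f k.
Proof.
exists (hdim M N), (fun k => (vbasis (homsp M N))`_k); split.
  by move=> k; apply/mem_homsp/vbasis_mem/mem_nth; rewrite size_tuple.
move=> h /mem_homsp/coord_vbasis ->.
by exists (fun k => coord (vbasis (homsp M N)) k h).
Qed.

(** If [M] and [N] have equal dimensions of homomorphisms into every module, apply
    this to the kernel of the universal map [M^m -> N]: as every [M -> N] factors
    through that map, so does every [N -> N] for reasons of dimension. *)
Lemma hdim_eq_power s (M N : fmodule H s) : (forall Y, hdim M Y = hdim N Y) ->
  exists m (f : 'I_m -> 'Hom(M, N)) (g : 'I_m -> 'Hom(N, M)),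
    [/\ forall k, is_hom (f k), forall k, is_hom (g k) &
        (\sum_k (f k \o g k))%VF = \1%VF].
Proof.
move=> eMN; have [m [f [hf fgen]]] := lin_comb_hom M N.
pose p : 'Hom(power M m, N) := \sum_k (f k \o pow_prj M k)%VF.
have hp : is_hom p by apply: is_hom_sum => k; apply: is_hom_comp => //; exact: pow_prj_hom.
have [X [j [mj ej]]] := sub_ex (submodule_ker hp).
have liftM : (homsp M N <= postc M p @: homsp M (power M m))%VS.
  apply/subvP => h /mem_homsp/fgen[c ->].
  apply/memv_imgP; exists (\sum_k c k *: pow_inj M k).
    apply/mem_homsp/is_hom_sum => k; rewrite -[X in is_hom X]addr0.
    by apply: is_homZD; [exact: pow_inj_hom|exact: is_hom0].
  rewrite postcE; apply/lfunP => x; rewrite !lfE !sum_lfunE.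
  apply: eq_bigr => k _; rewrite !lfE pow_prjE sum_ffunE (bigD1 k) //= big1.
    by rewrite !lfE ffunE pow_injE eqxx addr0 linearZ.
  by move=> l lk; rewrite !lfE ffunE pow_injE eq_sym (negbTE lk) scaler0.
have eqd : \dim (postc N p @: homsp N (power M m)) = hdim N N.
  have := hom_cov M mj hp ej; have := hom_cov N mj hp ej.
  rewrite -!eMN => ->; have -> : \dim (postc M p @: homsp M (power M m)) = hdim M N.
    by apply/eqP; rewrite eqn_leq (dimvS liftM) dimvS // hom_postc.
  by rewrite eMN => /addnI.
have : (\1%VF : 'Hom(N, N)) \in (postc N p @: homsp N (power M m))%VS.
  have /eqP -> : (postc N p @: homsp N (power M m) == homsp N N)%VS.
    by rewrite eqEdim hom_postc //= eqd.
  by apply/mem_homsp; exact: is_hom_id.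
case/memv_imgP => g /mem_homsp hg idE.
exists m, f, (fun k => (pow_prj M k \o g)%VF); split=> //.
  by move=> k; apply: is_hom_comp => //; exact: pow_prj_hom.
by rewrite idE postcE; apply/lfunP => x; rewrite !lfE !sum_lfunE; apply: eq_bigr => k _; rewrite !lfE.
Qed.

(** A theorem of Bongartz. By [hdim_eq_power] and locality an
    indecomposable summand of [N] is also one of [M]; cancel it and repeat. *)
Lemma hdim_iso s (M N : fmodule H s) : (forall Y, hdim M Y = hdim N Y) -> iso M N.
Proof.
have [k] := ubnP (\dim {: M}); elim: k M N => // k IH M N leM eMN.
have [N0|N0] := pselect (zero_module N).
  apply: iso_zero => //; apply: contrapT => M0.
  by have := hom_self M0; rewrite eMN hom_from0.
have [N1 iN1 [i [r [hi hr e]]]] := indec_summand_ex N0.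
have [m [f [g [hf hg fg]]]] := hdim_eq_power eMN.
have [l|l||l ml] := @indec_summand_sum s N1 M m (fun k => g k \o i)%VF (fun k => r \o f k)%VF iN1.
- exact: is_hom_comp.
- exact: is_hom_comp.
- rewrite -e; apply/lfunP => x; rewrite !lfE sum_lfunE.
  have -> : i x = (\sum_k (f k \o g k))%VF (i x) by rewrite fg !lfE.
  by rewrite sum_lfunE linear_sum; apply: eq_bigr => k' _; rewrite !lfE.
have /summandP[M' SM] : summand N1 M.
  by apply: mono_summand ml; exact: is_hom_comp.
have /summandP[N' SN] : summand N1 N by exists i, r.
have iM' : iso M' N'.
  apply: IH.
    have [j1 [p1 [j2 [p2 /biprod_ses/ses_dim dM]]]] := SM.
    by case: iN1 => N10 _; move: N10 leM; rewrite /zero_module dM; lia.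
  move=> Y; have := eMN Y; rewrite (sum_of_hom SM).1 (sum_of_hom SN).1; lia.
exact: sum_of_unique (sum_of_iso2 SM iM') SN.
Qed.

End Fitting.

(** * Projective modules and projective covers *)

Section Projective.
Variables (K : fieldType) (H : falgType K).
Implicit Types s : side.

Fact orbit_linear s (X : fmodule H s) (x : X) : linear (fun a => act X a x).
Proof. by move=> k a b; rewrite linearP !lfE. Qed.

Definition orbit_map s (X : fmodule H s) (x : X) : 'Hom(regular H s, X) :=
  linfun (fun a => act X a x).

Lemma orbitE s (X : fmodule H s) (x : X) a : orbit_map x a = act X a x.
Proof. exact: (linE (orbit_linear x)). Qed.

Lemma regular_actE s a (x : H) :
  regular_act H s a x = if s is Right then x * a else a * x.
Proof. by case: s; do !rewrite lfunE /=. Qed.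

Lemma act_regular s (X : fmodule H s) a (c : regular H s) x :
  act X (act (regular H s) a c) x = act X a (act X c x).
Proof.
rewrite -[act (regular H s) a c]/(regular_act H s a c) regular_actE.
by case: s X c x => X c x; rewrite actM.
Qed.

Lemma act_regular1 s a : act (regular H s) a 1 = a.
Proof.
rewrite -[act (regular H s) a 1]/(regular_act H s a 1) regular_actE.
by case: s; rewrite ?mulr1 ?mul1r.
Qed.

Lemma orbit_hom s (X : fmodule H s) (x : X) : is_hom (orbit_map x).
Proof. by move=> a c; rewrite !orbitE act_regular. Qed.

Lemma hom_regular s (X : fmodule H s) (f : 'Hom(regular H s, X)) :
  is_hom f -> f = orbit_map (f 1).
Proof.
by move=> hf; apply/lfunP => a; rewrite orbitE -hf act_regular1.
Qed.

Lemma regular_projective s : projective (regular H s).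
Proof.
move=> M N p f [hp /limg_fullP sp] hf; have [m pm] := sp (f 1).
exists (orbit_map m); first exact: orbit_hom.
by apply/lfunP => a; rewrite (hom_regular hf) !lfE !orbitE hp pm.
Qed.

Lemma power_projective s (P : fmodule H s) m : projective P -> projective (power P m).
Proof.
move=> pP M N p f ep hf.
have [k|h hh hE] := @fin_all_exists2 _ _ (fun k (h : 'Hom(P, M)) => is_hom h)
   (fun k h => (f \o pow_inj P k)%VF = (p \o h)%VF).
  by apply: pP => //; apply: is_hom_comp => //; exact: pow_inj_hom.
exists (\sum_k (h k \o pow_prj P k)%VF).
  by apply: is_hom_sum => k; apply: is_hom_comp => //; exact: pow_prj_hom.
apply/lfunP => x; rewrite {1}(pow_sum x) !lfE sum_lfunE !linear_sum.
apply: eq_bigr => k _; rewrite !lfE pow_prjE.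
by have /lfunP/(_ (x k)) := hE k; rewrite !lfE.
Qed.

Lemma free_epi s (M : fmodule H s) :
  exists m (p : 'Hom(power (regular H s) m, M)), epi p.
Proof.
pose b := vbasis {: M}.
pose p : 'Hom(power (regular H s) (\dim {: M}), M) :=
  \sum_(k < \dim {: M}) (orbit_map (b`_k) \o pow_prj _ k)%VF.
exists (\dim {: M}), p; split.
  apply: is_hom_sum => k; apply: is_hom_comp; first exact: pow_prj_hom.
  exact: orbit_hom.
apply/limg_fullP => x.
exists (finfun (fun k => coord b k x *: 1) : {ffun _ -> regular H s}).
rewrite /p sum_lfunE [RHS](coord_vbasis (memvf x)); apply: eq_bigr => k _.
by rewrite !lfE pow_prjE ffunE orbitE linearZ lfE act1.
Qed.

Lemma projective_summand s (Q P : fmodule H s) : summand Q P -> projective P -> projective Q.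
Proof.
move=> [i [r [hi hr /lcompP e]]] pP M N p f ep hf.
have [g hg gE] := pP M N p (f \o r)%VF ep (is_hom_comp hr hf).
exists (g \o i)%VF; first exact: is_hom_comp.
by apply/lfunP => x; have /lfunP/(_ (i x)) := gE; rewrite !lfE e lfE.
Qed.

Lemma projective_sum s (P Q M : fmodule H s) :
  sum_of P Q M -> projective P -> projective Q -> projective M.
Proof.
move=> [j1 [p1 [j2 [p2 [[hj1 hp1] [hj2 hp2] [e1 e2] e]]]]] pP pQ X N p f ep hf.
have [g1 hg1 gE1] := pP X N p (f \o j1)%VF ep (is_hom_comp hj1 hf).
have [g2 hg2 gE2] := pQ X N p (f \o j2)%VF ep (is_hom_comp hj2 hf).
exists ((g1 \o p1)%VF + (g2 \o p2)%VF).
  by apply: is_homD; exact: is_hom_comp.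
apply/lfunP => x; rewrite {1}(e x) !lfE !linearD /=.
have /lfunP/(_ (p1 x)) := gE1; have /lfunP/(_ (p2 x)) := gE2.
by rewrite !lfE => -> ->.
Qed.

Lemma injective_sum s (P Q M : fmodule H s) :
  sum_of P Q M -> injective_module P -> injective_module Q -> injective_module M.
Proof.
move=> [j1 [p1 [j2 [p2 [[hj1 hp1] [hj2 hp2] [e1 e2] e]]]]] pP pQ X N p f ep hf.
have [g1 hg1 gE1] := pP X N p (p1 \o f)%VF ep (is_hom_comp hf hp1).
have [g2 hg2 gE2] := pQ X N p (p2 \o f)%VF ep (is_hom_comp hf hp2).
exists ((j1 \o g1)%VF + (j2 \o g2)%VF).
  by apply: is_homD; exact: is_hom_comp.
apply/lfunP => x; rewrite {1}(e (f x)) !lfE.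
have /lfunP/(_ x) := gE1; have /lfunP/(_ x) := gE2.
by rewrite !lfE => -> ->.
Qed.

Lemma projective_zero s (Z : fmodule H s) : zero_module Z -> projective Z.
Proof.
move=> Z0 M N p f _ _; exists 0; first exact: is_hom0.
apply/lfunP => x; have /zero_moduleP Zx := Z0.
by rewrite (Zx x) !linear0.
Qed.

Lemma injective_zero s (Z : fmodule H s) : zero_module Z -> injective_module Z.
Proof.
move=> Z0 M N p f _ _; exists 0; first exact: is_hom0.
apply/lfunP => x; have /zero_moduleP Zx := Z0.
by rewrite [LHS]Zx [RHS]Zx.
Qed.

Lemma projective_hdim s (P X' X X'' : fmodule H s) (j : 'Hom(X', X)) (p : 'Hom(X, X'')) :
  projective P -> ses j p -> hdim P X = (hdim P X' + hdim P X'')%N.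
Proof.
move=> pP S; apply/(hom_lifts P S) => h hh; have [_ ep _] := S.
exact: pP ep hh.
Qed.

Lemma injective_hdim s (P X' X X'' : fmodule H s) (j : 'Hom(X', X)) (p : 'Hom(X, X'')) :
  injective_module P -> ses j p -> hdim X P = (hdim X' P + hdim X'' P)%N.
Proof.
move=> pP S; apply/(hom_extends P S) => h hh; have [ep _ _] := S.
exact: pP ep hh.
Qed.

Lemma projective_split s (P M : fmodule H s) (p : 'Hom(M, P)) :
  projective P -> epi p -> exists i, split_by i p.
Proof.
move=> pP ep; have [i hi e] := pP M P p \1%VF ep (@is_hom_id _ _ _ P).
by exists i; split=> //; case: ep.
Qed.

Lemma injective_split s (E M : fmodule H s) (j : 'Hom(E, M)) :
  injective_module E -> mono j -> exists r, split_by j r.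
Proof.
move=> pP ep; have [i hi e] := pP E M j \1%VF ep (@is_hom_id _ _ _ E).
by exists i; split=> //; case: ep.
Qed.

(** Split a free cover of [P] and read off coordinates. *)
Lemma dual_basis s (P : fmodule H s) : projective P ->
  exists m (e : 'I_m -> P) (h : 'I_m -> 'Hom(P, regular H s)),
    (forall k, is_hom (h k)) /\ forall x, x = \sum_k act P (h k x) (e k).
Proof.
move=> pP; have [m [p ep]] := free_epi P.
have [i [hi hp /lcompP e]] := projective_split pP ep.
exists m, (fun k : 'I_m => p (pow_inj (regular H s) k (1 : H))), (fun k => (pow_prj _ k \o i)%VF); split.
  by move=> k; apply: is_hom_comp => //; exact: pow_prj_hom.
move=> x; have ex : p (i x) = x by rewrite e lfE.
rewrite -[LHS]ex {1}(pow_sum (i x)) linear_sum.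
apply: eq_bigr => k _; rewrite !lfE pow_prjE -hp -pow_inj_hom.
by rewrite act_regular1.
Qed.

(** A projective module of least dimension mapping onto [M] is a projective
    cover: if [U] also covers [M], an endomorphism over [M] with values in [U] has
    a power whose image is a summand still mapping onto [M]. *)
Lemma projective_cover s (M : fmodule H s) :
  exists (P : fmodule H s) (p : 'Hom(P, M)),
    [/\ projective P, epi p & superfluous_kernel p].
Proof.
have [m0 [p0 ep0]] := free_epi M.
have [P [pP [p ep]] Pmin] := @min_nat_ex (fmodule H s) (fun P => \dim {: P})
  (fun P => projective P /\ exists p : 'Hom(P, M), epi p) _
  (conj (power_projective (@regular_projective s)) (ex_intro _ p0 ep0)).
exists P, p; split=> // U hU Uk.
have [X [j [mj ej]]] := sub_ex hU.
have [hp sp] := ep; have [hj _] := mj.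
have epj : epi (p \o j)%VF.
  split; first exact: is_hom_comp.
  rewrite limg_comp ej -sp -Uk limgD; apply/eqP; rewrite eqEsubv addvSl /=.
  apply/subvP => y /memv_addP[u Uu [v /memv_imgP[w]]].
  by rewrite memv_ker => /eqP-> ->-> ; rewrite addr0.
have [g hg gE] := pP X M (p \o j)%VF p epj hp.
have hjg : is_hom (j \o g)%VF by exact: is_hom_comp.
have [A [B [n [k [q [i [S skq mi fE]]]]]]] := fitting hjg.
have pow_p k' : (p \o endo_pow (j \o g) k')%VF = p.
  elim: k' => [|k' IH]; first by rewrite comp_lfun1r.
  by rewrite /= -/(endo_pow _ _) comp_lfunA comp_lfunA -gE.
have B_P : (\dim {: P} <= \dim {: B})%N.
  apply: Pmin; split; first exact: projective_summand (sum_of_summand S).2 pP.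
  exists (p \o i)%VF; split; first by apply: is_hom_comp => //; case: mi.
  apply/limg_fullP => y; have /limg_fullP/(_ y)[x <-] := sp.
  exists (q x); rewrite -{2}(pow_p n.+1) fE !lfE //.
have epow : epi (endo_pow (j \o g)%VF n.+1).
  rewrite fE; apply: epi_comp; first by case: skq.
  exact: mono_epi.
apply/eqP; rewrite eqEsubv subvf /= -ej.
case: epow => _ <-; rewrite /= -comp_lfunA limg_comp; apply: limgS; exact: subvf.
Qed.

End Projective.

(** * Duality *)

Section Duality.
Variables (K : fieldType) (H : falgType K).
Implicit Types s : side.

Lemma dim_dual (V : vectType K) : \dim {: 'Hom(V, K^o)} = \dim {: V}.
Proof. by rewrite !dimvf /dim /= muln1. Qed.

Lemma functional_ex (V : vectType K) (x : V) : x <> 0 ->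
  exists phi : 'Hom(V, K^o), phi x <> 0.
Proof.
move=> x0; apply: contrapT => no; apply: x0.
rewrite (coord_vbasis (memvf x)) big1 // => k _.
have linc : linear (coord (vbasis {: V}) k : V -> K^o) by move=> c u v; rewrite linearP.
suff -> : coord (vbasis {: V}) k x = 0 by rewrite scale0r.
apply: contrapT => h; apply: no; exists (linfun (coord (vbasis {: V}) k : V -> K^o)).
by rewrite (linE linc).
Qed.

Lemma is_hom_dmap s (M N : fmodule H s) (f : 'Hom(M, N)) :
  is_hom f -> is_hom (prec K^o f : 'Hom(dual N, dual M)).
Proof.
move=> hf a phi; apply/lfunP => x.
by rewrite precE lfE !dual_actE precE lfE hf.
Qed.

Lemma dmap_mono s (M N : fmodule H s) (f : 'Hom(M, N)) :
  epi f -> mono (prec K^o f : 'Hom(dual N, dual M)).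
Proof.
move=> ef; split; first by apply: is_hom_dmap; case: ef.
have [_ /limg_fullP sf] := ef.
apply/lker_eq0P => u v; rewrite !precE => e; apply/lfunP => y; have [x <-] := sf y.
by have /lfunP/(_ x) := e; rewrite !lfE.
Qed.

Lemma dmap_epi s (M N : fmodule H s) (f : 'Hom(M, N)) :
  mono f -> epi (prec K^o f : 'Hom(dual N, dual M)).
Proof.
move=> [hf kf]; split; first exact: is_hom_dmap.
apply/limg_fullP => phi; exists (phi \o f^-1)%VF; rewrite precE.
by apply/lfunP => x; rewrite !lfE lker0_lfunK //; apply/eqP.
Qed.

Fact flip_linear1 (V W : vectType K) (f : 'Hom(V, 'Hom(W, K^o))) (y : W) :
  linear (fun x => f x y : K^o).
Proof. by move=> k u v; rewrite linearP !lfE. Qed.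

Fact flip_linear2 (V W : vectType K) (f : 'Hom(V, 'Hom(W, K^o))) :
  linear (fun y => linfun (fun x => f x y : K^o)).
Proof.
move=> k u v; apply/lfunP => x; rewrite !lfE !(linE (flip_linear1 _ _)).
by rewrite linearP.
Qed.

Definition flip (V W : vectType K) (f : 'Hom(V, 'Hom(W, K^o))) :
  'Hom(W, 'Hom(V, K^o)) := linfun (fun y => linfun (fun x => f x y : K^o)).

Lemma flipE (V W : vectType K) (f : 'Hom(V, 'Hom(W, K^o))) x y : flip f y x = f x y.
Proof. by rewrite (linE (flip_linear2 f)) (linE (flip_linear1 f y)). Qed.

Fact flip_linear (V W : vectType K) : linear (@flip V W).
Proof. by move=> k f g; apply/lfunP => y; apply/lfunP => x; rewrite !(flipE, lfE). Qed.

(** Stated without [is_hom], because the double opposite of a variable side is not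
    convertible to that side. *)
Lemma flip_hom s t (X : fmodule H s) (Y : fmodule H t) (f : 'Hom(X, 'Hom(Y, K^o))) :
  (forall a x, f (act X a x) = dual_act Y a (f x)) ->
  forall a y, flip f (act Y a y) = dual_act X a (flip f y).
Proof.
move=> hf a y; apply/lfunP => x.
by rewrite dual_actE !flipE hf dual_actE.
Qed.

Lemma hdim_flip (X : fmodule H Right) (Y : fmodule H Left) :
  hdim X (dual Y) = hdim Y (dual X).
Proof.
pose F := linfun (@flip X Y).
rewrite /hdim -(limg_dim_eq (f := F) (U := homsp X (dual Y))).
  congr (\dim _); apply/vspaceP => g.
  have [g1 g2] := @mem_homsp _ _ Left Y (dual X) g; apply/memv_imgP/idP => [[f fh ->]|/g1 hg].
    have [f1 _] := @mem_homsp _ _ Right X (dual Y) f.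
    have [_ f2] := @mem_homsp _ _ Left Y (dual X) (F f); apply: f2.
    by rewrite (linE (@flip_linear X Y)); apply: flip_hom; exact: f1.
  have [_ f2] := @mem_homsp _ _ Right X (dual Y) (flip g).
  exists (flip g); first by apply: f2; exact: flip_hom.
  by rewrite (linE (@flip_linear X Y)); apply/lfunP => y; apply/lfunP => x; rewrite !flipE.
apply/eqP; rewrite -subv0; apply/subvP => f; rewrite memv_cap memv_ker => /andP[_].
rewrite (linE (@flip_linear X Y)) memv0 => /eqP e; apply/eqP/lfunP => x; apply/lfunP => y.
by rewrite -flipE e !lfE.
Qed.

Definition eval s (M : fmodule H s) : 'Hom(M, 'Hom('Hom(M, K^o), K^o)) :=
  flip (\1%VF : 'End('Hom(M, K^o))).

Lemma evalE s (M : fmodule H s) x phi : eval M x phi = phi x.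
Proof. by rewrite flipE lfE. Qed.

Lemma eval_inj s (M : fmodule H s) : injective (eval M).
Proof.
move=> x y e; apply: contrapT => xy.
have [phi] : exists phi : 'Hom(M, K^o), phi (x - y) <> 0.
  by apply: functional_ex => /eqP; rewrite subr_eq0 => /eqP.
by apply; have /lfunP/(_ phi) := e; rewrite !evalE linearB /= => ->; rewrite subrr.
Qed.

Lemma eval_act s (M : fmodule H s) a x :
  eval M (act M a x) = dual_act (dual M) a (eval M x).
Proof.
apply/lfunP => phi; rewrite evalE.
rewrite (@dual_actE K H (opp s) (dual M) a (eval M x) phi) evalE.
by rewrite -[RHS]/(dual_act M a phi x) dual_actE.
Qed.

Lemma eval_surj s (M : fmodule H s) : limg (eval M) = fullv.
Proof.
apply: eq_dim_full; rewrite !dim_dual limg_dim_eq //.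
have /lker_eq0P -> := @eval_inj s M; exact: capv0.
Qed.

Lemma ddualR (M : fmodule H Right) : iso M (dual (dual M)).
Proof.
exists (eval M); split; split; try exact: eval_act.
  by apply/lker_eq0P; exact: eval_inj.
exact: eval_surj.
Qed.

Lemma ddualL (M : fmodule H Left) : iso M (dual (dual M)).
Proof.
exists (eval M); split; split; try exact: eval_act.
  by apply/lker_eq0P; exact: eval_inj.
exact: eval_surj.
Qed.

Lemma hdim_dual (X Y : fmodule H Right) : hdim (dual Y) (dual X) = hdim X Y.
Proof. by rewrite -hdim_flip -(hom_iso (ddualR Y)).2. Qed.

Lemma dual_iso s (M N : fmodule H s) : iso M N -> iso (dual N) (dual M).
Proof.
by move=> [f [mf ef]]; exists (prec K^o f); split; [exact: dmap_mono|exact: dmap_epi].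
Qed.

(** Maps into [D P] correspond to maps out of [P] by exchanging the two arguments. *)
Lemma dual_projective (P : fmodule H Left) : projective P -> injective_module (dual P).
Proof.
move=> pP M N j f mj hf.
have [g hg gE] := pP _ _ _ _ (dmap_epi mj) (flip_hom hf : is_hom (flip f : 'Hom(P, dual M))).
exists (flip g : 'Hom(N, dual P)); first exact: flip_hom.
apply/lfunP => x; apply/lfunP => p; rewrite lfE flipE.
by have /lfunP/(_ p)/lfunP/(_ x) := gE; rewrite flipE lfE precE lfE.
Qed.

(** Dualize the lifting problem, extend along the mono [D p], and dualize back; the
    result takes values in the double dual of [X], that is, in [X]. *)
Lemma projective_of_dual (M : fmodule H Left) :
  injective_module (dual M) -> projective M.
Proof.
move=> iM X Y p f ep hf; have [hp _] := ep.
have [g hg gE] := iM _ _ _ _ (dmap_mono ep) (is_hom_dmap hf).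
have [ev [[hev _] _ /lcompP ev1 /lcompP ev2]] :
   exists ev : 'Hom(dual (dual X), X), [/\ mono ev, epi ev,
     (ev \o eval X = \1)%VF & (eval X \o ev = \1)%VF].
  apply: (@iso_inv _ _ Left X (dual (dual X)) (eval X)).
    by split; [exact: eval_act|apply/lker_eq0P; exact: eval_inj].
  by split; [exact: eval_act|exact: eval_surj].
have hgf : is_hom (flip g : 'Hom(M, dual (dual X))) by exact: flip_hom.
exists (ev \o flip g)%VF; first exact: is_hom_comp.
apply/lfunP => m; apply: (@eval_inj Left Y); apply/lfunP => phi.
rewrite !evalE !lfE.
have -> : phi (p (ev (flip g m))) = eval X (ev (flip g m)) (prec K^o p phi).
  by rewrite evalE precE lfE.
rewrite ev2 lfE flipE.
by have /lfunP/(_ phi)/lfunP/(_ m) := gE; rewrite lfE [prec K^o f phi]precE lfE.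
Qed.

End Duality.

(** * The Auslander-Reiten formula for the transpose *)

Section Transpose.
Variables (K : fieldType) (H : falgType K).
Implicit Types s : side.

(** Restriction to [C] maps the dual of [V] onto the dual of [C]. *)
Lemma annihilator_dim (V : vectType K) (C : {vspace V}) :
  (\dim (vsp (fun phi : 'Hom(V, K^o) => forall x, x \in C -> phi x = 0%R)) + \dim C
    = \dim {: V})%N.
Proof.
pose j : 'Hom(subvs_of C, V) := linfun vsval.
have jE x : j x = vsval x by rewrite lfunE.
have := limg_ker_dim (prec K^o j) fullv; rewrite capfv dim_dual => <-.
congr (_ + _)%N.
  congr (\dim _); apply/vspaceP => phi; rewrite memv_ker precE.
  set P := fun _ => _; have lcP : lin_closed P.
    split=> [x _|k u v hu hv x Cx]; first by rewrite lfE.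
    by rewrite !lfE hu // hv // scaler0 addr0.
  have [m1 m2] := mem_vsp lcP phi.
  apply/idP/eqP => [/m1 h|h].
    by apply/lfunP => x; rewrite !lfE jE h // subvsP.
  apply: m2 => x Cx; have /lfunP/(_ (vsproj C x)) := h.
  by rewrite !lfE jE vsprojK.
have -> : \dim C = \dim {: 'Hom(subvs_of C, K^o)} by rewrite dim_dual dimvf.
congr (\dim _); apply/esym/limg_fullP => mu.
exists (mu \o linfun (vsproj C))%VF; rewrite precE; apply/lfunP => x.
by rewrite !lfE jE lfunE /= vsvalK.
Qed.

Lemma regular_act_opp s (a b : H) :
  regular_act H s a b = regular_act H (opp s) b a.
Proof. by rewrite !regular_actE; case: s. Qed.

Lemma regular_act_comm s (a b x : H) :
  regular_act H (opp s) a (regular_act H s b x) =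
  regular_act H s b (regular_act H (opp s) a x).
Proof. by rewrite !regular_actE; case: s; rewrite /= mulrA. Qed.

Lemma act_regular_opp s (X : fmodule H s) (a c : H) x :
  act X (regular_act H (opp s) a c) x = act X c (act X a x).
Proof. by rewrite regular_actE; case: s X x => X x; rewrite actM. Qed.

Section Formula.
Variables (s : side) (M : fmodule H s) (T : fmodule H (opp s)) (P1 P0 : fmodule H s).
Variables (p1 : 'Hom(P1, P0)) (p0 : 'Hom(P0, M)) (q : 'Hom('Hom(P1, regular H s), T)).
Hypotheses (pP1 : projective P1) (pP0 : projective P0) (ep0 : epi p0) (hp1 : is_hom p1).
Hypothesis p10 : limg p1 = lker p0.
Hypothesis qact : forall a (h : 'Hom(P1, regular H s)), is_hom h ->
  q (act (regular H (opp s)) a \o h)%VF = act T a (q h).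
Hypothesis qsurj : forall t, exists2 h : 'Hom(P1, regular H s), is_hom h & q h = t.
Hypothesis qker : forall h : 'Hom(P1, regular H s), is_hom h ->
  (q h = 0 <-> exists2 h0 : 'Hom(P0, regular H s), is_hom h0 & h = (h0 \o p1)%VF).
Variable X : fmodule H s.

(** For a dual basis [e_k], [h_k] of [P1], the pairing
    [(g, f) |-> \sum_k g (q h_k) (f e_k)] between [Hom_H(T, D X)] and [Hom_H(P1, X)] is
    nondegenerate on the left, and its right kernel consists of the maps that factor
    through [p1]. So [Hom_H(T, D X)] is the annihilator of the image of
    [Hom_H(P0, X)] in the dual of [Hom_H(P1, X)]. *)
Lemma transpose_hdim :
  (hdim T (dual X) + hdim P0 X = hdim M X + hdim P1 X)%N.
Proof.
have [m [e [h [hh he]]]] := dual_basis pP1.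
pose V : vectType K := 'Hom(P1, X); pose U := homsp P1 X.
pose I := (prec X p1 @: homsp P0 X)%VS.
have UUC : (U :&: U^C)%VS = 0%VS := capv_compl U.
pose pi : 'End(V) := daddv_pi U U^C.
have piU f : is_hom f -> pi f = f.
  by move=> hf; apply: daddv_pi_id => //; exact/mem_homsp.
have piC f : f \in (U^C)%VS -> pi f = 0.
  move=> Cf; have := daddv_pi_add UUC (_ : f \in (U + U^C)%VS).
  rewrite addv_complf memvf => /(_ isT).
  have UCU : (U^C :&: U)%VS = 0%VS by rewrite capvC.
  rewrite (daddv_pi_id UCU Cf) => /eqP.
  by rewrite -[X in _ == X]add0r => /eqP/addIr.
have pi_hom f : is_hom (pi f) by apply/mem_homsp; exact: memv_pi.
pose Phi0 (g : 'Hom(T, 'Hom(X, K^o))) (f : V) : K^o := \sum_k g (q (h k)) (pi f (e k)).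
have lin1 g : linear (Phi0 g).
  move=> c u v; rewrite /Phi0 scaler_sumr -big_split; apply: eq_bigr => k _ /=.
  by rewrite linearP !lfE linearP.
pose Phi1 g : 'Hom(V, K^o) := linfun (Phi0 g).
have Phi1E g f : is_hom f -> Phi1 g f = \sum_k g (q (h k)) (f (e k)).
  by move=> hf; rewrite /Phi1 (linE (lin1 g)) /Phi0 piU.
have lin2 : linear Phi1.
  move=> c u v; apply/lfunP => f; rewrite !lfE /Phi1 !(linE (lin1 _)) /Phi0.
  by rewrite scaler_sumr -big_split; apply: eq_bigr => k _ /=; rewrite !lfE.
pose Phi : 'Hom('Hom(T, 'Hom(X, K^o)), 'Hom(V, K^o)) := linfun Phi1.
have PhiE g : Phi g = Phi1 g by rewrite /Phi (linE lin2).
(* the elementary maps [p |-> x . (h p)] span [Hom_H(P1, X)] *)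
have elem_hom (P : fmodule H s) (h' : 'Hom(P, regular H s)) x :
  is_hom h' -> is_hom (orbit_map (x : X) \o h')%VF.
  by move=> hh'; apply: is_hom_comp => //; exact: orbit_hom.
have expand (f : V) : is_hom f -> f = \sum_k (orbit_map (f (e k)) \o h k)%VF.
  move=> hf; apply/lfunP => x; rewrite {1}(he x) linear_sum sum_lfunE /=.
  by apply: eq_bigr => k _; rewrite hf lfE orbitE.
have pair_elem (g : 'Hom(T, dual X)) (h' : 'Hom(P1, regular H s)) x : is_hom g -> is_hom h' ->
    Phi1 g (orbit_map (x : X) \o h')%VF = g (q h') x.
  move=> hg hh'; rewrite Phi1E; last exact: elem_hom.
  have eh' : h' = \sum_k (act (regular H (opp s)) (h' (e k)) \o h k)%VF.
    apply/lfunP => y; rewrite {1}(he y) linear_sum sum_lfunE /=; apply: eq_bigr => k _.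
    rewrite hh' lfE -[LHS]/(regular_act H s _ _) -[RHS]/(regular_act H (opp s) _ _).
    exact: regular_act_opp.
  rewrite [in RHS]eh' !linear_sum sum_lfunE /=; apply: eq_bigr => k _.
  by rewrite qact // hg -[RHS]/(dual_act X _ _ _) dual_actE lfE orbitE.
have hI : hdim P0 X = (hdim M X + \dim I)%N by exact: hom_con hp1 ep0 p10.
have subI : (I <= U)%VS by exact: hom_prec.
(* functionals on [Hom_H(P1, X)] are those on all linear maps that vanish on the
   complement used by [pi] *)
pose C := (I + U^C)%VS.
have dimC : (\dim C + \dim U = \dim I + \dim {: V})%N.
  rewrite dimv_disjoint_sum; first by rewrite -addnA dimv_compl subnK // dimvS // subvf.
  by apply/eqP; rewrite -subv0 -UUC; apply: capvS.
suff -> : hdim T (dual X) = \dim (vsp (fun phi : 'Hom(V, K^o) => forall x, x \in C -> phi x = 0%R)).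
  have num (a c u i v b m' : nat) : (a + c = v -> c + u = i + v -> b = m' + i ->
     a + b = m' + u)%N by lia.
  exact: num (annihilator_dim C) dimC hI.
rewrite /hdim -(limg_dim_eq (f := Phi)); last first.
  apply/eqP; rewrite -subv0; apply/subvP => g; rewrite memv_cap memv_ker => /andP[hg /eqP Pg].
  have {}hg : is_hom (g : 'Hom(T, dual X)) by apply/mem_homsp.
  rewrite memv0; apply/eqP/lfunP => t; apply/lfunP => x.
  have [h' hh' <-] := qsurj t.
  by rewrite -pair_elem // -PhiE Pg !lfE.
congr (\dim _); apply/vspaceP => phi.
set Pr := fun _ => _; have lcP : lin_closed Pr.
  split=> [x _|k u v hu hv x Cx]; first by rewrite lfE.
  by rewrite !lfE hu // hv // scaler0 addr0.
have [m1 m2] := mem_vsp lcP phi.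
apply/memv_imgP/idP => [[g gh ->]|/m1 hphi].
  have hg : is_hom (g : 'Hom(T, dual X)) by apply/mem_homsp.
  have [_ m3] := mem_vsp lcP (Phi g); apply: m3 => f /memv_addP[u Iu [v Vv ->]].
  rewrite linearD /= PhiE; have -> : Phi1 g v = 0.
    rewrite /Phi1 (linE (lin1 g)) /Phi0 big1 // => k _.
    rewrite piC //.
    by rewrite lfE linear0.
  rewrite addr0; case/memv_imgP: Iu => f0 /mem_homsp hf0 ->; rewrite precE.
  have [m0 [e0 [h0 [hh0 he0]]]] := dual_basis pP0.
  have -> : (f0 \o p1)%VF = \sum_k (orbit_map (f0 (e0 k)) \o (h0 k \o p1))%VF.
    apply/lfunP => x; rewrite lfE {1}(he0 (p1 x)) linear_sum sum_lfunE /=.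
    by apply: eq_bigr => k _; rewrite hf0 !lfE orbitE.
  rewrite linear_sum big1 //= => k _; rewrite pair_elem //; last exact: is_hom_comp.
  have -> : q (h0 k \o p1)%VF = 0.
    by apply/qker; [exact: is_hom_comp|exists (h0 k)].
  by rewrite linear0 lfE.
(* conversely [phi] comes from [q h' |-> (x |-> phi (p |-> x . h' p))] *)
pose Psi0 (h' : 'Hom(P1, regular H s)) (x : X) : K^o := phi (orbit_map x \o h')%VF.
have orbD c (x y : X) : orbit_map (c *: x + y) = c *: orbit_map x + orbit_map y.
  by apply/lfunP => a; rewrite !lfE !orbitE linearP.
have lin3 h' : linear (Psi0 h').
  by move=> c x y; rewrite /Psi0 orbD comp_lfunDl -comp_lfunZl linearP.
pose Psi1 h' : 'Hom(X, K^o) := linfun (Psi0 h').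
have Psi1E h' x : Psi1 h' x = phi (orbit_map x \o h')%VF by rewrite /Psi1 (linE (lin3 h')).
have lin4 : linear Psi1.
  move=> c u v; apply/lfunP => x; rewrite !lfE !Psi1E comp_lfunDr -comp_lfunZr.
  by rewrite linearP.
pose Psi : 'Hom('Hom(P1, regular H s), 'Hom(X, K^o)) := linfun Psi1.
have PsiE h' : Psi h' = Psi1 h' by rewrite /Psi (linE lin4).
pose U1 := homsp P1 (regular H s).
have UUC1 : (U1 :&: U1^C)%VS = 0%VS := capv_compl U1.
pose pi1 : 'End('Hom(P1, regular H s)) := daddv_pi U1 U1^C.
have pi1U f : is_hom f -> pi1 f = f.
  by move=> hf; apply: daddv_pi_id => //; exact/mem_homsp.
have pi1_hom f : is_hom (pi1 f) by apply/mem_homsp; exact: memv_pi.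
pose q1 := (q \o pi1)%VF.
have q1K t : q1 ((q1^-1)%VF t) = t.
  apply: limg_lfunVK; apply/mem_limgP; have [h' hh' <-] := qsurj t.
  by exists h'; rewrite /q1 lfE pi1U.
pose g : 'Hom(T, dual X) := (Psi \o (pi1 \o q1^-1))%VF.
have gq h' : is_hom h' -> g (q h') = Psi1 h'.
  move=> hh'; rewrite /g !lfE -PsiE; apply/eqP; rewrite -subr_eq0 -linearB /=.
  set d := _ - h'; have hd : is_hom d by apply: is_homD; [exact: pi1_hom|exact: is_homN].
  have [|h0 hh0 ->] := (qker hd).1.
    by rewrite linearB /=; have := q1K (q h'); rewrite /q1 !lfE => ->; rewrite subrr.
  apply/eqP/lfunP => x; rewrite PsiE Psi1E lfE; apply: hphi.
  apply: (subvP (addvSl _ _)); apply/memv_imgP; exists (orbit_map x \o h0)%VF.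
    by apply/mem_homsp; exact: elem_hom.
  by rewrite precE comp_lfunA.
have reg_hom a (h' : 'Hom(P1, regular H s)) : is_hom h' ->
    is_hom (act (regular H (opp s)) a \o h' : 'Hom(P1, regular H s))%VF.
  move=> hh' b y; rewrite !lfE hh'.
  rewrite -[LHS]/(regular_act H (opp s) _ (regular_act H s _ _)).
  rewrite -[RHS]/(regular_act H s _ (regular_act H (opp s) _ _)).
  exact: regular_act_comm.
have hg : is_hom g.
  move=> a t; have [h' hh' <-] := qsurj t; apply/lfunP => x.
  rewrite -qact // gq; last exact: reg_hom.
  rewrite -[RHS]/(dual_act X _ _ _) dual_actE gq // !Psi1E; congr (phi _).
  apply/lfunP => y; rewrite !lfE !orbitE -[act (regular _ _) _ _]/(regular_act H (opp s) _ _).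
  exact: act_regular_opp.
have [_ mg] := @mem_homsp _ _ _ T (dual X) g; exists g; first exact: mg.
apply/lfunP => f.
have := daddv_pi_add UUC (_ : f \in (U + U^C)%VS).
rewrite addv_complf memvf => /(_ isT) <-; rewrite !linearD /=; congr (_ + _).
  rewrite -/pi PhiE Phi1E // {1}(expand (pi f)) // linear_sum /=.
  by apply: eq_bigr => k _; rewrite gq // Psi1E.
set v := daddv_pi _ _ _; have Uv : v \in (U^C)%VS by exact: memv_pi.
rewrite hphi; last by apply: (subvP (addvSr _ _)).
rewrite PhiE /Phi1 (linE (lin1 g)) /Phi0 big1 // => k _.
have map0 (G : 'Hom(X, K^o)) x : x = 0 -> G x = 0 by move=> ->; rewrite linear0.
by apply: map0; rewrite (piC v Uv) lfE.
Qed.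

End Formula.
End Transpose.

(** * Hereditary algebras: resolutions and the Euler form *)

Section Resolutions.
Variables (K : fieldType) (H : falgType K).
Implicit Types s : side.

Definition hereditary_on s : Prop :=
  forall (P M : fmodule H s) (j : 'Hom(M, P)), projective P -> mono j -> projective M.

Definition resolution s (M P1 P0 : fmodule H s) : Prop :=
  [/\ projective P1, projective P0 &
      exists (j : 'Hom(P1, P0)) (p : 'Hom(P0, M)), ses j p].

Definition coresolution s (X E0 E1 : fmodule H s) : Prop :=
  [/\ injective_module E0, injective_module E1 &
      exists (j : 'Hom(X, E0)) (p : 'Hom(E0, E1)), ses j p].

Lemma resolution_ex s (M : fmodule H s) : hereditary_on s ->
  exists P1 P0, @resolution s M P1 P0.
Proof.
move=> her; have [P0 [p [pP0 ep _]]] := projective_cover M.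
have [P1 [j sj]] := ses_quo ep; exists P1, P0; split=> //; last by exists j, p.
by apply: her pP0 _; case: sj => mj _ _; exact: mj.
Qed.

Lemma ses_dual s (X' X X'' : fmodule H s) (j : 'Hom(X', X)) (p : 'Hom(X, X'')) :
  ses j p -> ses (prec K^o p : 'Hom(dual X'', dual X)) (prec K^o j : 'Hom(dual X, dual X')).
Proof.
move=> [mj ep e]; split; [exact: dmap_mono|exact: dmap_epi|].
apply/vspaceP => phi; rewrite memv_ker precE; apply/idP/eqP.
  move/mem_limgP => [mu ->]; rewrite precE; apply/lfunP => x.
  by rewrite !lfE (ses_comp0 _ e) linear0.
move=> h; apply/mem_limgP; have [hp ep'] := ep.
have pV y : p ((p^-1)%VF y) = y by rewrite limg_lfunVK // ep' memvf.
exists (phi \o p^-1)%VF; rewrite precE; apply/lfunP => x; rewrite !lfE.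
have : x - (p^-1)%VF (p x) \in limg j by rewrite e memv_ker linearB /= pV subrr.
move/mem_limgP => [y /eqP]; rewrite subr_eq => /eqP {1}->.
by have /lfunP/(_ y) := h; rewrite !lfE linearD /= => ->; rewrite add0r.
Qed.

(** Pull a projective cover of [N] back to [M]: the pullback is projective, so maps
    to [Q] lift to [E] and then extend by injectivity of [E]. *)
Lemma injective_quotient s (E Q : fmodule H s) (e : 'Hom(E, Q)) : hereditary_on s ->
  injective_module E -> epi e -> injective_module Q.
Proof.
move=> her iE ee M N j f mj hf; have [hj ij] := mj.
have [P [pi [pP epi_pi _]]] := projective_cover N; have [hpi spi] := epi_pi.
have [X [i [mi limi]]] := sub_ex (submodule_pre hpi (submodule_limg hj)).
have [hi _] := mi; have pX := her _ _ _ pP mi.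
have [|g hg gE] := factor_mono mj (is_hom_comp hi hpi).
  apply/subvP => _ /mem_limgP[x ->]; rewrite lfE memv_preim -limi.
  by apply/mem_limgP; exists x.
have jg x : j (g x) = pi (i x) by have /lfunP/(_ x) := gE; rewrite !lfE.
have [u hu uE] := pX _ _ _ _ ee (is_hom_comp hg hf).
have [v hv vE] := iE _ _ _ _ mi hu.
have [he _] := ee.
have evi x : e (v (i x)) = f (g x).
  by have /lfunP/(_ x) := uE; have /lfunP/(_ x) := vE; rewrite !lfE => <- ->.
have lifti p m : pi p = j m -> exists2 x, p = i x & g x = m.
  move=> pm; have : p \in limg i by rewrite limi -memv_preim pm; apply/mem_limgP; exists m.
  move/mem_limgP => [x px]; exists x => //; move/lker_eq0P: ij; apply.
  by rewrite jg -px.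
have [|w hw wE] := factor_epi epi_pi (is_hom_comp hv he).
  apply/subvP => p; rewrite !memv_ker lfE => /eqP pp.
  have [|x -> gx] := lifti p 0; first by rewrite pp linear0.
  by rewrite evi gx linear0.
exists w => //; apply/lfunP => m; rewrite lfE.
have /limg_fullP/(_ (j m))[p pm] := spi; have [x px gx] := lifti _ _ pm.
by have /lfunP/(_ p) := wE; rewrite !lfE pm => <-; rewrite px evi gx.
Qed.

(** Submodules of left projectives are dual to quotients of right injectives. *)
Lemma hereditary_left : hereditary_on Right -> hereditary_on Left.
Proof.
move=> her P M j pP mj; apply: projective_of_dual.
exact: injective_quotient her (dual_projective pP) (dmap_epi mj).
Qed.

Lemma enough_injectives (M : fmodule H Right) :
  exists (E : fmodule H Right) (j : 'Hom(M, E)), injective_module E /\ mono j.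
Proof.
have [P [p [pP ep _]]] := projective_cover (dual M).
have [f [mf _]] := ddualR M.
exists (dual P), ((prec K^o p : 'Hom(dual (dual M), dual P)) \o f)%VF; split.
  exact: dual_projective.
exact: mono_comp mf (dmap_mono ep).
Qed.

Lemma coresolution_ex (M : fmodule H Right) : hereditary_on Right ->
  exists E0 E1, coresolution M E0 E1.
Proof.
move=> her; have [E0 [j [iE mj]]] := enough_injectives M.
have [E1 [p S]] := ses_sub mj; exists E0, E1; split=> //; last by exists j, p.
by have [_ ep _] := S; exact: injective_quotient her iE ep.
Qed.

(** Both differences equal the alternating sum of the [hdim P_a E_b]. *)
Lemma resolution_hdim s (M P1 P0 X E0 E1 : fmodule H s) :
  resolution M P1 P0 -> coresolution X E0 E1 ->
  (hdim P0 X + hdim M E1 = hdim P1 X + hdim M E0)%N.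
Proof.
move=> [pP1 pP0 [j [p S]]] [iE0 iE1 [j' [p' S']]].
have := projective_hdim pP0 S'; have := projective_hdim pP1 S'.
have := injective_hdim iE0 S; have := injective_hdim iE1 S; lia.
Qed.

(** The dimension of [Hom(M, X)] minus that of [Ext^1(M, X)]. By [resolution_hdim] it
    does not depend on the resolution. *)
Definition euler_form (M X : fmodule H Right) : int :=
  xget 0 [set d | exists P1 P0, resolution M P1 P0 /\
                  d = (hdim P0 X)%:Z - (hdim P1 X)%:Z]%classic.

Hypothesis her : hereditary_on Right.

Lemma euler_formP (M X P1 P0 E0 E1 : fmodule H Right) :
  resolution M P1 P0 -> coresolution X E0 E1 ->
  euler_form M X = (hdim P0 X)%:Z - (hdim P1 X)%:Z /\
  euler_form M X = (hdim M E0)%:Z - (hdim M E1)%:Z.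
Proof.
move=> r c; have e0 := resolution_hdim r c.
have -> : euler_form M X = (hdim M E0)%:Z - (hdim M E1)%:Z; last by split; lia.
rewrite /euler_form; case: xgetP => [_ _ [Q1 [Q0 [r' ->]]]|/(_ ((hdim P0 X)%:Z - (hdim P1 X)%:Z))[]].
  by have := resolution_hdim r' c; lia.
by exists P1, P0.
Qed.

Lemma euler_form_res (M X P1 P0 : fmodule H Right) : resolution M P1 P0 ->
  euler_form M X = (hdim P0 X)%:Z - (hdim P1 X)%:Z.
Proof.
by move=> r; have [E0 [E1 c]] := coresolution_ex X her; have [] := euler_formP r c.
Qed.

Lemma euler_form_cores (M X E0 E1 : fmodule H Right) : coresolution X E0 E1 ->
  euler_form M X = (hdim M E0)%:Z - (hdim M E1)%:Z.
Proof.
by move=> c; have [P1 [P0 r]] := resolution_ex M her; have [] := euler_formP r c.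
Qed.

Lemma euler_form_projective (P X : fmodule H Right) : projective P ->
  euler_form P X = (hdim P X)%:Z.
Proof.
move=> pP; have [E0 [E1 c]] := coresolution_ex X her.
have [_ _ [j [p S]]] := c; have := projective_hdim pP S.
by rewrite (euler_form_cores _ c); lia.
Qed.

Lemma euler_form_injective (M E : fmodule H Right) : injective_module E ->
  euler_form M E = (hdim M E)%:Z.
Proof.
move=> iE; have [P1 [P0 r]] := resolution_ex M her.
have [_ _ [j [p S]]] := r; have := injective_hdim iE S.
by rewrite (euler_form_res _ r); lia.
Qed.

Lemma euler_form_addr (M X' X X'' : fmodule H Right) (j : 'Hom(X', X)) (p : 'Hom(X, X'')) :
  ses j p -> euler_form M X = euler_form M X' + euler_form M X''.
Proof.
move=> S; have [P1 [P0 r]] := resolution_ex M her; rewrite !(euler_form_res _ r).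
have [pP1 pP0 _] := r; have := projective_hdim pP0 S; have := projective_hdim pP1 S; lia.
Qed.

Lemma euler_form_addl (M X' X X'' : fmodule H Right) (j : 'Hom(X', X)) (p : 'Hom(X, X'')) :
  ses j p -> euler_form X M = euler_form X' M + euler_form X'' M.
Proof.
move=> S; have [E0 [E1 r]] := coresolution_ex M her; rewrite !(euler_form_cores _ r).
have [iE0 iE1 _] := r; have := injective_hdim iE0 S; have := injective_hdim iE1 S; lia.
Qed.

(** * Transposes and translates over a hereditary algebra *)

Section Star.
Variables (s : side) (P : fmodule H s).
Let V := 'Hom(P, regular H s).

Definition star_act0 (a : H) : 'End(V) := postc P (act (regular H (opp s)) a).
Fact star_act0E a f x : star_act0 a f x = regular_act H (opp s) a (f x).
Proof. by rewrite /star_act0 postcE lfE. Qed.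
Fact star_act_linear : linear star_act0.
Proof.
move=> k a b; apply/lfunP => f; apply/lfunP => x.
by rewrite !(lfE, star_act0E) linearP !lfE.
Qed.
Definition star_act : 'Hom(H, 'End(V)) := linfun star_act0.
Lemma star_actE a f x : star_act a f x = regular_act H (opp s) a (f x).
Proof. by rewrite /star_act (linE star_act_linear) star_act0E. Qed.
Fact star_act1 f : star_act 1 f = f.
Proof. by apply/lfunP => x; rewrite star_actE regular_act1. Qed.
Fact star_actM a b f : star_act (a * b) f =
  if opp s is Right then star_act b (star_act a f) else star_act a (star_act b f).
Proof.
apply/lfunP => x; rewrite star_actE regular_actM.
have side_if t (u v : V) : (if t is Right then u else v) x =
  if t is Right then u x else v x by case: t.
by rewrite side_if !star_actE.
Qed.
(** All linear maps [P -> H], with [H] acting through its other regular action;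
    [Hom_H(P, H)] is a submodule. *)
Definition linear_star : fmodule H (opp s) := FModule star_act1 star_actM.
End Star.

Lemma is_transpose_ex s (M : fmodule H s) : hereditary_on s ->
  exists T : fmodule H (opp s), is_transpose M T.
Proof.
move=> hers; have [P0 [p0 [pP0 ep0 sup0]]] := projective_cover M.
have [P1 [p1 S]] := ses_quo ep0; have [mp1 _ e1] := S.
have pP1 := hers _ _ _ pP0 mp1; have [hp1 k1] := mp1.
pose L := linear_star P1.
have hom_sub : submodule (homsp P1 (regular H s) : {vspace L}).
  move=> a f /mem_homsp hf; apply/mem_homsp => b x.
  rewrite -[act L a f]/(star_act P1 a f) !star_actE hf.
  exact: (regular_act_comm s a b (f x)).
have [X [j [mj ej]]] := sub_ex hom_sub; have [hj ij] := mj.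
have I_sub : submodule (prec (regular H s) p1 @: homsp P0 (regular H s) : {vspace L})%VS.
  move=> a _ /memv_imgP[f /mem_homsp hf ->].
  apply/memv_imgP; exists (act (linear_star P0) a f).
    apply/mem_homsp => b x.
    rewrite -[act (linear_star P0) a f]/(star_act P0 a f) !star_actE hf.
    exact: (regular_act_comm s a b (f x)).
  apply/lfunP => x; rewrite !precE lfE -[act L a _]/(star_act P1 a _).
  by rewrite -[act (linear_star P0) a f]/(star_act P0 a f) !star_actE lfE.
have [T [p [ep kp]]] := quo_ex (submodule_pre hj I_sub).
have jV f : is_hom (f : 'Hom(P1, regular H s)) -> j ((j^-1)%VF f) = f.
  by move=> hf; apply: limg_lfunVK; rewrite ej; apply/mem_homsp.
have jhom x : is_hom (j x : 'Hom(P1, regular H s)).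
  by apply/mem_homsp; rewrite -ej; apply/mem_limgP; exists x.
have jinj : injective j by apply/lker_eq0P.
have [hp sp] := ep.
exists T, P1, P0, p1, p0, (p \o j^-1)%VF; split.
- by split=> // U hU; rewrite k1 addv0.
- move=> a h hh.
  have -> : (act (regular H (opp s)) a \o h)%VF = act L a h.
    by apply/lfunP => x; rewrite -[act L a h]/(star_act P1 a h) star_actE lfE.
  rewrite !lfE -hp; congr (p _); apply: jinj; rewrite hj !jV //.
  by apply/mem_homsp; apply: hom_sub; apply/mem_homsp.
- move=> t; have /limg_fullP/(_ t)[x <-] := sp; exists (j x) => //.
  by rewrite lfE; congr (p _); apply: jinj; rewrite jV.
move=> h hh; rewrite lfE; split.
  move/eqP; rewrite -memv_ker kp -memv_preim jV // => /memv_imgP[h0 /mem_homsp hh0 ->].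
  by exists h0 => //; rewrite precE.
move=> [h0 hh0 hE]; apply/eqP; rewrite -memv_ker kp -memv_preim jV //.
by apply/memv_imgP; exists h0; [exact/mem_homsp|rewrite precE].
Qed.

(** In a minimal presentation [p1] is injective: its image is projective, so its
    kernel is a direct summand, which minimality excludes. *)
Lemma transposeP s (M : fmodule H s) (T : fmodule H (opp s)) : hereditary_on s ->
  is_transpose M T -> exists P1 P0, @resolution s M P1 P0 /\
  forall X, (hdim T (dual X) + hdim P0 X = hdim M X + hdim P1 X)%N.
Proof.
move=> hers [P1 [P0 [p1 [p0 [q [[[pP1 pP0] [ep0 hp1] e sup0 sup1] c1 c2 c3]]]]]].
exists P1, P0; split; last by move=> X; exact: transpose_hdim pP1 pP0 ep0 hp1 e c1 c2 c3 X.
split=> //; exists p1, p0; split=> //; split=> //.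
have [Y [u [i [eu mi uE iE]]]] := image_ex hp1.
have pY : projective Y by exact: hers pP0 mi.
have [v S] := projective_split pY eu; have [hv hu /lcompP uv] := S.
have full : limg v = fullv.
  apply: sup1; first exact: submodule_limg.
  apply/eqP; rewrite eqEsubv subvf; apply/subvP => x _.
  rewrite -[x](subrK (v (u x))) addrC; apply: memv_add.
    by apply/mem_limgP; exists (u x).
  by rewrite memv_ker uE lfE linearB /= uv lfE subrr linear0.
have mu : mono u.
  split=> //; apply/lker_eq0P => x y.
  have /limg_fullP sv := full; have [x' <-] := sv x; have [y' <-] := sv y.
  by rewrite !uv !lfE => ->.
by rewrite uE; have [] := mono_comp mu mi.
Qed.

(** Auslander-Reiten formula: [Hom(X, tau M)] has the dimension of [Ext^1(M, X)]. *)
Lemma is_tau_hdim (M T : fmodule H Right) : is_tau M T ->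
  forall X, (hdim X T)%:Z = (hdim M X)%:Z - euler_form M X.
Proof.
move=> [T' tr i] X; have [P1 [P0 [r e]]] := transposeP her tr.
rewrite (euler_form_res X r) (hom_iso i).2 hdim_flip.
have num (a b c d : nat) : (a + b = c + d)%N -> a%:Z = c%:Z - (b%:Z - d%:Z) by lia.
exact: num (e X).
Qed.

Lemma is_tau_ex (M : fmodule H Right) : exists T, is_tau M T.
Proof.
have [T tr] := is_transpose_ex M her; exists (dual T); exists T => //.
exact: iso_refl.
Qed.

(** Auslander-Reiten formula for the inverse translate, from the transpose of the left
    module [D B]. *)
Lemma is_tauV_hdim (B N : fmodule H Right) : is_tauV B N ->
  forall X, (hdim N X)%:Z = (hdim X B)%:Z - euler_form X B.
Proof.
move=> tr X; have [Q1 [Q0 [r e]]] := transposeP (hereditary_left her) tr.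
have [pQ1 pQ0 [j [p S]]] := r.
have c : coresolution B (dual Q0) (dual Q1).
  split; try exact: dual_projective.
  have [mp ep ejp] := ses_dual S; have [f [mf ef]] := ddualR B.
  exists ((prec K^o p : 'Hom(dual (dual B), dual Q0)) \o f)%VF, (prec K^o j).
  split=> //; first exact: mono_comp.
  by rewrite limg_comp; case: ef => _ ->; rewrite ejp.
rewrite (euler_form_cores X c).
have := e (dual X).
have -> : hdim N (dual (dual X)) = hdim N X by rewrite -(hom_iso (ddualR X)).2.
rewrite hdim_dual -!(hdim_flip X); lia.
Qed.

Lemma is_tauV_ex (B : fmodule H Right) : exists N, is_tauV B N.
Proof. exact: (is_transpose_ex (dual B) (hereditary_left her)). Qed.

End Resolutions.

Section Structure.
Variables (K : fieldType) (H : falgType K).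
Implicit Types s : side.

(** * Existence of direct sums *)

Section BinarySum.
Variables (s : side) (M N : fmodule H s).
Let V : vectType K := (M * N)%type.

Definition sum_act0 (a : H) (x : V) : V := (act M a x.1, act N a x.2).
Fact sum_act0_linear a : linear (sum_act0 a).
Proof. by move=> k x y; rewrite /sum_act0 !linearP. Qed.
Fact sum_act_linear : linear (fun a => linfun (sum_act0 a)).
Proof.
move=> k a b; apply/lfunP => x; rewrite !lfE !(linE (sum_act0_linear _)).
by rewrite /sum_act0 !linearP !lfE.
Qed.
Definition sum_act : 'Hom(H, 'End(V)) := linfun (fun a => linfun (sum_act0 a)).
Lemma sum_actE a (x : V) : sum_act a x = (act M a x.1, act N a x.2).
Proof. by rewrite (linE sum_act_linear) (linE (sum_act0_linear _)). Qed.
Fact sum_act1 x : sum_act 1 x = x.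
Proof. by rewrite sum_actE !act1; case: x. Qed.
Fact sum_actM a b x : sum_act (a * b) x =
  if s is Right then sum_act b (sum_act a x) else sum_act a (sum_act b x).
Proof.
have side_if (t : side) (u v : V) (u1 v1 : M) (u2 v2 : N) : u = (u1, u2) -> v = (v1, v2) ->
    (if t is Right then u else v) =
    (if t is Right then u1 else v1, if t is Right then u2 else v2).
  by case: t => e1 e2; rewrite ?e1 ?e2.
by rewrite sum_actE !actM; apply/esym/side_if; rewrite !sum_actE.
Qed.
Definition sum_module : fmodule H s := FModule sum_act1 sum_actM.

Lemma sum_ex : exists X, sum_of M N X.
Proof.
have l1 : linear (fun x : M => (x, 0) : V) by move=> k x y; apply: injective_projections; rewrite /= ?scaler0 ?addr0.
have l2 : linear (fun x : N => (0, x) : V) by move=> k x y; apply: injective_projections; rewrite /= ?scaler0 ?addr0.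
have l3 : linear (fun x : V => x.1) by [].
have l4 : linear (fun x : V => x.2) by [].
exists sum_module, (linfun (fun x : M => (x, 0) : V)), (linfun (fun x : V => x.1)),
  (linfun (fun x : N => (0, x) : V)), (linfun (fun x : V => x.2)).
split.
- split=> a x; rewrite ?(linE l1) ?(linE l3).
    by rewrite -[RHS]/(sum_act a _) sum_actE /= linear0.
  by rewrite -[act sum_module a x]/(sum_act a _) sum_actE.
- split=> a x; rewrite ?(linE l2) ?(linE l4).
    by rewrite -[RHS]/(sum_act a _) sum_actE /= linear0.
  by rewrite -[act sum_module a x]/(sum_act a _) sum_actE.
- by split=> x; rewrite ?(linE l1) ?(linE l2) ?(linE l3) ?(linE l4).
move=> x; rewrite ?(linE l1) ?(linE l2) ?(linE l3) ?(linE l4).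
by case: x => x y; congr (_, _); rewrite ?addr0 ?add0r.
Qed.
End BinarySum.

(** The version of [hdim_iso] in the second argument, by duality. *)
Lemma hdim_iso_r (M N : fmodule H Right) : (forall X, hdim X M = hdim X N) -> iso M N.
Proof.
move=> e; have half (Z : fmodule H Right) (Y : fmodule H Left) : hdim (dual Z) Y = hdim (dual Y) Z.
  by rewrite (hom_iso (ddualL Y)).2; exact: hdim_dual.
have i : iso (dual M) (dual N) by apply: hdim_iso => Y; rewrite !half.
exact: iso_trans (ddualR M) (iso_trans (iso_sym (dual_iso i)) (iso_sym (ddualR N))).
Qed.

Hypothesis her : hereditary_on H Right.

(** * The lemma of Happel and Ringel *)

(** Let [Y] be the image of [f] and [P] a projective module mapping onto [A]. As [H] is
    hereditary, the preimage [Q] of [Y] in [P] is projective, so [Q -> Y] lifts along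
    [A -> Y]. Pushing [Q -> P] out along this lift gives an extension [E] of [A/Y] by
    [A] that maps to the extension [A] of [A/Y] by [Y], and an exact sequence
    [0 -> A -> E + Y -> A -> 0]. It splits, so [Y] is a summand of [A + A]; then an
    indecomposable summand of [Y] is isomorphic to [A], and the epi [A -> Y] is
    injective for reasons of dimension. *)
Lemma indec_endo_mono (A : fmodule H Right) (f : 'Hom(A, A)) :
  indecomposable A ->
  (forall (M : fmodule H Right) (j : 'Hom(A, M)) (p : 'Hom(M, A)), ses j p ->
     exists i, split_by i p) ->
  is_hom f -> f <> 0 -> mono f.
Proof.
move=> iA split_ses hf f0.
have [Y [e [i [ee mi fE _]]]] := image_ex hf.
have [P [pi [pP epi_pi _]]] := projective_cover A.
have [hpi spi] := epi_pi; have [hi /lker_eq0P ii] := mi; have [he se] := ee.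
have [Q [k [mk limk]]] := sub_ex (submodule_pre hpi (submodule_limg hi)).
have [hk /lker_eq0P ik] := mk.
have [|g hg gE] := factor_mono mi (is_hom_comp hk hpi).
  apply/subvP => _ /mem_limgP[x ->]; rewrite lfE memv_preim -limk.
  by apply/mem_limgP; exists x.
have ig x : i (g x) = pi (k x) by have /lfunP/(_ x) := gE; rewrite !lfE.
have fe x : f x = i (e x) by rewrite fE lfE.
have pQ : projective Q := her pP mk.
have [s hs sE] := pQ _ _ _ _ ee hg.
have es x : e (s x) = g x by have /lfunP/(_ x) := sE; rewrite !lfE.
have [X [jP [pP' [jA [pA bX]]]]] := sum_ex P A.
have [x1 x2] := biprod_cross bX; case: bX => [[hjP hpP] [hjA hpA] [y1 y2] y].
(* [E] is the pushout of [k] and [s], with induced map [phi] to [A] *)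
pose d : 'Hom(Q, X) := (jP \o k)%VF - (jA \o s)%VF.
have dE x : d x = jP (k x) - jA (s x) by rewrite /d !lfE.
have hd : is_hom d.
  by apply: is_homD; [exact: is_hom_comp|apply: is_homN; exact: is_hom_comp].
have [E [u [eu ku]]] := quo_ex (submodule_limg hd); have [hu su] := eu.
pose v : 'Hom(X, A) := (pi \o pP')%VF + (f \o pA)%VF.
have vE x : v x = pi (pP' x) + f (pA x) by rewrite /v !lfE.
have hv : is_hom v by apply: is_homD; exact: is_hom_comp.
have [|phi hphi phiE] := factor_epi eu hv.
  rewrite ku; apply/subvP => _ /mem_limgP[x ->]; rewrite memv_ker vE dE !linearB /=.
  by rewrite y1 y2 x1 x2 !linear0 addr0 sub0r fe es ig subrr.
have pu x : phi (u x) = v x by have /lfunP/(_ x) := phiE; rewrite !lfE.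
have [M [jE [pE [jY [pY bM]]]]] := sum_ex E Y.
have [z1 z2] := biprod_cross bM; case: bM => [[hjE hpE] [hjY hpY] [w1 w2] w].
pose J : 'Hom(A, M) := (jE \o (u \o jA))%VF - (jY \o e)%VF.
have JE a : J a = jE (u (jA a)) - jY (e a) by rewrite /J !lfE.
pose Pp : 'Hom(M, A) := (phi \o pE)%VF + (i \o pY)%VF.
have PpE m : Pp m = phi (pE m) + i (pY m) by rewrite /Pp !lfE.
have S : ses J Pp.
  split.
  - split; first by apply: is_homD; [|apply: is_homN]; do ?exact: is_hom_comp;
      apply: is_hom_comp => //; exact: is_hom_comp.
    apply/lker_eq0P => a b /eqP; rewrite -subr_eq0 -linearB /= => /eqP Jab.
    apply/eqP; rewrite -subr_eq0; apply/eqP; move: (a - b) Jab => c Jc.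
    have : u (jA c) = 0.
      by have := congr1 pE Jc; rewrite JE linearB /= w1 z2 subr0 linear0.
    move/eqP; rewrite -memv_ker ku => /mem_limgP[x]; rewrite dE => jc.
    have kx : k x = 0.
      by have := congr1 pP' jc; rewrite linearB /= y1 !x2 subr0.
    have x0 : x = 0 by apply: ik; rewrite kx linear0.
    by have := congr1 pA jc; rewrite y2 x0 !linear0 addr0 linear0.
  - split; first by apply: is_homD; exact: is_hom_comp.
    apply/limg_fullP => a; have /limg_fullP/(_ a)[p <-] := spi.
    exists (jE (u (jP p))); rewrite PpE w1 z1 pu vE y1 x1 !linear0 !addr0 //.
  apply/vspaceP => m; rewrite memv_ker; apply/idP/eqP.
    move/mem_limgP => [a ->]; rewrite PpE JE !linearB /= w1 w2 z1 z2 !linear0 addr0 sub0r.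
    by rewrite pu vE y2 x2 linear0 add0r fe subrr.
  move=> Pm; apply/mem_limgP.
  have /limg_fullP/(_ (pE m))[x ux] := su.
  have : pi (pP' x) = i (- pY m - e (pA x)).
    have := Pm; rewrite PpE -ux pu vE => /eqP.
    rewrite linearB linearN /= -fe addrAC addr_eq0 => /eqP h.
    by rewrite -[LHS](addrK (i (pY m))) h addrC.
  move=> pix; have : pP' x \in limg k.
    by rewrite limk -memv_preim pix; apply/mem_limgP; exists (- pY m - e (pA x)).
  move/mem_limgP => [q kq].
  have gq : g q = - pY m - e (pA x) by apply: ii; rewrite ig -kq pix.
  exists (s q + pA x); rewrite JE [e _]linearD /= es gq subrK.
  rewrite linearN opprK [LHS]w; congr (jE _ + _); rewrite -ux.
  have -> : jA (s q + pA x) = x - d q.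
    by rewrite dE -kq linearD /= opprB [X in _ = X + _]y [RHS]addrC -addrA addKr.
  rewrite linearB /=; have -> : u (d q) = 0; last by rewrite subr0.
  by apply/eqP; rewrite -memv_ker ku; apply/mem_limgP; exists q.
have [sg Ssg] := split_ses _ _ _ S; have [r bM'] := split_section S Ssg.
have [[hJ hr] [hsg hPp] _ idM] := bM'.
have Y0 : ~ zero_module Y.
  move=> /zero_moduleP Y0; apply: f0; apply/lfunP => x.
  by rewrite fe (Y0 (e x)) linear0 lfE.
have [Y1 iY1 [i1 [r1 [hi1 hr1 /lcompP ri]]]] := indec_summand_ex Y0.
(* the identity of [Y] is [pY \o (J \o r + sg \o Pp) \o jY], which factors through
   [A + A]; restrict it to an indecomposable summand of [Y] *)
pose ik_ (b : 'I_2) : 'Hom(Y1, A) :=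
  if b == ord0 then (r \o (jY \o i1))%VF else (i \o i1)%VF.
pose rk_ (b : 'I_2) : 'Hom(A, Y1) :=
  if b == ord0 then (r1 \o (- e))%VF else (r1 \o (pY \o sg))%VF.
have [b|b||b mb] := @indec_summand_sum _ _ _ Y1 A 2 ik_ rk_ iY1.
- by rewrite /ik_; case: ifP => _; do ?exact: is_hom_comp;
    apply: is_hom_comp => //; exact: is_hom_comp.
- rewrite /rk_; case: ifP => _; first by apply: is_hom_comp => //; exact: is_homN.
  by apply: is_hom_comp => //; exact: is_hom_comp.
- rewrite !big_ord_recl big_ord0 addr0 /ik_ /rk_ /=; apply/lfunP => t.
  rewrite !lfE -linearD /=.
  have -> : - e (r (jY (i1 t))) + pY (sg (i (i1 t))) = i1 t.
    have := congr1 pY (idM (jY (i1 t))).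
    by rewrite w2 linearD /= JE linearB /= z1 sub0r w2 PpE z2 w2 linear0 add0r => <-.
  by rewrite ri lfE.
have hik b' : is_hom (ik_ b').
  by rewrite /ik_; case: ifP => _; do ?exact: is_hom_comp;
    apply: is_hom_comp => //; exact: is_hom_comp.
have hrk b' : is_hom (rk_ b').
  rewrite /rk_; case: ifP => _; first by apply: is_hom_comp => //; exact: is_homN.
  by apply: is_hom_comp => //; exact: is_hom_comp.
have [g' [mg' eg']] : iso Y1 A.
  apply: summand_indec => //; first by case: iY1.
  exact: mono_summand mb.
have me : mono e.
  apply: epi_mono => //; apply: leq_trans (_ : \dim {: Y1} <= _)%N.
    by rewrite (mono_dim mg'); case: eg' => _ ->.
  have [mi1 _] : mono i1 /\ epi r1 by apply: split_mono; split=> //; apply/lcompP.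
  by rewrite (mono_dim mi1) dimvS ?subvf.
by rewrite fE; exact: mono_comp me mi.
Qed.

End Structure.

(** * Indecomposable balanced pairs *)

Section Balanced.
Variables (K : fieldType) (H : falgType K).
Hypothesis her : hereditary_on H Right.
Implicit Types A B M N P I X : fmodule H Right.

(** As [hdim] minus [euler_form] is the dimension of [Ext^1], these are the
    Auslander-Reiten formulas for [B = tau A] and [A = tau^-1 B]. They force
    [Hom(A, Q) = 0] for [Q] projective and [Hom(E, B) = 0] for [E] injective. *)
Definition translate_pair A B : Prop :=
  (forall X, (hdim X B)%:Z = (hdim A X)%:Z - euler_form A X) /\
  (forall X, (hdim A X)%:Z = (hdim X B)%:Z - euler_form X B).

Lemma sum_of_euler A B M : sum_of A B M -> forall X,
  euler_form M X = euler_form A X + euler_form B X /\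
  euler_form X M = euler_form X A + euler_form X B.
Proof.
move=> [j1 [p1 [j2 [p2 /biprod_ses S]]]] X.
by split; [exact: euler_form_addl S|exact: euler_form_addr S].
Qed.

(** A nonzero map to a projective module has projective image, which splits off. *)
Lemma stable_summand A : exists A0 P,
  [/\ projective P, sum_of A0 P A & forall Q, projective Q -> hdim A0 Q = 0%N].
Proof.
have [k] := ubnP (\dim {: A}); elim: k A => // k IH A leA.
have [[Q [pQ nz]]|none] := pselect (exists Q, projective Q /\ hdim A Q <> 0%N); last first.
  have [Z Z0] := zero_ex H Right; exists A, Z; split; first exact: projective_zero.
    exact: sum_of_0.
  by move=> Q pQ; apply: contrapT => nz; apply: none; exists Q.
have [f hf f0] := hom_neq0 nz; have [Y [e [i [ee mi fE _]]]] := image_ex hf.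
have pY : projective Y := her pQ mi.
have [X [j sj]] := ses_quo ee; have [u su] := projective_split pY ee.
have [r b] := split_section sj su.
have SA : sum_of X Y A by exists j, r, u, e.
have [|A0 [P [pP S st]]] := IH X.
  have Y0 : \dim {: Y} <> 0%N.
    move=> /zero_moduleP Y0; apply: f0; apply/lfunP => x.
    by rewrite fE lfE (Y0 (e x)) linear0 lfE.
  by move: leA; rewrite (ses_dim sj); lia.
have [R SR SA'] := sum_of_assoc S SA; exists A0, R; split=> //.
exact: projective_sum SR pP pY.
Qed.

Lemma costable_summand B : exists B0 I,
  [/\ injective_module I, sum_of B0 I B & forall E, injective_module E -> hdim E B0 = 0%N].
Proof.
have [k] := ubnP (\dim {: B}); elim: k B => // k IH B leB.
have [[Q [pQ nz]]|none] := pselect (exists Q, injective_module Q /\ hdim Q B <> 0%N); last first.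
  have [Z Z0] := zero_ex H Right; exists B, Z; split; first exact: injective_zero.
    exact: sum_of_0.
  by move=> Q pQ; apply: contrapT => nz; apply: none; exists Q.
have [f hf f0] := hom_neq0 nz; have [Y [e [i [ee mi fE _]]]] := image_ex hf.
have pY : injective_module Y := injective_quotient her pQ ee.
have [X [p sp]] := ses_sub mi; have [r sr] := injective_split pY mi.
have [v b] := split_retraction sp sr.
have SB : sum_of X Y B by apply: sum_of_sym; exists i, r, v, p.
have [|B0 [I [iI S st]]] := IH X.
  have Y0 : \dim {: Y} <> 0%N.
    move=> /zero_moduleP Y0; apply: f0; apply/lfunP => x.
    by rewrite fE lfE (Y0 (e x)) linear0 lfE.
  by move: leB; rewrite (ses_dim sp); lia.
have [R SR SB'] := sum_of_assoc S SB; exists B0, R; split=> //.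
exact: injective_sum SR iI pY.
Qed.

(** The Euler forms of [(X, B)] and [(A, X)] are opposite. By additivity it suffices
    to check this for projective [X], where [Hom(A, X) = 0]. *)
Lemma translate_of_stable A B : (forall Q, projective Q -> hdim A Q = 0%N) ->
  (forall X, (hdim X B)%:Z = (hdim A X)%:Z - euler_form A X) -> translate_pair A B.
Proof.
move=> st e; split=> // X.
have [P1 [P0 r]] := resolution_ex X her; have [pP1 pP0 [j [p S]]] := r.
have := euler_form_res her B r; have := euler_form_addr her A S.
have := e P0; have := e P1; have := e X; rewrite (st P0) // (st P1) //; lia.
Qed.

Lemma translate_of_costable A B : (forall E, injective_module E -> hdim E B = 0%N) ->
  (forall X, (hdim A X)%:Z = (hdim X B)%:Z - euler_form X B) -> translate_pair A B.
Proof.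
move=> st e; split=> // X.
have [E0 [E1 r]] := coresolution_ex X her; have [iE0 iE1 [j [p S]]] := r.
have := euler_form_cores her A r; have := euler_form_addl her B S.
have := e E0; have := e E1; have := e X; rewrite (st E0) // (st E1) //; lia.
Qed.

Lemma balanced_of_translate A B A0 B0 P I : translate_pair A0 B0 ->
  projective P -> injective_module I -> sum_of A0 P A -> sum_of B0 I B ->
  hdim A B = 0%N -> balanced (A, B).
Proof.
move=> [e1 e2] pP iI SA SB hAB; split; first exact/hom_zeroP.
- have [T tT] := is_tau_ex her A.
  have i : iso B0 T.
    apply: hdim_iso_r => X; have := is_tau_hdim her tT X; have := e1 X.
    rewrite (sum_of_hom SA).1; have := (sum_of_euler SA X).1.
    by rewrite (euler_form_projective her X pP); lia.
  exists T, I; split=> //; apply/dsum_boolP; exact: sum_of_iso1 SB i.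
have [N tN] := is_tauV_ex her B.
have i : iso A0 N.
  apply: hdim_iso => X; have := is_tauV_hdim her tN X; have := e2 X.
  rewrite (sum_of_hom SB).2; have := (sum_of_euler SB X).2.
  by rewrite (euler_form_injective her X iI); lia.
exists N, P; split=> //; apply/dsum_boolP; exact: sum_of_iso1 SA i.
Qed.

(** A projective summand of [A] contributes nothing to [Ext^1], so that [B] is also the
    translate of the stable part of [A]. *)
Lemma balanced_translate A B I B' : (forall X, (hdim X B)%:Z = (hdim A X)%:Z - euler_form A X) ->
  injective_module I -> sum_of B I B' -> hdim A B' = 0%N -> balanced (A, B').
Proof.
move=> e iI S h; have [A0 [P [pP SA st]]] := stable_summand A.
suff tr : translate_pair A0 B by exact: balanced_of_translate tr pP iI SA S h.
apply: translate_of_stable => // X; rewrite e (sum_of_hom SA).1 (sum_of_euler SA X).1.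
by rewrite (euler_form_projective her X pP); lia.
Qed.

Lemma balanced_translateV A B P A' : (forall X, (hdim A X)%:Z = (hdim X B)%:Z - euler_form X B) ->
  projective P -> sum_of A P A' -> hdim A' B = 0%N -> balanced (A', B).
Proof.
move=> e pP S h; have [B0 [I [iI SB st]]] := costable_summand B.
suff tr : translate_pair A B0 by exact: balanced_of_translate tr pP iI S SB h.
apply: translate_of_costable => // X; rewrite e (sum_of_hom SB).2 (sum_of_euler SB X).2.
by rewrite (euler_form_injective her X iI); lia.
Qed.

Lemma pair_dsum_sum_of (p1 p2 : mpair H) A B : sum_of p1.1 p2.1 A -> sum_of p1.2 p2.2 B ->
  pair_dsum (fun b : bool => if b then p1 else p2) (A, B).
Proof. by move=> S1 S2; split; apply/dsum_boolP. Qed.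

(** A decomposition of [A] induces one of [(A, B)] into balanced pairs, the injective
    summand of [B] going to the second part. *)
Lemma balanced_split A B A1 A2 : balanced (A, B) -> sum_of A1 A2 A ->
  exists B1 B2, [/\ balanced (A1, B1), balanced (A2, B2), sum_of B1 B2 B &
    forall X, (hdim X B1)%:Z = (hdim A1 X)%:Z - euler_form A1 X].
Proof.
move=> [/= /hom_zeroP hAB [T [I [tT iI /dsum_boolP /= ST]]] _] SA.
have [T1 t1] := is_tau_ex her A1; have [T2 t2] := is_tau_ex her A2.
have e1 := is_tau_hdim her t1; have e2 := is_tau_hdim her t2.
have [Z SZ] := sum_ex T1 T2.
have i : iso Z T.
  apply: hdim_iso_r => X; have := is_tau_hdim her tT X.
  rewrite (sum_of_hom SZ).2 (sum_of_hom SA).1 (sum_of_euler SA X).1.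
  by have := e1 X; have := e2 X; lia.
have [B2 S2 SB] := sum_of_assoc (sum_of_iso SZ i) ST.
exists T1, B2.
move: hAB; rewrite (sum_of_hom SA).1 !(sum_of_hom SB).2 => h.
split=> //; last by apply: balanced_translate e2 iI S2 _; lia.
have [Z0 z0] := zero_ex H Right.
apply: balanced_translate e1 (injective_zero z0) (sum_of_0 _ z0) _; lia.
Qed.

Lemma balanced_splitV A B B1 B2 : balanced (A, B) -> sum_of B1 B2 B ->
  exists A1 A2, [/\ balanced (A1, B1), balanced (A2, B2), sum_of A1 A2 A &
    forall X, (hdim A1 X)%:Z = (hdim X B1)%:Z - euler_form X B1].
Proof.
move=> [/= /hom_zeroP hAB _ [T [P [tT pP /dsum_boolP /= ST]]]] SB.
have [T1 t1] := is_tauV_ex her B1; have [T2 t2] := is_tauV_ex her B2.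
have e1 := is_tauV_hdim her t1; have e2 := is_tauV_hdim her t2.
have [Z SZ] := sum_ex T1 T2.
have i : iso Z T.
  apply: hdim_iso => X; have := is_tauV_hdim her tT X.
  rewrite (sum_of_hom SZ).1 (sum_of_hom SB).2 (sum_of_euler SB X).2.
  by have := e1 X; have := e2 X; lia.
have [A2 S2 SA] := sum_of_assoc (sum_of_iso SZ i) ST.
exists T1, A2.
move: hAB; rewrite (sum_of_hom SB).2 !(sum_of_hom SA).1 => h.
split=> //; last by apply: balanced_translateV e2 pP S2 _; lia.
have [Z0 z0] := zero_ex H Right.
apply: balanced_translateV e1 (projective_zero z0) (sum_of_0 _ z0) _; lia.
Qed.

(** For the formula, split off the zero module from [A]: the injective summand of [B]
    then forms a balanced pair with it, and so vanishes. *)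
Lemma indec_balanced_top A B : indec_balanced (A, B) -> ~ zero_module A ->
  indecomposable A /\ forall X, (hdim X B)%:Z = (hdim A X)%:Z - euler_form A X.
Proof.
move=> [bal _ ind] A0; split.
  split=> // A1 A2 SA; have [B1 [B2 [b1 b2 SB _]]] := balanced_split bal SA.
  have [[z _]|[z _]] := ind _ _ b1 b2 (pair_dsum_sum_of (p1 := (A1, B1)) (p2 := (A2, B2)) SA SB).
    by left.
  by right.
have [Z z] := zero_ex H Right; have SA := sum_of_0 A z.
have [B1 [B2 [b1 b2 SB e]]] := balanced_split bal SA.
have [[//]|[_ /= z2]] := ind _ _ b1 b2 (pair_dsum_sum_of (p1 := (A, B1)) (p2 := (Z, B2)) SA SB).
by move=> X; rewrite -e (hom_iso (sum_of_zero SB z2)).2.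
Qed.

Lemma indec_balanced_bottom A B : indec_balanced (A, B) -> ~ zero_module B ->
  indecomposable B /\ forall X, (hdim A X)%:Z = (hdim X B)%:Z - euler_form X B.
Proof.
move=> [bal _ ind] B0; split.
  split=> // B1 B2 SB; have [A1 [A2 [b1 b2 SA _]]] := balanced_splitV bal SB.
  have [[_ z]|[_ z]] := ind _ _ b1 b2 (pair_dsum_sum_of (p1 := (A1, B1)) (p2 := (A2, B2)) SA SB).
    by left.
  by right.
have [Z z] := zero_ex H Right; have SB := sum_of_0 B z.
have [A1 [A2 [b1 b2 SA e]]] := balanced_splitV bal SB.
have [[//]|[/= z2 _]] := ind _ _ b1 b2 (pair_dsum_sum_of (p1 := (A1, B)) (p2 := (A2, Z)) SA SB).
by move=> X; rewrite -e (hom_iso (sum_of_zero SA z2)).1.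
Qed.

Lemma euler_form_iso A A' X : iso A A' ->
  euler_form A X = euler_form A' X /\ euler_form X A = euler_form X A'.
Proof.
move=> i; have [Z z] := zero_ex H Right.
have S := sum_of_iso (sum_of_0 A z) i.
have [-> ->] := sum_of_euler S X.
rewrite (euler_form_projective her X (projective_zero z)) hom_from0 //.
by rewrite (euler_form_injective her X (injective_zero z)) hom_to0 // !addr0.
Qed.

Lemma indec_balanced_iso_top (p q : mpair H) : indec_balanced p -> indec_balanced q ->
  ~ zero_module p.1 -> iso p.1 q.1 -> pair_iso p q.
Proof.
case: p q => A B [A' B'] /= ip iq A0 i; split=> //.
have [_ e] := indec_balanced_top ip A0.
have [_ e'] := indec_balanced_top iq (fun z => A0 (zero_iso (iso_sym i) z)).
apply: hdim_iso_r => X /=; have := e X; have := e' X.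
by rewrite (hom_iso i).1 (euler_form_iso X i).1; lia.
Qed.

Lemma indec_balanced_iso_bottom (p q : mpair H) : indec_balanced p -> indec_balanced q ->
  ~ zero_module p.2 -> iso p.2 q.2 -> pair_iso p q.
Proof.
case: p q => A B [A' B'] /= ip iq B0 i; split=> //.
have [_ e] := indec_balanced_bottom ip B0.
have [_ e'] := indec_balanced_bottom iq (fun z => B0 (zero_iso (iso_sym i) z)).
apply: hdim_iso => X /=; have := e X; have := e' X.
by rewrite (hom_iso i).2 (euler_form_iso X i).2; lia.
Qed.

End Balanced.

(** * Semisimple modules *)

Section Semisimple.
Variables (K : fieldType) (H : falgType K).
Implicit Types s : side.

Lemma simple_mono s (M N : fmodule H s) (f : 'Hom(M, N)) :
  simple M -> is_hom f -> f <> 0 -> mono f.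
Proof.
move=> [_ sM] hf f0; split=> //; have [//|kf] := sM _ (submodule_ker hf).
case: f0; apply/lfunP => x; rewrite lfE; apply/eqP.
by rewrite -memv_ker kf memvf.
Qed.

Lemma simple_epi s (M N : fmodule H s) (f : 'Hom(M, N)) :
  simple N -> is_hom f -> f <> 0 -> epi f.
Proof.
move=> [_ sN] hf f0; split=> //; have [l0|//] := sN _ (submodule_limg hf).
case: f0; apply/lfunP => x; rewrite lfE; apply/eqP.
by rewrite -memv0 -l0; apply/mem_limgP; exists x.
Qed.

Definition maximal_sub s (M : fmodule H s) (U : {vspace M}) : Prop :=
  [/\ submodule U, U <> fullv & forall V : {vspace M}, submodule V -> (U <= V)%VS ->
     V = U \/ V = fullv].

Lemma maximal_sub_ex s (M : fmodule H s) : ~ zero_module M ->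
  exists U : {vspace M}, maximal_sub U.
Proof.
move=> M0; have [|U [hU Uf] Umax] := @max_vspace K M
  (fun U => submodule U /\ U <> fullv) 0%VS.
  split; first exact: submodule0.
  by move=> e; apply: M0; rewrite /zero_module -e dimv0.
exists U; split=> // V hV UV; have [->|Vf] := pselect (V = fullv); first by right.
by left; apply/esym/eqP; rewrite eqEdim UV Umax.
Qed.

Lemma maximal_quotient s (M X : fmodule H s) (p : 'Hom(M, X)) :
  epi p -> maximal_sub (lker p) -> simple X.
Proof.
move=> [hp sp] [hU Uf Umax]; split.
  move=> /zero_moduleP X0; apply: Uf; apply/vspaceP => x.
  by rewrite memv_ker memvf (X0 (p x)) eqxx.
move=> V hV; have [||e|e] := Umax (p @^-1: V)%VS; first exact: submodule_pre.
- by apply/subvP => x; rewrite memv_ker -memv_preim => /eqP->; rewrite mem0v.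
- left; apply/eqP; rewrite -subv0; apply/subvP => y Vy.
  have /limg_fullP/(_ y)[x xy] := sp; rewrite memv0 -xy -memv_ker -e -memv_preim xy //.
right; apply/eqP; rewrite eqEsubv subvf; apply/subvP => y _.
by have /limg_fullP/(_ y)[x <-] := sp; rewrite memv_preim e memvf.
Qed.

Lemma simple_maximal s (M X : fmodule H s) (p : 'Hom(M, X)) :
  epi p -> simple X -> maximal_sub (lker p).
Proof.
move=> [hp sp] [X0 sX]; split; first exact: submodule_ker.
  move=> e; apply: X0; apply/zero_moduleP => y; have /limg_fullP/(_ y)[x <-] := sp.
  by apply/eqP; rewrite -memv_ker e memvf.
move=> V hV sub; have [e|e] := sX _ (submodule_img hp hV).
  left; apply/eqP; rewrite eqEsubv sub andbT; apply/subvP => x Vx.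
  by rewrite memv_ker -memv0 -e memv_img.
right; apply/eqP; rewrite eqEsubv subvf; apply/subvP => x _.
have : p x \in (p @: V)%VS by rewrite e memvf.
move/memv_imgP => [v Vv pxv]; rewrite -[x](subrK v); apply: memvD => //.
by apply: (subvP sub); rewrite memv_ker linearB /= pxv subrr.
Qed.

Lemma hdim_factor_epi s (M X Y : fmodule H s) (p : 'Hom(M, X)) : epi p ->
  (forall f : 'Hom(M, Y), is_hom f -> (lker p <= lker f)%VS) -> hdim M Y = hdim X Y.
Proof.
move=> ep h; have [Z [j [mj e' e]]] := ses_quo ep; have [hj _] := mj.
rewrite (hom_con Y hj ep e) -[RHS]addn0; congr (_ + _)%N; apply/eqP.
rewrite dimv_eq0 -subv0; apply/subvP => _ /memv_imgP[f /mem_homsp hf ->].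
rewrite memv0 precE; apply/eqP/lfunP => x; rewrite !lfE; apply/eqP.
rewrite -memv_ker; apply: (subvP (h f hf)); rewrite -e.
by apply/mem_limgP; exists x.
Qed.

Lemma hdim_factor_mono s (M X Y : fmodule H s) (j : 'Hom(X, M)) : mono j ->
  (forall f : 'Hom(Y, M), is_hom f -> (limg f <= limg j)%VS) -> hdim Y M = hdim Y X.
Proof.
move=> mj h; have [Z [p [_ [hp _] e]]] := ses_sub mj.
rewrite (hom_cov Y mj hp e) -[RHS]addn0; congr (_ + _)%N; apply/eqP.
rewrite dimv_eq0 -subv0; apply/subvP => _ /memv_imgP[f /mem_homsp hf ->].
rewrite memv0 postcE; apply/eqP/lfunP => x; rewrite !lfE; apply/eqP.
rewrite -memv_ker -e; apply: (subvP (h f hf)).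
by apply/mem_limgP; exists x.
Qed.

Definition semisimple s (M : fmodule H s) : Prop :=
  forall V : {vspace M}, submodule V -> exists W : {vspace M},
    [/\ submodule W, (V + W)%VS = fullv & (V :&: W)%VS = 0%VS].

Lemma semisimple_sub s (M N : fmodule H s) (j : 'Hom(N, M)) :
  mono j -> semisimple M -> semisimple N.
Proof.
move=> [hj /lker_eq0P ij] sM V hV; have [W [hW VW1 VW0]] := sM _ (submodule_img hj hV).
exists (j @^-1: W)%VS; split; first exact: submodule_pre.
  apply/eqP; rewrite eqEsubv subvf; apply/subvP => x _.
  have : j x \in (j @: V + W)%VS by rewrite VW1 memvf.
  case/memv_addP => _ /memv_imgP[v Vv ->] [w Ww jx].
  apply/memv_addP; exists v => //; exists (x - v); last by rewrite addrC subrK.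
  by rewrite -memv_preim linearB /= jx addrAC subrr add0r.
apply/eqP; rewrite -subv0; apply/subvP => x; rewrite memv_cap -memv_preim => /andP[Vx Wx].
have : j x \in (j @: V :&: W)%VS by rewrite memv_cap memv_img.
rewrite VW0 !memv0 => /eqP jx; apply/eqP; apply: ij; rewrite jx linear0 //.
Qed.

Lemma semisimple_split s (X' M X'' : fmodule H s) (j : 'Hom(X', M)) (p : 'Hom(M, X'')) :
  semisimple M -> ses j p -> sum_of X' X'' M.
Proof.
move=> sM S; have [mj [hp sp] e] := S; have [hj _] := mj.
have [W [hW VW1 VW0]] := sM _ (submodule_limg hj).
have [Y [k [mk ek]]] := sub_ex hW; have [hk /lker_eq0P ik] := mk.
have mpk : mono (p \o k)%VF.
  split; first exact: is_hom_comp.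
  apply/lker_eq0P => x y /eqP; rewrite !lfE -subr_eq0 -!linearB /= -memv_ker -e => xy.
  have : k (x - y) \in (limg j :&: W)%VS.
    by rewrite memv_cap xy -ek; apply/mem_limgP; exists (x - y).
  rewrite VW0 memv0 => /eqP kxy; apply/eqP; rewrite -subr_eq0; apply/eqP/ik.
  by rewrite kxy linear0.
have epk : epi (p \o k)%VF.
  split; first exact: is_hom_comp.
  apply/limg_fullP => y; have /limg_fullP/(_ y)[x <-] := sp.
  have : x \in (limg j + W)%VS by rewrite VW1 memvf.
  case/memv_addP => _ /mem_limgP[x' ->] [w]; rewrite -ek => /mem_limgP[t ->] ->.
  by exists t; rewrite lfE linearD /= (ses_comp0 _ e) add0r.
have [g [[hg _] _ _ /lcompP gK]] := iso_inv mpk epk.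
have Sp : split_by (k \o g)%VF p.
  split=> //; first exact: is_hom_comp.
  by apply/lcompP => x; have := gK x; rewrite !lfE.
by have [r b] := split_section S Sp; exists j, r, (k \o g)%VF, p.
Qed.

(** A minimal supplement [W] of [V] meets it trivially: a nonzero element of the
    intersection is avoided by a maximal submodule, which would cut [W] down. *)
Lemma semisimple_of_maximal s (M : fmodule H s) :
  (forall x : M, x <> 0 -> exists2 U : {vspace M}, maximal_sub U & x \notin U) ->
  semisimple M.
Proof.
move=> rad0 V hV.
have [|W [hW VW] Wmin] := @min_vspace K M
  (fun W => submodule W /\ (V + W)%VS = fullv) fullv.
  split; first exact: submodulef.
  by apply/eqP; rewrite eqEsubv subvf addvSr.
exists W; split=> //; apply/eqP; rewrite -subv0; apply/subvP => x; rewrite memv_cap.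
move=> /andP[Vx Wx]; rewrite memv0; apply/negP => /negP/eqP x0.
have [U [hU Uf Umax] xU] := rad0 x x0.
have [||e|e] := Umax (U + (V :&: W))%VS.
- by apply: submoduleD => //; exact: submoduleI.
- exact: addvSl.
- move/negP: xU; apply; rewrite -e; apply: (subvP (addvSr _ _)).
  by rewrite memv_cap Vx.
have [] : submodule (W :&: U)%VS /\ (V + (W :&: U))%VS = fullv.
  split; first exact: submoduleI.
  apply/eqP; rewrite eqEsubv subvf; apply/subvP => t _.
  have : t \in (V + W)%VS by rewrite VW memvf.
  case/memv_addP => v Vv [w Ww ->].
  have : w \in (U + (V :&: W))%VS by rewrite e memvf.
  case/memv_addP => u Uu [v' + wE]; rewrite memv_cap => /andP[Vv' Wv'].
  apply/memv_addP; exists (v + v'); first exact: memvD.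
  exists u; last by rewrite wE -addrA [u + v']addrC.
  by rewrite memv_cap Uu andbT -[u](addrK v') -wE memvB.
move=> h1 h2; have := Wmin _ (conj h1 h2).
move=> le; have /eqP eW : (W :&: U == W)%VS by rewrite eqEdim capvSl le.
by move/negP: xU; apply; move: Wx; rewrite -eW memv_cap => /andP[].
Qed.

(** A maximal submodule [W] meeting [V] trivially is a supplement of [V]: a simple
    submodule outside [V + W] would enlarge [W]. *)
Lemma semisimple_of_simples s (M : fmodule H s) :
  (forall U : {vspace M}, submodule U -> U <> fullv ->
     exists (N : fmodule H s) (k : 'Hom(N, M)),
       [/\ simple N, mono k & ~~ (limg k <= U)%VS]) ->
  semisimple M.
Proof.
move=> gen V hV.
have [|W [hW VW] Wmax] := @max_vspace K M
  (fun W => submodule W /\ (V :&: W)%VS = 0%VS) 0%VS.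
  by split; [exact: submodule0|rewrite capv0].
exists W; split=> //; apply: contrapT => VWf.
have hVW := submoduleD hV hW.
have [N [k [[N0 sN] mk kVW]]] := gen _ hVW VWf; have [hk _] := mk.
have kVW0 x : k x \in (V + W)%VS -> k x = 0.
  have [e|e] := sN _ (submodule_pre hk hVW).
    by rewrite memv_preim e memv0 => /eqP->; rewrite linear0.
  case/negP: kVW; apply/subvP => _ /mem_limgP[y ->].
  by rewrite memv_preim e memvf.
have [] : submodule (W + limg k)%VS /\ (V :&: (W + limg k))%VS = 0%VS.
  split; first by apply: submoduleD => //; exact: submodule_limg.
  apply/eqP; rewrite -subv0; apply/subvP => v; rewrite memv_cap => /andP[Vv].
  case/memv_addP => w Ww [_ /mem_limgP[x ->] vE].
  have kx : k x = 0.
    apply: kVW0; rewrite -[k x](addKr w) -vE; apply/memv_addP.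
    by exists v => //; exists (- w); rewrite ?memvN // addrC.
  by rewrite -VW memv_cap Vv vE kx addr0 Ww.
move=> h1 h2; have le := Wmax _ (conj h1 h2).
have /eqP eW : (W == W + limg k)%VS by rewrite eqEdim addvSl le.
case/negP: kVW; apply: (subv_trans (addvSr W (limg k))); rewrite -eW; exact: addvSr.
Qed.

(** * Tops and socles *)

(** Among the submodules that contain the radical as a set, a smallest one lies in
    every maximal submodule. *)
Lemma is_top_ex (M : fmodule H Right) : exists T, is_top M T.
Proof.
pose rad x := forall U : {vspace M}, maximal_sub U -> x \in U.
have [|U [hU radU] Umin] := @min_vspace K M
  (fun U => submodule U /\ forall x, rad x -> x \in U) fullv.
  by split=> [|x _]; [exact: submodulef|rewrite memvf].
have [T [p [ep kp]]] := quo_ex hU; exists T, p => // x; rewrite kp; split.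
  move=> Ux V hV Vf Vmax; have mV : maximal_sub V by split.
  have [] : submodule (U :&: V)%VS /\ forall y, rad y -> y \in (U :&: V)%VS.
    split; first exact: submoduleI.
    by move=> y ry; rewrite memv_cap radU //= ry.
  move=> h1 h2; have le := Umin _ (conj h1 h2).
  have /eqP e : (U :&: V == U)%VS by rewrite eqEdim capvSl le.
  by move: Ux; rewrite -e memv_cap => /andP[].
by move=> h; apply: radU => V [hV Vf Vmax]; exact: h.
Qed.

Lemma is_soc_ex (M : fmodule H Right) : exists T, is_soc M T.
Proof.
pose allS (U : {vspace M}) := forall (N : fmodule H Right) (k : 'Hom(N, M)),
  simple N -> mono k -> (limg k <= U)%VS.
have [|U [hU allU] Umin] := @min_vspace K M (fun U => submodule U /\ allS U) fullv.
  by split=> [|N k _ _]; [exact: submodulef|exact: subvf].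
have [T [j [mj ej]]] := sub_ex hU; exists T, j => // V hV; rewrite ej; split.
  by move=> UV N k sN mk; apply: subv_trans UV; exact: allU.
move=> allV; have [] : submodule (U :&: V)%VS /\ allS (U :&: V)%VS.
  split; first exact: submoduleI.
  by move=> N k sN mk; rewrite subv_cap allU ?allV.
move=> h1 h2; have le := Umin _ (conj h1 h2).
have /eqP <- : (U :&: V == U)%VS by rewrite eqEdim capvSl le.
exact: capvSr.
Qed.

Lemma top_semisimple (M T : fmodule H Right) : is_top M T -> semisimple T.
Proof.
move=> [p [hp sp] rad]; apply: semisimple_of_maximal => x x0.
have /limg_fullP/(_ x)[y xy] := sp.
have [U [mU yU]] : exists U : {vspace M}, maximal_sub U /\ y \notin U.
  apply: contrapT => no; apply: x0; rewrite -xy; apply/eqP; rewrite -memv_ker.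
  apply/rad => U hU Uf Umax; apply: contrapT => /negP yU; apply: no.
  by exists U.
have [hU Uf Umax] := mU.
have kU : (lker p <= U)%VS.
  by apply/subvP => z /rad; apply=> //; exact: Umax.
have memU z : p z \in (p @: U)%VS -> z \in U.
  move/memv_imgP => [u Uu pz]; rewrite -[z](subrK u) memvD //.
  by apply: (subvP kU); rewrite memv_ker linearB /= pz subrr.
exists (p @: U)%VS; last by apply/negP; rewrite -xy => /memU; apply/negP.
split; first exact: submodule_img.
  move=> e; apply: Uf; apply/eqP; rewrite eqEsubv subvf; apply/subvP => z _.
  by apply: memU; rewrite e memvf.
move=> V hV UV; have [||e|e] := Umax (p @^-1: V)%VS; first exact: submodule_pre.
- apply/subvP => u Uu; rewrite -memv_preim; apply: (subvP UV); exact: memv_img.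
- left; rewrite -e lpreimK // sp subvf //.
right; apply/eqP; rewrite eqEsubv subvf; apply/subvP => t _.
by have /limg_fullP/(_ t)[z <-] := sp; rewrite memv_preim e memvf.
Qed.

Lemma top_hdim (M T N : fmodule H Right) : is_top M T -> simple N -> hdim M N = hdim T N.
Proof.
move=> [p ep rad] sN; apply: hdim_factor_epi ep _ => f hf.
have [->|f0] := pselect (f = 0).
  by apply/subvP => x _; rewrite memv_ker lfE.
have [hU Uf Umax] := simple_maximal (simple_epi sN hf f0) sN.
by apply/subvP => x /rad; apply.
Qed.

Lemma soc_semisimple (M T : fmodule H Right) : is_soc M T -> semisimple T.
Proof.
move=> [j mj soc]; have [hj /lker_eq0P ij] := mj.
apply: semisimple_of_simples => U hU Uf; apply: contrapT => no; apply: Uf.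
have : (limg j <= j @: U)%VS.
  apply/(soc _ (submodule_img hj hU)) => N k sN mk; have [hk _] := mk.
  have kj : (limg k <= limg j)%VS by have [h _] := soc _ (submodule_limg hj); exact: h.
  have [g hg gE] := factor_mono mj hk kj; have [_ /lker_eq0P ik] := mk.
  have mg : mono g.
    split=> //; apply/lker_eq0P => x y e; apply: ik.
    by rewrite gE !lfE e.
  rewrite gE limg_comp; apply: limgS; apply: contrapT => /negP gU.
  by apply: no; exists N, g.
move=> sub; apply/eqP; rewrite eqEsubv subvf; apply/subvP => x _.
have : j x \in (j @: U)%VS by apply: (subvP sub); apply/mem_limgP; exists x.
by case/memv_imgP => u Uu /ij ->.
Qed.

Lemma soc_hdim (M T N : fmodule H Right) : is_soc M T -> simple N -> hdim N M = hdim N T.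
Proof.
move=> [j mj soc] sN; have [hj _] := mj; apply: hdim_factor_mono mj _ => f hf.
have [->|f0] := pselect (f = 0).
  by apply/subvP => _ /mem_limgP[x ->]; rewrite lfE mem0v.
have [h _] := soc _ (submodule_limg hj); apply: h => //; exact: simple_mono.
Qed.

(** A map from [P] to a simple module that is nonzero on the kernel of [p] would have a
    kernel supplementing it. *)
Lemma cover_hdim s (M P N : fmodule H s) (p : 'Hom(P, M)) :
  epi p -> superfluous_kernel p -> simple N -> hdim P N = hdim M N.
Proof.
move=> ep sup sN; apply: hdim_factor_epi (ep) _ => f hf.
apply: contrapT => nsub; have [N0 sN'] := sN; have [hp _] := ep.
have [e|e] := sN' _ (submodule_img hf (submodule_ker hp)).
  apply: nsub; apply/subvP => x kx; rewrite memv_ker -memv0 -e memv_img //.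
suff kf : lker f = fullv by apply: nsub; rewrite kf subvf.
apply: sup; first exact: submodule_ker.
apply/eqP; rewrite eqEsubv subvf; apply/subvP => x _.
have : f x \in (f @: lker p)%VS by rewrite e memvf.
case/memv_imgP => z kz fx; apply/memv_addP; exists (x - z).
  by rewrite memv_ker linearB /= fx subrr.
by exists z; rewrite ?subrK.
Qed.

End Semisimple.

(** * Pairing g-vectors with modules *)

Section GVectors.
Variables (K : fieldType) (H : falgType K) (n : nat) (S : 'I_n -> fmodule H Right).
Hypothesis simS : is_simples S.
Implicit Types M N X : fmodule H Right.

Lemma simpleS i : simple (S i).
Proof. by case: simS. Qed.

Lemma schur i j : i != j -> hdim (S i) (S j) = 0%N.
Proof.
move=> ij; have [_ inj _] := simS; apply/hom_zeroP => f hf; apply: contrapT => f0.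
move/negP: ij; apply; apply/eqP/inj; exists f; split.
  exact: simple_mono (simpleS i) hf f0.
exact: simple_epi (simpleS j) hf f0.
Qed.

Lemma endS_gt0 i : (0 < hdim (S i) (S i))%N.
Proof. by apply: hom_self; case: (simpleS i). Qed.

Lemma comp_factors_ex M : exists s, comp_factors S M s.
Proof.
have [k] := ubnP (\dim {: M}); elim: k M => // k IH M leM.
have [M0|M0] := pselect (zero_module M); first by exists [::]; constructor.
have [U mU] := maximal_sub_ex M0; have [hU _ _] := mU.
have [X [p [ep kp]]] := quo_ex hU.
have sX : simple X by apply: maximal_quotient ep _; rewrite kp.
have [i [f [mf ef]]] : exists i, iso X (S i) by case: simS => _ _; exact.
have [M' [j sj]] := ses_quo (epi_comp ep ef).
have [|s cs] := IH M'.
  have := ses_dim sj; have [] := simpleS i; rewrite /zero_module.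
  by move=> /eqP; rewrite -lt0n => ? _ ?; lia.
have [mj e1 e2] := sj; exists (i :: s).
exact: comp_factorsS mj e1 e2 cs.
Qed.

Lemma dimvP M : exists2 s, comp_factors S M s & dimv S M = \row_i (count_mem i s : int).
Proof.
have [s cs] := comp_factors_ex M.
exact: (@xgetPex _ 0 [set d : 'rV[int]_n | exists2 s : seq 'I_n,
    comp_factors S M s & d = \row_i (count_mem i s : int)]%classic
    (ex_intro _ _ (ex_intro2 _ _ s cs erefl))).
Qed.

Lemma big_count (V : nmodType) (s : seq 'I_n) (phi : 'I_n -> V) :
  \sum_(i <- s) phi i = \sum_i phi i *+ count_mem i s.
Proof.
elim: s => [|x s IH]; first by rewrite big_nil big1.
rewrite big_cons IH (bigD1 x) //= [in RHS](bigD1 x) //= eqxx mulrnDr mulr1n addrA.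
congr (_ + _); apply: eq_bigr => i ix.
by rewrite eq_sym (negbTE ix) add0n.
Qed.

Lemma count_hdim (s : seq 'I_n) i :
  (\sum_(k <- s) hdim (S k) (S i) = count_mem i s * hdim (S i) (S i))%N /\
  (\sum_(k <- s) hdim (S i) (S k) = count_mem i s * hdim (S i) (S i))%N.
Proof.
elim: s => [|x s [IH1 IH2]]; first by rewrite !big_nil.
rewrite !big_cons IH1 IH2 /= mulnDl; have [->|xi] := eqVneq x i.
  by rewrite mul1n.
have ix : i != x by rewrite eq_sym.
by rewrite (schur xi) (schur ix).
Qed.

Lemma semisimple_hdim M s : comp_factors S M s -> semisimple M -> forall Y,
  hdim M Y = (\sum_(k <- s) hdim (S k) Y)%N /\ hdim Y M = (\sum_(k <- s) hdim Y (S k))%N.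
Proof.
elim=> [{}M M0 _ Y|M' {}M i {}s j p mj ep e cs IH sM Y].
  by rewrite !big_nil hom_from0 // hom_to0.
have S' := semisimple_split sM (And3 mj ep e).
have [h1 h2] := IH (semisimple_sub mj sM) Y.
by rewrite (sum_of_hom S').1 (sum_of_hom S').2 !big_cons h1 h2 addnC [in X in _ /\ X]addnC.
Qed.

Section Additive.
Variable R : realType.

Definition additive_fun (phi : fmodule H Right -> R) : Prop :=
  forall X' X X'' (j : 'Hom(X', X)) (p : 'Hom(X, X'')), ses j p -> phi X = phi X' + phi X''.

Lemma additive_zero phi Z : additive_fun phi -> zero_module Z -> phi Z = 0.
Proof.
move=> ad z; have [j1 [p1 [j2 [p2 /biprod_ses/ad /eqP]]]] := sum_of_0 Z z.
by rewrite -subr_eq subrr => /eqP <-.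
Qed.

Lemma additive_comp phi M s : additive_fun phi -> comp_factors S M s ->
  phi M = \sum_(k <- s) phi (S k).
Proof.
move=> ad; elim=> [{}M M0|M' {}M i {}s j p mj ep e cs IH].
  by rewrite big_nil additive_zero.
by rewrite big_cons -IH (ad _ _ _ _ _ (And3 mj ep e)) addrC.
Qed.

Lemma projective_additive (P : fmodule H Right) : projective P ->
  additive_fun (fun X => (hdim P X)%:R).
Proof. by move=> pP X' X X'' j p /(projective_hdim pP) ->; rewrite natrD. Qed.

(** A projective cover of [S k] detects the composition factors [S k]. *)
Lemma simple_cover k : exists P : fmodule H Right,
  projective P /\ forall i, hdim P (S i) = hdim (S k) (S i).
Proof.
have [P [p [pP ep sup]]] := projective_cover (S k).
by exists P; split=> // i; exact: cover_hdim ep sup (simpleS i).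
Qed.

Definition simple_cover_of k : fmodule H Right := projT1 (cid (simple_cover k)).

(** The multiplicity of [S k] in [X] times the dimension of the endomorphism ring of
    [S k] ([weight_comp]); as a dimension of homomorphisms it is visibly additive. *)
Definition weight k X : R := (hdim (simple_cover_of k) X)%:R.

Lemma weight_additive k : additive_fun (weight k).
Proof.
apply: projective_additive; rewrite /simple_cover_of.
by case: cid => P [].
Qed.

Lemma weight_simple k i : weight k (S i) = (hdim (S k) (S i))%:R.
Proof. by rewrite /weight /simple_cover_of; case: cid => P [_ /= ->]. Qed.

Lemma weight_ge0 k X : 0 <= weight k X.
Proof. exact: ler0n. Qed.

Lemma weight_comp k X s : comp_factors S X s ->
  weight k X = (count_mem k s)%:R * (hdim (S k) (S k))%:R.
Proof.
move=> cs; rewrite (additive_comp (weight_additive k) cs).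
under eq_bigr do rewrite weight_simple.
by rewrite -natr_sum (count_hdim s k).2 natrM.
Qed.

Lemma weight_gt0 X : ~ zero_module X -> 0 < \sum_k weight k X.
Proof.
move=> X0; rewrite lt_def sumr_ge0; last by move=> *; exact: weight_ge0.
rewrite andbT; apply/eqP => w0; have [[|i s] cs] := comp_factors_ex X.
  by inversion cs.
have /eqP : weight i X = 0.
  apply/eqP; move/eqP: w0; rewrite psumr_eq0; last by move=> *; exact: weight_ge0.
  by move/allP => /(_ i); rewrite mem_index_enum => /(_ isT).
rewrite (weight_comp i cs) /= eqxx -natrM pnatr_eq0 muln_eq0 /=.
by have := endS_gt0 i; case: (hdim _ _).
Qed.

(** Sum over a composition series of [X]; the weights count its factors. *)
Lemma additive_expand phi X : additive_fun phi ->
  phi X = \sum_k phi (S k) / (hdim (S k) (S k))%:R * weight k X.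
Proof.
move=> ad; have [s cs] := comp_factors_ex X; rewrite (additive_comp ad cs) big_count.
apply: eq_bigr => k _; rewrite (weight_comp k cs) -[LHS]mulr_natr.
have : (hdim (S k) (S k))%:R != 0 :> R by rewrite pnatr_eq0 -lt0n endS_gt0.
by move=> f0; field.
Qed.

(** Homomorphisms between a module and a simple one only see its top, or its socle,
    and these are semisimple. *)
Lemma gvec_coord (p : mpair H) i :
  gvec S R p 0 i * (hdim (S i) (S i))%:R = (hdim p.1 (S i))%:R - (hdim (S i) p.2)%:R.
Proof.
have [T tT] := is_top_ex p.1; have [T' sT'] := is_soc_ex p.2.
rewrite /gvec mxE /gvecZ; case: xgetP => [v _|/(_ (dimv S T - dimv S T'))[]]; last first.
  by exists T, T'.
move=> [{}T [{}T' [{}tT {}sT' ->]]].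
have [s cs ->] := dimvP T; have [s' cs' ->] := dimvP T'.
rewrite (top_hdim tT (simpleS i)) (soc_hdim sT' (simpleS i)).
rewrite (semisimple_hdim cs (top_semisimple tT) (S i)).1.
rewrite (semisimple_hdim cs' (soc_semisimple sT') (S i)).2.
rewrite (count_hdim s i).1 (count_hdim s' i).2 !natrM -mulrBl !mxE; congr (_ * _).
by rewrite intrD intrN.
Qed.

(** The pairing of [v] with the class of [X], weighted by the dimensions of the
    endomorphism rings of the simple modules. *)
Definition gform (v : 'rV[R]_n) X : R := \sum_k v 0 k * weight k X.

Lemma gform_additive v : additive_fun (gform v).
Proof.
move=> X' X X'' j p sj; rewrite /gform -big_split; apply: eq_bigr => k _.
by rewrite (weight_additive k sj) mulrDr.
Qed.

Hypothesis her : hereditary_on H Right.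

(** The pairing of the g-vector of [(A, B)] with [X] is the dimension of [Hom(A, X)]
    minus that of [Hom(X, B)]: the difference is additive in [X] because [B] is the
    sum of the translate of [A] and an injective module. *)
Lemma gform_balanced (p : mpair H) X : balanced p ->
  gform (gvec S R p) X = (hdim p.1 X)%:R - (hdim X p.2)%:R.
Proof.
move=> [_ [T [I [tT iI /dsum_boolP /= ST]]] _].
pose phi Y : R := (euler_form p.1 Y)%:~R - (hdim Y I)%:R.
have phiE Y : (hdim p.1 Y)%:R - (hdim Y p.2)%:R = phi Y.
  rewrite /phi (sum_of_hom ST).2 natrD; have := is_tau_hdim her tT Y.
  move=> /(congr1 (fun z : int => z%:~R : R)); rewrite intrD intrN => e.
  have -> : (hdim Y T)%:R = (hdim p.1 Y)%:R - (euler_form p.1 Y)%:~R :> R := e.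
  by ring.
have ad : additive_fun phi.
  move=> X' X1 X'' j q sj; rewrite /phi (euler_form_addr her p.1 sj).
  by rewrite (injective_hdim iI sj) natrD intrD; ring.
rewrite phiE (additive_expand X ad) /gform; apply: eq_bigr => k _; congr (_ * _).
have f0 : (hdim (S k) (S k))%:R != 0 :> R by rewrite pnatr_eq0 -lt0n endS_gt0.
by apply: (mulIf f0); rewrite divfK // gvec_coord phiE.
Qed.

End Additive.

Lemma comp_factors_iso M N s : iso M N -> comp_factors S M s -> comp_factors S N s.
Proof.
move=> i cs; case: cs i => [{}M M0|M' {}M k {}s j p mj ep e cs] i.
  by constructor; exact: zero_iso i M0.
have [f [mf ef]] := i; have [g [mg eg gf fg]] := iso_inv mf ef.
have [_ /lker_eq0P ig] := mg.
apply: (comp_factorsS (mono_comp mj mf) (epi_comp eg ep)) cs.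
apply/vspaceP => y; rewrite memv_ker lfE -memv_ker -e.
apply/idP/idP => [/mem_limgP[x ->]|/mem_limgP[x gy]].
  rewrite lfE; have /lcompP/(_ (j x)) := gf; rewrite lfE => ->.
  by apply/mem_limgP; exists x.
apply/mem_limgP; exists x; rewrite lfE -gy.
by have /lcompP/(_ y) := fg; rewrite lfE.
Qed.

Lemma dimv_iso M N : iso M N -> dimv S M = dimv S N.
Proof.
move=> i; rewrite /dimv; congr xget; apply/seteqP; split=> d [s cs ->]; exists s => //.
  exact: comp_factors_iso i cs.
exact: comp_factors_iso (iso_sym i) cs.
Qed.

Lemma stab_iso (R : realType) M N : iso M N -> stab S R M = stab S R N.
Proof.
have half A B v : iso A B -> stab S R A v -> stab S R B v.
  move=> i [v0 vs]; split; first by rewrite /dimvR -(dimv_iso i).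
  move=> M' j mj; have [f [mf _]] := iso_sym i.
  exact: vs (mono_comp mj mf).
by move=> i; apply/seteqP; split=> v; apply: half => //; exact: iso_sym.
Qed.

End GVectors.

(** * Dropping a summand of a direct sum *)

Section Jasso.
Variables (K : fieldType) (H : falgType K).
Implicit Types s : side.

Lemma dsum_hom_zero s (I : finType) (F : I -> fmodule H s) (M X : fmodule H s) : dsum F M ->
  (hom_zero M X <-> forall i, hom_zero (F i) X) /\ (hom_zero X M <-> forall i, hom_zero X (F i)).
Proof.
move=> [j [p [hj hp e1 e2 e]]]; split; split.
- move=> h i f hf; apply/lfunP => x; have := h _ (is_hom_comp (hp i) hf).
  by move=> /lfunP/(_ (j i x)); rewrite !lfE e1.
- move=> h f hf; apply/lfunP => x; rewrite (e x) linear_sum lfE big1 // => i _.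
  by have /lfunP/(_ (p i x)) := h i _ (is_hom_comp (hj i) hf); rewrite !lfE.
- move=> h i f hf; apply/lfunP => x; have := h _ (is_hom_comp hf (hj i)).
  by move=> /lfunP/(_ x) /(congr1 (p i)); rewrite !lfE e1 linear0.
- move=> h f hf; apply/lfunP => x; rewrite lfE (e (f x)) big1 // => i _.
  by have /lfunP/(_ x) := h i _ (is_hom_comp hf (hp i)); rewrite !lfE => ->; rewrite linear0.
Qed.

(** The remaining summands make up the kernel of the [i]-th projection. *)
Lemma dsum_drop s (I : finType) (F : I -> fmodule H s) (M : fmodule H s) i : dsum F M ->
  exists M', dsum (fun j : {j : I | j != i} => F (val j)) M'.
Proof.
move=> [j [p [hj hp e1 e2 e]]].
have [M' [k [mk ek]]] := sub_ex (submodule_ker (hp i)); have [hk /lker_eq0P ik] := mk.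
have pk x : p i (k x) = 0.
  by apply/eqP; rewrite -memv_ker -ek; apply/mem_limgP; exists x.
have fac (l : {l : I | l != i}) : exists g : 'Hom(F (val l), M'), is_hom g /\ forall x, k (g x) = j (val l) x.
  have [|g hg gE] := factor_mono mk (hj (val l)).
    apply/subvP => _ /mem_limgP[x ->]; rewrite ek memv_ker e2 //; exact: (valP l).
  by exists g; split=> // x; rewrite gE lfE.
pose g l := projT1 (cid (fac l)).
have hg l : is_hom (g l) by rewrite /g; case: cid => ? [].
have gE l x : k (g l x) = j (val l) x by rewrite /g; case: cid => ? [].
exists M', g, (fun l => (p (val l) \o k)%VF); split=> //.
- by move=> l; exact: is_hom_comp.
- by move=> l x; rewrite lfE gE e1.
- by move=> l m x lm; rewrite lfE gE e2.
move=> x; apply: ik; rewrite linear_sum [LHS]e (bigD1 i) //= pk linear0 add0r.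
under [RHS]eq_bigr do rewrite gE lfE.
exact: (big_sub (fun l => l != i) (fun l => j l (p l (k x)))).
Qed.

Lemma pair_dsum_drop (I : finType) (F : I -> mpair H) p i : pair_dsum F p ->
  exists q, pair_dsum (fun j : {j : I | j != i} => F (val j)) q.
Proof.
by move=> [/(dsum_drop i)[M dM] /(dsum_drop i)[N dN]]; exists (M, N).
Qed.

(** * Simple objects of wide subcategories *)

Definition wide (C : fmodule H Right -> Prop) : Prop :=
  [/\ forall (X Y Z : fmodule H Right) (p : 'Hom(X, Z)) (j : 'Hom(Z, Y)), epi p -> mono j -> C X -> C Y -> C Z,
      forall (X Y Z : fmodule H Right) (j : 'Hom(X, Y)) (p : 'Hom(Y, Z)), ses j p -> C Y -> C Z -> C X &
      forall (X Y Z : fmodule H Right) (j : 'Hom(X, Y)) (p : 'Hom(Y, Z)), ses j p -> C X -> C Y -> C Z].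

Definition endo_division (N : fmodule H Right) : Prop :=
  forall f : 'Hom(N, N), is_hom f -> f <> 0 -> mono f.

Lemma comp_neq0_mono s (X M Y : fmodule H s) (f : 'Hom(X, M)) (j : 'Hom(M, Y)) :
  mono j -> f <> 0 -> (j \o f)%VF <> 0.
Proof.
move=> mj f0 e; apply: f0; apply: (mono_eq mj); rewrite e; apply/lfunP => x.
by rewrite !lfE linear0.
Qed.

Lemma comp_neq0_epi s (X M Y : fmodule H s) (p : 'Hom(X, M)) (f : 'Hom(M, Y)) :
  epi p -> f <> 0 -> (f \o p)%VF <> 0.
Proof.
move=> ep f0 e; apply: f0; apply: (epi_eq ep); rewrite e; apply/lfunP => x.
by rewrite !lfE.
Qed.

Lemma zero_map_to s (M N : fmodule H s) (f : 'Hom(M, N)) : zero_module N -> f = 0.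
Proof.
by move=> /zero_moduleP N0; apply/lfunP => x; rewrite [LHS]N0 [RHS]N0.
Qed.

Lemma ses_comp s (X M Y : fmodule H s) (j : 'Hom(X, M)) (p : 'Hom(M, Y)) :
  ses j p -> (p \o j)%VF = 0.
Proof. by move=> [_ _ e]; apply/lfunP => x; rewrite !lfE (ses_comp0 x e). Qed.

(** If [X -> N] is a mono with [X] nonzero in [C], a composite [N -> X -> N] is nonzero,
    hence invertible. If [N'] is another simple object, the image and the kernel of a
    nonzero map [N -> N'] lie in [C], so that the map is invertible. *)
Lemma unique_simple_source C N : wide C -> C N -> ~ zero_module N -> endo_division N ->
  (forall X, C X -> ~ zero_module X -> hdim N X <> 0%N) -> unique_simple_object C N.
Proof.
move=> [Cim Cker _] CN N0 div src.
have simN (X : fmodule H Right) (j : 'Hom(X, N)) : C X -> mono j -> zero_module X \/ epi j.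
  move=> CX mj; have [z|z] := pselect (zero_module X); [by left|right].
  have [f hf f0] := hom_neq0 (src X CX z); have [hj _] := mj.
  have [_ ejf] := endo_iso (div _ (is_hom_comp hf hj) (comp_neq0_mono mj f0)).
  split=> //; apply/eqP; rewrite eqEsubv subvf -ejf limg_comp; apply: limgS; exact: subvf.
split; first by split.
move=> N' [CN' N'0 simN'].
have [f hf f0] := hom_neq0 (src N' CN' N'0).
have [Y [p [j [ep mj fE _]]]] := image_ex hf.
have CY := Cim _ _ _ _ _ ep mj CN CN'.
have [Y0|ej] := simN' _ _ CY mj.
  by case: f0; rewrite fE (zero_map_to p Y0); apply/lfunP => x; rewrite !lfE linear0.
have [Z [k S]] := ses_quo ep; have CZ := Cker _ _ _ _ _ S CN CY; have [mk _ _] := S.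
have [Z0|ek] := simN _ _ CZ mk.
  apply: iso_sym; exists f; rewrite fE.
  by split; [exact: mono_comp (ses_mono S Z0) mj|exact: epi_comp].
case: f0; apply: (epi_eq ek); rewrite fE -comp_lfunA (ses_comp S).
by apply/lfunP => x; rewrite !lfE linear0.
Qed.

(** Here a nonzero map from the cokernel of [X -> N] to [N] would give an invertible
    endomorphism of [N] that vanishes on [X]. *)
Lemma unique_simple_target C N : wide C -> C N -> ~ zero_module N -> endo_division N ->
  (forall X, C X -> ~ zero_module X -> hdim X N <> 0%N) -> unique_simple_object C N.
Proof.
move=> [Cim Cker Ccok] CN N0 div tgt.
have simN (X : fmodule H Right) (j : 'Hom(X, N)) : C X -> mono j -> zero_module X \/ epi j.
  move=> CX mj; have [Q [p S]] := ses_sub mj; have CQ := Ccok _ _ _ _ _ S CX CN.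
  have [_ ep e] := S; have [hp _] := ep; have [hj _] := mj.
  have [z|z] := pselect (zero_module Q).
    right; split=> //; rewrite e (zero_map_to p z); apply/vspaceP => x.
    by rewrite memv_ker memvf lfE eqxx.
  left; have [f hf f0] := hom_neq0 (tgt Q CQ z).
  have mfp := div _ (is_hom_comp hp hf) (comp_neq0_epi ep f0).
  apply: contrapT => X0; have := comp_neq0_mono mfp (_ : j <> 0); case.
    move=> j0; apply: X0; apply/zero_moduleP => x.
    by have [_ /lker_eq0P ij] := mj; apply: ij; rewrite j0 !lfE.
  by rewrite -comp_lfunA (ses_comp S); apply/lfunP => x; rewrite !lfE linear0.
split; first by split.
move=> N' [CN' N'0 simN'].
have [f hf f0] := hom_neq0 (tgt N' CN' N'0).
have [Y [p [j [ep mj fE _]]]] := image_ex hf.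
have CY := Cim _ _ _ _ _ ep mj CN' CN.
have [Z [k S]] := ses_quo ep; have CZ := Cker _ _ _ _ _ S CN' CY; have [mk _ _] := S.
have [Z0|ek] := simN' _ _ CZ mk.
  have mf : mono f by rewrite fE; exact: mono_comp (ses_mono S Z0) mj.
  by have [//|ef] := simN _ _ CN' mf; exists f.
case: f0; apply: (epi_eq ek); rewrite fE -comp_lfunA (ses_comp S).
by apply/lfunP => x; rewrite !lfE linear0.
Qed.

End Jasso.

(** * Opposite walls of the upper and lower chambers *)

Section Walls.
Variables (K : fieldType) (H : falgType K) (n : nat) (S : 'I_n -> fmodule H Right).
Hypotheses (simS : is_simples S) (her : hereditary_on H Right).
Variables (R : realType) (T : 'I_n -> mpair H) (i : 'I_n).
Hypothesis compT : complete_balanced T.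
Implicit Types X Y Z : fmodule H Right.

(** The pairings of [X] with the [j]-th g-vector ([G_gform]) and with [eta], and the
    Jasso category of the members of [T] other than the [i]-th. *)
Let G j X : R := (hdim (T j).1 X)%:R - (hdim X (T j).2)%:R.
Let W X : R := \sum_k weight simS R k X.
Let J X : Prop := forall j, j != i -> hdim (T j).1 X = 0%N /\ hdim X (T j).2 = 0%N.

Lemma indecT j : indec_balanced (T j). Proof. by case: compT. Qed.

Lemma G_gform j X : gform simS (gvec S R (T j)) X = G j X.
Proof. by apply: gform_balanced => //; case: (indecT j). Qed.

Lemma G_additive j : additive_fun (G j).
Proof.
move=> X' X X'' u p sp; rewrite -!G_gform.
exact: (gform_additive simS _ sp).
Qed.

Lemma hdimT j k : hdim (T j).1 (T k).2 = 0%N.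
Proof.
have [_ _ [p [d1 d2] [h0 _ _]]] := compT; apply/hom_zeroP.
have [h1 _] := (dsum_hom_zero p.2 d1).1; have h2 := h1 h0 j.
by have [h3 _] := (dsum_hom_zero (T j).1 d2).2; exact: h3 h2 k.
Qed.

Lemma W_gt0 X : ~ zero_module X -> 0 < W X.
Proof. exact: weight_gt0. Qed.

Lemma gform_chamber v : std_open_chamber S R T v ->
  exists2 r : 'I_n -> R, forall j, 0 < r j & forall X, gform simS v X = \sum_j r j * G j X.
Proof.
move=> [r r0 ->]; exists r => // X; rewrite /gform.
under eq_bigr => k _ do rewrite summxE mulr_suml.
rewrite exchange_big; apply: eq_bigr => j _; rewrite -G_gform /gform mulr_sumr.
by apply: eq_bigr => k _; rewrite mxE mulrA.
Qed.

(** For kernels and cokernels one of the two vanishing conditions is inherited, and the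
    other follows as [G k] is additive. *)
Lemma J_wide : wide J.
Proof.
split.
- move=> X Y Z p j ep mj JX JY k ki; have [a _] := JY k ki; have [_ b] := JX k ki.
  have [X' [j' s1]] := ses_quo ep; have [Y' [p' s2]] := ses_sub mj.
  have [l1 _ _ _] := hom_ses_le (T k).1 s2; have [_ _ l2 _] := hom_ses_le (T k).2 s1.
  by move: l1 l2; rewrite a b; lia.
- move=> X Y Z j p s JY JZ k ki; have [a b] := JY k ki; have [a' b'] := JZ k ki.
  have [l1 _ _ _] := hom_ses_le (T k).1 s; have a0 : hdim (T k).1 X = 0%N by lia.
  split=> //; have := G_additive k s; rewrite /G a b a' b' a0 !subrr addr0 sub0r.
  by move/esym/eqP; rewrite oppr_eq0 pnatr_eq0 => /eqP.
move=> X Y Z j p s JX JY k ki; have [a b] := JX k ki; have [a' b'] := JY k ki.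
have [_ _ l1 _] := hom_ses_le (T k).2 s; have b0 : hdim Z (T k).2 = 0%N by lia.
split=> //; have := G_additive k s; rewrite /G a b a' b' b0 !subrr add0r subr0.
by move/esym/eqP; rewrite pnatr_eq0 => /eqP.
Qed.

Section Upper.
Let A := (T i).1.
Hypothesis A0 : ~ zero_module A.
Variables (e : R) (r : 'I_n -> R).
Hypotheses (e0 : 0 < e) (r0 : forall j, 0 < r j).
Hypothesis cone : forall X, G i X - e * W X = \sum_j r j * G j X.

(** Otherwise the two sides of [cone] have different signs. *)
Lemma quotient_generated j X (q : 'Hom((T j).1, X)) : epi q -> hdim A X = 0%N -> zero_module X.
Proof.
move=> eq_ hA; apply: contrapT => /W_gt0 WX.
have hB k : hdim X (T k).2 = 0%N.
  have [X' [u s]] := ses_quo eq_; have [_ _ l _] := hom_ses_le (T k).2 s.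
  by move: l; rewrite hdimT; lia.
have : G i X - e * W X < 0.
  by rewrite /G hA hB subrr sub0r oppr_lt0 mulr_gt0.
rewrite cone ltNge sumr_ge0 // => k _; apply: mulr_ge0; first exact: ltW.
by rewrite /G hB subr0.
Qed.

(** Let [Z] be the trace of [A] in [M = (T j).1]. Both [Hom(M, B)] and [Hom(Z, B)] vanish
    for [B = (T i).2], the latter because [Hom(A, B) = 0]; so additivity of [G i] and
    [hom(A, M) = hom(A, Z)] give [Hom(A, M/Z) = 0]. *)
Lemma trace_full j Y (f : 'Hom((T j).1, Y)) : is_hom f -> f <> 0 ->
  exists2 g : 'Hom(A, (T j).1), is_hom g & (f \o g)%VF <> 0.
Proof.
move=> hf f0; set M := (T j).1 in f hf f0 *.
pose inU (U : {vspace M}) := forall g : 'Hom(A, M), is_hom g -> (limg g <= U)%VS.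
have [|U [hU allU] Umin] := @min_vspace K M (fun U => submodule U /\ inU U) fullv.
  by split=> [|g _]; [exact: submodulef|exact: subvf].
have subU V : submodule V -> inU V -> (U <= V)%VS.
  move=> hV aV; have [] : submodule (U :&: V)%VS /\ inU (U :&: V)%VS.
    by split=> [|g hg]; [exact: submoduleI|rewrite subv_cap allU ?aV].
  move=> h1 h2; have /eqP <- : (U :&: V == U)%VS by rewrite eqEdim capvSl Umin.
  exact: capvSr.
have [Z [u [mu eu]]] := sub_ex hU; have [X [p s]] := ses_sub mu; have [hu _] := mu.
have [_ ep _] := s.
have hAZ : hdim A M = hdim A Z by apply: hdim_factor_mono mu _ => g hg; rewrite eu allU.
have hZB : hdim Z (T i).2 = 0%N.
  apply/hom_zeroP => h hh.
  have kh : (U <= u @: lker h)%VS.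
    apply: subU => [|g hg]; first by apply: submodule_img => //; exact: submodule_ker.
    have [|g' hg' gE] := factor_mono mu hg; first by rewrite eu allU.
    apply/subvP => _ /mem_limgP[x ->]; rewrite gE lfE memv_img // memv_ker.
    have /hom_zeroP/(_ _ (is_hom_comp hg' hh)) := hdimT i i.
    by move=> /lfunP/(_ x); rewrite !lfE => ->.
  apply/lfunP => z; rewrite lfE; apply/eqP; rewrite -memv_ker.
  have : u z \in (u @: lker h)%VS.
    by apply: (subvP kh); rewrite -eu; apply/mem_limgP; exists z.
  by case/memv_imgP => z' kz; have [_ /lker_eq0P iu] := mu; move/iu => ->.
have hAX : hdim A X = 0%N.
  have [_ _ l _] := hom_ses_le (T i).2 s; have hXB : hdim X (T i).2 = 0%N.
    by move: l; rewrite hdimT; lia.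
  have := G_additive i s; rewrite /G -/A -/M hdimT hAZ hZB hXB !subr0.
  by rewrite -natrD => /eqP; rewrite eqr_nat => /eqP; lia.
have X0 := quotient_generated ep hAX.
apply: contrapT => no; apply: f0; apply/lfunP => x; rewrite lfE; apply/eqP; rewrite -memv_ker.
have Uf : (U <= lker f)%VS.
  apply: subU => [|g hg]; first exact: submodule_ker.
  apply/subvP => _ /mem_limgP[y ->]; rewrite memv_ker; apply/eqP.
  have : (f \o g)%VF = 0 by apply: contrapT => fg; apply: no; exists g.
  by move=> /lfunP/(_ y); rewrite !lfE.
apply: (subvP Uf); have [_ _ ue] := s; rewrite -eu ue memv_ker.
by move/zero_moduleP: X0 => X0; rewrite (X0 (p x)).
Qed.

(** Sequences [0 -> A -> M -> A -> 0] split, by additivity of [G i]. *)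
Lemma top_division : endo_division A.
Proof.
have Ti : indec_balanced (A, (T i).2) by rewrite /A -surjective_pairing; exact: indecT.
have [iA _] := indec_balanced_top her Ti A0.
move=> f; apply: indec_endo_mono => // M j p s.
have hMB : hdim M (T i).2 = 0%N.
  by have [_ _ _] := hom_ses_le (T i).2 s; rewrite hdimT; lia.
have : lifts A p.
  apply/(hom_lifts A s); have := G_additive i s; rewrite /G -/A hMB hdimT !subr0.
  by rewrite -natrD => /eqP; rewrite eqr_nat => /eqP.
move=> /(_ \1%VF) []; first exact: is_hom_id.
by move=> k hk kE; have [_ [hp _] _] := s; exists k.
Qed.

(** A nonzero map [(T j).1 -> A] composes with some map [A -> (T j).1] to an invertible
    endomorphism of [A]. *)
Lemma top_in_J : J A.
Proof.
move=> j ji; split; last exact: hdimT.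
apply/hom_zeroP => f hf; apply: contrapT => f0.
have [g hg fg] := trace_full hf f0.
have mfg := top_division (is_hom_comp hg hf) fg.
have sA : summand A (T j).1 by exact: mono_summand mfg.
have Tj0 : ~ zero_module (T j).1.
  by move=> z; apply: fg; rewrite (zero_map_to g z); apply/lfunP => x; rewrite !lfE linear0.
have Tj : indec_balanced ((T j).1, (T j).2) by rewrite -surjective_pairing; exact: indecT.
have [iAj _] := indec_balanced_top her Tj Tj0.
have iso_A := summand_indec iAj A0 sA.
have [_ inj _] := compT; move/negP: ji; apply; apply/eqP/esym/inj.
exact: indec_balanced_iso_top (indecT i) (indecT j) A0 iso_A.
Qed.

(** On [J] the cone equation reads [(1 - r i) G i X = e W X]; the case [X = A]
    shows that [1 - r i] is positive. *)
Lemma top_source X : J X -> ~ zero_module X -> hdim A X <> 0%N.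
Proof.
have coneJ Y : J Y -> (1 - r i) * G i Y = e * W Y.
  move=> JY; have := cone Y; rewrite (bigD1 i) //= big1 => [|j ji].
    by rewrite addr0 => /eqP; rewrite subr_eq addrC -subr_eq => /eqP <-; rewrite mulrBl mul1r.
  by have [a b] := JY j ji; rewrite /G a b subrr mulr0.
have ri : 0 < 1 - r i.
  have hAA : 0 < G i A by rewrite /G hdimT subr0 ltr0n; exact: hom_self.
  rewrite -(pmulr_lgt0 _ hAA) coneJ; last exact: top_in_J.
  by rewrite mulr_gt0 // W_gt0.
move=> JX X0 hAX; have : 0 < (1 - r i) * G i X by rewrite coneJ // mulr_gt0 // W_gt0.
by rewrite pmulr_rgt0 // /G -/A hAX sub0r oppr_gt0 ltNge ler0n.
Qed.

Lemma top_unique_simple : unique_simple_object J A.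
Proof.
apply: unique_simple_source J_wide top_in_J A0 top_division _.
exact: top_source.
Qed.
End Upper.

Section Lower.
Let B := (T i).2.
Hypothesis B0 : ~ zero_module B.
Variables (e : R) (r : 'I_n -> R).
Hypotheses (e0 : 0 < e) (r0 : forall j, 0 < r j).
Hypothesis cone : forall X, G i X + e * W X = \sum_j r j * G j X.

(** Otherwise the two sides of [cone] have different signs. *)
Lemma sub_cogenerated j X (u : 'Hom(X, (T j).2)) : mono u -> hdim X B = 0%N -> zero_module X.
Proof.
move=> mu hB; apply: contrapT => /W_gt0 WX.
have hA k : hdim (T k).1 X = 0%N.
  have [X' [p s]] := ses_sub mu; have [l _ _ _] := hom_ses_le (T k).1 s.
  by move: l; rewrite hdimT; lia.
have : 0 < G i X + e * W X.
  by rewrite /G hA hB subrr add0r mulr_gt0.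
rewrite cone ltNge sumr_le0 // => k _; apply: mulr_ge0_le0; first exact: ltW.
by rewrite /G hA sub0r oppr_le0.
Qed.

(** Dually to [trace_full], the common kernel [X] of the maps [M -> B], for [M = (T j).2],
    satisfies [Hom(X, B) = 0] by additivity of [G i], and so vanishes. *)
Lemma reject_zero j Y (f : 'Hom(Y, (T j).2)) : is_hom f -> f <> 0 ->
  exists2 g : 'Hom((T j).2, B), is_hom g & (g \o f)%VF <> 0.
Proof.
move=> hf f0; set M := (T j).2 in f hf f0 *.
pose inU (U : {vspace M}) := forall g : 'Hom(M, B), is_hom g -> (U <= lker g)%VS.
have [|U [hU allU] Umax] := @max_vspace K M (fun U => submodule U /\ inU U) 0%VS.
  by split=> [|g _]; [exact: submodule0|exact: sub0v].
have subU V : submodule V -> inU V -> (V <= U)%VS.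
  move=> hV aV; have [] : submodule (U + V)%VS /\ inU (U + V)%VS.
    by split=> [|g hg]; [exact: submoduleD|rewrite subv_add allU ?aV].
  move=> h1 h2; have /eqP eU : (U == U + V)%VS by rewrite eqEdim addvSl Umax.
  rewrite eU; exact: addvSr.
have [X [u [mu eu]]] := sub_ex hU; have [Q [p s]] := ses_sub mu.
have [_ ep kp] := s; have [hp _] := ep.
have hQB : hdim M B = hdim Q B by apply: hdim_factor_epi ep _ => g hg; rewrite -kp eu allU.
have hAQ : hdim (T i).1 Q = 0%N.
  apply/hom_zeroP => h hh.
  have kh : (p @^-1: limg h <= U)%VS.
    apply: subU => [|g hg]; first by apply: submodule_pre => //; exact: submodule_limg.
    have [|g' hg' gE] := factor_epi ep hg; first by rewrite -kp eu allU.
    apply/subvP => x; rewrite -memv_preim memv_ker gE lfE => /mem_limgP[y ->].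
    have /hom_zeroP/(_ _ (is_hom_comp hh hg')) := hdimT i i.
    by move=> /lfunP/(_ y); rewrite !lfE => ->.
  apply/lfunP => z; rewrite lfE; have [_ /limg_fullP/(_ (h z))[x px]] := ep.
  rewrite -px; apply/eqP; rewrite -memv_ker -kp eu; apply: (subvP kh).
  by rewrite -memv_preim px; apply/mem_limgP; exists z.
have hXB : hdim X B = 0%N.
  have [l _ _ _] := hom_ses_le (T i).1 s; have hAX : hdim (T i).1 X = 0%N.
    by move: l; rewrite hdimT; lia.
  have := G_additive i s; rewrite /G -/B -/M hdimT hAX hAQ hQB !sub0r.
  by rewrite -opprD => /oppr_inj; rewrite -natrD => /eqP; rewrite eqr_nat => /eqP; lia.
have X0 := sub_cogenerated mu hXB.
apply: contrapT => no; apply: f0; apply/lfunP => y; rewrite lfE.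
have fU : (limg f <= U)%VS.
  apply: subU => [|g hg]; first exact: submodule_limg.
  apply/subvP => _ /mem_limgP[x ->]; rewrite memv_ker; apply/eqP.
  have : (g \o f)%VF = 0 by apply: contrapT => fg; apply: no; exists g.
  by move=> /lfunP/(_ x); rewrite !lfE.
have : f y \in U by apply: (subvP fU); apply/mem_limgP; exists y.
rewrite -eu => /mem_limgP[x ->].
by move/zero_moduleP: X0 => X0; rewrite (X0 x) linear0.
Qed.

Lemma bottom_division : endo_division B.
Proof.
have Ti : indec_balanced ((T i).1, B) by rewrite /B -surjective_pairing; exact: indecT.
have [iB _] := indec_balanced_bottom her Ti B0.
move=> f; apply: indec_endo_mono => // M j p s.
have hAM : hdim (T i).1 M = 0%N.
  by have [_ l _ _] := hom_ses_le (T i).1 s; move: l; rewrite hdimT; lia.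
have : extends B j.
  apply/(hom_extends B s); have := G_additive i s; rewrite /G -/B hAM hdimT !sub0r.
  by rewrite -opprD => /oppr_inj; rewrite -natrD => /eqP; rewrite eqr_nat => /eqP.
move=> /(_ \1%VF) []; first exact: is_hom_id.
move=> k hk kE; have [[hj _] _ _] := s.
have [u b] := split_retraction s (And3 hj hk (esym kE)).
have [[_ _] [hu hp] [_ eu] _] := b; exists u; split=> //.
by apply/lcompP => x; rewrite eu lfE.
Qed.

Lemma bottom_in_J : J B.
Proof.
move=> j ji; split; first exact: hdimT.
apply/hom_zeroP => f hf; apply: contrapT => f0.
have [g hg fg] := reject_zero hf f0.
have mfg := bottom_division (is_hom_comp hf hg) fg.
have sB : summand B (T j).2 by exact: mono_summand mfg.
have Tj0 : ~ zero_module (T j).2.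
  by move=> z; apply: fg; rewrite (zero_map_to f z); apply/lfunP => x; rewrite !lfE linear0.
have Tj : indec_balanced ((T j).1, (T j).2) by rewrite -surjective_pairing; exact: indecT.
have [iBj _] := indec_balanced_bottom her Tj Tj0.
have iso_B := summand_indec iBj B0 sB.
have [_ inj _] := compT; move/negP: ji; apply; apply/eqP/esym/inj.
exact: indec_balanced_iso_bottom (indecT i) (indecT j) B0 iso_B.
Qed.

(** Here [cone] reads [(r i - 1) G i X = e W X] on [J], and [G i B] is negative. *)
Lemma bottom_target X : J X -> ~ zero_module X -> hdim X B <> 0%N.
Proof.
have coneJ Y : J Y -> (r i - 1) * G i Y = e * W Y.
  move=> JY; have := cone Y; rewrite (bigD1 i) //= big1 => [|j ji].
    by rewrite addr0 mulrBl mul1r => <-; rewrite addrC addKr.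
  by have [a b] := JY j ji; rewrite /G a b subrr mulr0.
have ri : r i - 1 < 0.
  have hBB : G i B < 0 by rewrite /G hdimT sub0r oppr_lt0 ltr0n; exact: hom_self.
  rewrite -(nmulr_lgt0 _ hBB) coneJ; last exact: bottom_in_J.
  by rewrite mulr_gt0 // W_gt0.
move=> JX X0 hXB; have : 0 < (r i - 1) * G i X by rewrite coneJ // mulr_gt0 // W_gt0.
by rewrite nmulr_rgt0 // /G -/B hXB subr0 ltNge ler0n.
Qed.

Lemma bottom_unique_simple : unique_simple_object J B.
Proof.
apply: unique_simple_target J_wide bottom_in_J B0 bottom_division _.
exact: bottom_target.
Qed.
End Lower.

Lemma opposite_wall_of_simple N : unique_simple_object J N -> opposite_wall S T i (stab S R N).
Proof.
move=> uN; have [_ _ [p dp _]] := compT; have [q dq] := pair_dsum_drop i dp.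
have Jq X : jasso q X <-> J X.
  have [d1 d2] := dq; rewrite /jasso (dsum_hom_zero X d1).1 (dsum_hom_zero X d2).2; split.
    move=> [h1 h2] j ji; pose j' : {j | j != i} := exist _ j ji.
    by split; apply/hom_zeroP; [exact: (h1 j')|exact: (h2 j')].
  by move=> h; split=> j'; apply/hom_zeroP; have [] := h (val j') (valP j').
exists q, N; split=> //; case: uN => [[JN N0 simN] uniq]; split.
  split=> //; first exact/Jq.
  by move=> X j /Jq; exact: simN.
move=> N' [/Jq JN' N'0 simN']; apply: uniq; split=> // X j JX; apply: simN'.
exact/Jq.
Qed.

(** The coordinates of a g-vector are determined by dimensions of homomorphisms, by
    [gvec_coord], so isomorphic pairs have the same g-vector. *)
Lemma gform_gvec_iso (p : mpair H) X : pair_iso (T i) p -> gform simS (gvec S R p) X = G i X.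
Proof.
move=> [i1 i2]; rewrite -G_gform; apply: eq_bigr => k _; congr (_ * _).
have f0 : (hdim (S k) (S k))%:R != 0 :> R by rewrite pnatr_eq0 -lt0n endS_gt0.
by apply: (mulIf f0); rewrite !gvec_coord // (hom_iso i1).1 (hom_iso i2).2.
Qed.

Lemma gform_shift v (c : R) X : gform simS (v + c *: eta n R) X = gform simS v X + c * W X.
Proof.
rewrite /gform /W mulr_sumr -big_split; apply: eq_bigr => k _ /=.
by rewrite !mxE mulr1 mulrDl.
Qed.

Lemma upper_opposite_wall (p : mpair H) : pair_iso (T i) p -> ~ zero_module p.1 ->
  upper_chamber S (gvec S R p) (std_open_chamber S R T) ->
  opposite_wall S T i (stab S R p.1).
Proof.
move=> ip p0 [_ _ near].
have [e /= [e0 Ce]] : exists e : R, 0 < e /\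
    std_open_chamber S R T (gvec S R p - e *: eta n R).
  have [e [? ?]] := filter_ex (filterI (nbhs_right_gt (0 : R)) near).
  by exists e.
have [ip1 _] := ip; rewrite -(stab_iso S R ip1); apply: opposite_wall_of_simple.
have [r r0 rE] := gform_chamber Ce.
have A0 : ~ zero_module (T i).1 by move/(zero_iso ip1).
apply: (top_unique_simple A0 e0 r0) => X.
by rewrite -rE -(scaleNr e (eta n R)) gform_shift (gform_gvec_iso X ip) mulNr.
Qed.

Lemma lower_opposite_wall (p : mpair H) : pair_iso (T i) p -> ~ zero_module p.2 ->
  lower_chamber S (gvec S R p) (std_open_chamber S R T) ->
  opposite_wall S T i (stab S R p.2).
Proof.
move=> ip p0 [_ _ near].
have [e /= [e0 Ce]] : exists e : R, 0 < e /\
    std_open_chamber S R T (gvec S R p + e *: eta n R).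
  have [e [? ?]] := filter_ex (filterI (nbhs_right_gt (0 : R)) near).
  by exists e.
have [_ ip2] := ip; rewrite -(stab_iso S R ip2); apply: opposite_wall_of_simple.
have [r r0 rE] := gform_chamber Ce.
have B0 : ~ zero_module (T i).2 by move/(zero_iso ip2).
apply: (bottom_unique_simple B0 e0 r0) => X.
by rewrite -rE gform_shift (gform_gvec_iso X ip).
Qed.

End Walls.

Theorem theorem0p5 : forall (K : fieldType) (H : falgType K) (n : nat)
    (S : 'I_n -> fmodule H Right) (R : realType) (A B : fmodule H Right),
  hereditary H -> is_simples S -> (2 <= n)%N -> indec_balanced (A, B) ->
  (~ zero_module A -> forall (T : 'I_n -> mpair H) (i : 'I_n),
     complete_balanced T -> pair_iso (T i) (A, B) ->
     upper_chamber S (gvec S R (A, B)) (std_open_chamber S R T) ->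
     opposite_wall S T i (stab S R A)) /\
  (~ zero_module B -> forall (T : 'I_n -> mpair H) (i : 'I_n),
     complete_balanced T -> pair_iso (T i) (A, B) ->
     lower_chamber S (gvec S R (A, B)) (std_open_chamber S R T) ->
     opposite_wall S T i (stab S R B)).
Proof.
move=> K H n S R A B her simS _ _; split=> nz T i compT ip ch.
  exact: (upper_opposite_wall simS her compT ip nz ch).
exact: (lower_opposite_wall simS her compT ip nz ch).
Qed.
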